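(* Let $D\subset V=\mathbb{A}^n_{\mathbb{C}}$ be a linear free divisor whose associated group $G$ is reductive. Then the irreducible $G$-modules occurring in a decomposition of $V$ into irreducible $G$-modules are pairwise non-isomorphic, and their number equals the number of irreducible components of $D$.
   Context: Let $V=\mathbb{A}^n_{\mathbb{C}}$ with linear coordinates $x_1,\dots,x_n$ and $D\subset V$ a reduced hypersurface. $\mathrm{Der}(-\log D)$ is the sheaf of vector fields $\delta$ with $\delta(f)\in(f)$ for a local reduced equation $f$ of $D$. $D$ is a linear free divisor if $\mathrm{Der}(-\log D)$ is freely generated over $\mathcal{O}_V$ by globally defined linear vector fields, i.e. fields $\sum_{i,j}a_{ij}x_j\partial/\partial x_i$ with $a_{ij}\in\mathbb{C}$. The associated group $G$ is the largest connected subgroup of $\mathrm{GL}(V)$ preserving $D$. $D$ is called reductive if $G$ is reductive. *)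

(* Defs.v *)
From HB Require Import structures.
From mathcomp Require Import all_boot all_order all_algebra.
From mathcomp Require Import complex mpoly.
From mathcomp Require Import boolp classical_sets functions cardinality reals.

Set Implicit Arguments.
Unset Strict Implicit.
Unset Printing Implicit Defensive.

Import GRing.Theory.
Local Open Scope classical_set_scope.
Local Open Scope ring_scope.

Section ZariskiTopology.
Context {K : closedFieldType}.

Definition zeros m (S : set {mpoly K[m]}) : set 'rV[K]_m :=
  [set v | forall p, S p -> p.@[v 0] = 0].

Definition zariski_closed m (Z : set 'rV[K]_m) : Prop :=
  exists S : set {mpoly K[m]}, Z = zeros S.

Definition zariski_connected m (A : set 'rV[K]_m) : Prop :=
  A !=set0 /\
  forall Z1 Z2 : set 'rV[K]_m, zariski_closed Z1 -> zariski_closed Z2 ->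
    A `<=` Z1 `|` Z2 -> A `&` Z1 `&` Z2 = set0 -> A `<=` Z1 \/ A `<=` Z2.

Definition zariski_irreducible m (A : set 'rV[K]_m) : Prop :=
  A !=set0 /\
  forall Z1 Z2 : set 'rV[K]_m, zariski_closed Z1 -> zariski_closed Z2 ->
    A `<=` Z1 `|` Z2 -> A `<=` Z1 \/ A `<=` Z2.

Definition irreducible_component m (D Z : set 'rV[K]_m) : Prop :=
  [/\ zariski_irreducible Z, Z `<=` D
    & forall Y, zariski_irreducible Y -> Y `<=` D -> Z `<=` Y -> Y = Z].

End ZariskiTopology.

Section LinearFreeDivisor.
Context {K : closedFieldType} {n : nat}.
Implicit Types (f g : {mpoly K[n]}) (D : set 'rV[K]_n).

Definition mpoly_dvd f g : Prop := exists q : {mpoly K[n]}, g = q * f.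

(* f is a nonconstant polynomial generating a radical ideal, and D is its zero
   locus; over an algebraically closed field, every reduced hypersurface of
   affine space has such a global equation, unique up to a nonzero constant *)
Definition reduced_equation f D : Prop :=
  [/\ (1 < msize f)%N,
      forall g k, mpoly_dvd f (g ^+ k) -> mpoly_dvd f g
    & D = zeros [set f]].

(* The vector field \sum_i delta_i d/dx_i is encoded by the row of its
   coefficients *)
Definition vfield_apply (delta : 'rV[{mpoly K[n]}]_n) f : {mpoly K[n]} :=
  \sum_(i < n) delta 0 i * f^`M(i).

Definition linear_vfield (A : 'M[K]_n) : 'rV[{mpoly K[n]}]_n :=
  \row_(i < n) \sum_(j < n) A i j *: 'X_j.

(* As affine space is affine, the sheaf Der(-log D) is given by its module of
   global sections *)
Definition log_vfield f (delta : 'rV[{mpoly K[n]}]_n) : Prop :=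
  mpoly_dvd f (vfield_apply delta f).

Definition linear_free_divisor D : Prop :=
  exists2 f, reduced_equation f D &
  exists (m : nat) (A : 'I_m -> 'M[K]_n),
    (forall k, log_vfield f (linear_vfield (A k))) /\
    (forall delta, log_vfield f delta ->
       exists! c : 'rV[{mpoly K[n]}]_m,
         delta = \sum_(k < m) c 0 k *: linear_vfield (A k)).

End LinearFreeDivisor.

(* GL(V) is the set of units of 'M_n, acting on V = 'rV_n by v |-> v *m g, and
   its Zariski topology is induced from the affine space of all matrices *)
Section LinearGroups.
Context {K : closedFieldType} {n : nat}.
Implicit Types (G H U : set 'M[K]_n) (D : set 'rV[K]_n).

Definition subgroup_GL H : Prop :=
  [/\ forall g, H g -> g \in unitmx,
      H 1%:M,
      forall g h, H g -> H h -> H (g *m h)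
    & forall g, H g -> H (invmx g)].

Definition connected_GL H : Prop := zariski_connected [set mxvec g | g in H].

Definition closed_GL H : Prop :=
  exists2 Z, zariski_closed Z & H = [set g | g \in unitmx /\ Z (mxvec g)].

Definition preserves H D : Prop :=
  forall g, H g -> [set v *m g | v in D] = D.

Definition associated_group D G : Prop :=
  [/\ subgroup_GL G, connected_GL G, preserves G D
    & forall H, subgroup_GL H -> connected_GL H -> preserves H D -> H `<=` G].

Definition unipotent_mx (g : 'M[K]_n) : Prop :=
  exists k : nat, (g - 1%:M) ^+ k = 0.

(* Triviality of the unipotent radical, the largest connected normal unipotent
   closed subgroup *)
Definition reductive G : Prop :=
  forall U, subgroup_GL U -> closed_GL U -> connected_GL U -> U `<=` G ->
    (forall g u, G g -> U u -> U (invmx g *m u *m g)) ->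
    (forall u, U u -> unipotent_mx u) ->
    U = [set 1%:M].

(* Subspaces of V are row spaces of square matrices; the definitions follow
   mxmodule, mxsimple and mx_iso of mxrepresentation, which only covers finite
   groups *)
Definition gmodule G (W : 'M[K]_n) : Prop := forall g, G g -> stablemx W g.

Definition gsimple G (W : 'M[K]_n) : Prop :=
  [/\ gmodule G W, W != 0
    & forall W' : 'M[K]_n, gmodule G W' -> (W' <= W)%MS -> W' != 0 ->
        (W <= W')%MS].

(* The linear map v |-> v *m phi restricts to an equivariant bijection from W1
   onto W2; every linear map between subspaces of V is such a restriction *)
Definition giso G (W1 W2 : 'M[K]_n) : Prop :=
  exists phi : 'M[K]_n,
    [/\ (W1 *m phi :=: W2)%MS, \rank (W1 *m phi) = \rank W1
      & forall g, G g -> W1 *m g *m phi = W1 *m phi *m g].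

Definition irreducible_decomposition G k (W : 'I_k -> 'M[K]_n) : Prop :=
  [/\ forall i, gsimple G (W i),
      (\sum_(i < k) W i :=: 1%:M)%MS
    & mxdirect (\sum_(i < k) W i)].

End LinearGroups.

(* Main.v *)
(* Let [B_1, ..., B_n] be the linear fields generating [Der(-log D)] and [f] the
   reduced equation.  By Saito's criterion [f] is, up to a constant, the
   determinant of the matrix with rows [x B_k]; hence any [P] commuting with the
   [B_k] satisfies [f(x(1+tP)) = det(1+tP) f(x)], so it lies in the Lie algebra
   [g] of matrices whose vector field multiplies [f] by a constant.  Jordan
   decomposition inside [g] gives enough one-parameter subgroups of [G] to see
   that whatever commutes with [G] commutes with [g]; thus the commutant of [G]
   is central in [g].  An isomorphism between two distinct summands of [V] would
   give a commuting nilpotent that does not commute with the projections, which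
   also lie in the commutant.

   For the count, let [chi_1, ..., chi_s] be the characters of [g] on the
   irreducible factors [F_i] of [f].
   - A trace [A |-> tr(A|W_j)] is a character of [g], hence a closed logarithmic
     1-form; its residue along [F_i = 0] is a constant [c_i], so the trace is
     [sum_i c_i chi_i].  The traces are independent on the projections, whence
     [k <= s].
   - The radical of the trace form of [g] is an ideal of nilpotent matrices,
     which is zero by Engel's theorem since [V] is semisimple.  So a combination
     of the [chi_i], being [G]-invariant, is [tr(Y _)] with [Y] in the commutant
     of [G], i.e. (Schur) in the span of the projections.  As the [chi_i] are
     independent, [s <= k]. *)
Require Import Defs.
From HB Require Import structures.
From mathcomp Require Import all_boot all_order all_algebra.
From mathcomp Require Import complex mpoly.
From mathcomp Require Import boolp classical_sets functions cardinality reals.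
From mathcomp Require Import ring zify.

Set Implicit Arguments.
Unset Strict Implicit.
Unset Printing Implicit Defensive.

Import Order.TTheory GRing.Theory Num.Theory.
Local Open Scope classical_set_scope.
Local Open Scope card_scope.
Local Open Scope ring_scope.

(** * Factorial domains and Gauss's lemma *)

(** [G] is given only as a maximal connected group of matrices, without a Lie algebra, so [g] is
    built from [f] alone ([lie_stab]). The two meet in three places: polynomial one-parameter groups
    that fix [f] up to constants lie in [G] by maximality; [g] is stable under conjugation by [G];
    and connectedness of [G] keeps each factor of [f] semi-invariant. Exponentials of semisimple
    matrices are not polynomial in the parameter, and eigenvalues need not be rational, so these
    matrices are reached through tori with natural exponents satisfying the same linear relations.
    The algebra rests on unique factorization and on a Nullstellensatz for one equation, both
    obtained by singling out a variable. The elimination behind the Nullstellensatz also shows, with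
    no appeal to the topology of a complex hypersurface, that residues are constant. *)

Section Divisibility.
Context {R : idomainType}.
Implicit Types a b c p : R.

Definition rdvd a b : Prop := exists q, b = q * a.

Definition rprime p : Prop :=
  [/\ p != 0, p \isn't a GRing.unit
    & forall a b, rdvd p (a * b) -> rdvd p a \/ rdvd p b].

Definition rirreducible p : Prop :=
  [/\ p != 0, p \isn't a GRing.unit
    & forall a b, p = a * b -> a \is a GRing.unit \/ b \is a GRing.unit].

(** The number of primes is recorded because it is the part of the induction measure of
    [factorial_poly] that handles constant factors. *)
Definition prime_factored m a : Prop :=
  exists u (s : seq R), [/\ u \is a GRing.unit, size s = m,
    forall p, p \in s -> rprime p & a = u * \prod_(p <- s) p].

Lemma rdvd_refl a : rdvd a a. Proof. by exists 1; rewrite mul1r. Qed.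
Lemma rdvd0 a : rdvd a 0. Proof. by exists 0; rewrite mul0r. Qed.
Lemma rdvd_mull a b c : rdvd a c -> rdvd a (b * c).
Proof. by case=> q ->; exists (b * q); rewrite mulrA. Qed.
Lemma rdvd_mulr a b c : rdvd a b -> rdvd a (b * c).
Proof. by rewrite mulrC; apply: rdvd_mull. Qed.
Lemma rdvd_trans a b c : rdvd a b -> rdvd b c -> rdvd a c.
Proof. by move=> ab [q ->]; apply: rdvd_mull. Qed.
Lemma rdvdD a b c : rdvd a b -> rdvd a c -> rdvd a (b + c).
Proof. by case=> [q ->] [r ->]; exists (q + r); rewrite mulrDl. Qed.
Lemma rdvdN a b : rdvd a b -> rdvd a (- b).
Proof. by case=> [q ->]; exists (- q); rewrite mulNr. Qed.
Lemma rdvdB a b c : rdvd a b -> rdvd a c -> rdvd a (b - c).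
Proof. by move=> ab ac; apply: rdvdD ab (rdvdN ac). Qed.
Lemma rdvd_sum a (I : Type) (r : seq I) (P : pred I) (F : I -> R) :
  (forall i, P i -> rdvd a (F i)) -> rdvd a (\sum_(i <- r | P i) F i).
Proof.
by move=> aF; elim/big_ind: _ => //; [apply: rdvd0 | apply: rdvdD].
Qed.
Lemma rdvd_addr a b c : rdvd a b -> rdvd a (b + c) -> rdvd a c.
Proof. by move=> ab abc; rewrite -[c](addKr b) addrC; apply: rdvdB. Qed.
Lemma rdvd_mul2l c a b : c != 0 -> rdvd (c * a) (c * b) -> rdvd a b.
Proof.
by move=> c0 [q e]; exists q; apply: (mulfI c0); rewrite e mulrCA.
Qed.
Lemma rdvd_mul a b c d : rdvd a b -> rdvd c d -> rdvd (a * c) (b * d).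
Proof. by case=> [q ->] [r ->]; exists (q * r); rewrite mulrACA. Qed.
Lemma rdvd_unit a b : b \is a GRing.unit -> rdvd a b -> a \is a GRing.unit.
Proof. by move=> bU [q bE]; move: bU; rewrite bE unitrM => /andP[]. Qed.
Lemma unit_rdvd a b : a \is a GRing.unit -> rdvd a b.
Proof. by move=> aU; exists (b / a); rewrite mulrVK. Qed.

Lemma rprime_neq0 p : rprime p -> p != 0. Proof. by case. Qed.

Lemma rprime_ndvd1 p : rprime p -> ~ rdvd p 1.
Proof. by case=> _ /negP pN _ /(rdvd_unit (unitr1 R))/pN. Qed.

Lemma rprime_ndvd_unit p u : rprime p -> u \is a GRing.unit -> ~ rdvd p u.
Proof. by case=> _ pN _ uU /(rdvd_unit uU); apply/negP. Qed.

Lemma rprime_dvdM p a b : rprime p -> rdvd p (a * b) -> rdvd p a \/ rdvd p b.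
Proof. by case=> _ _; apply. Qed.

Lemma rprime_dvdX p a m : rprime p -> rdvd p (a ^+ m) -> rdvd p a.
Proof.
move=> pp; elim: m => [|m IH]; first by rewrite expr0 => /(rprime_ndvd1 pp).
by rewrite exprS => /(rprime_dvdM pp) [].
Qed.

Lemma rprime_dvd_prod p (I : eqType) (s : seq I) (F : I -> R) :
  rprime p -> rdvd p (\prod_(q <- s) F q) -> exists2 q, q \in s & rdvd p (F q).
Proof.
move=> pp; elim: s => [|q s IH]; first by rewrite big_nil => /(rprime_ndvd1 pp).
rewrite big_cons => /(rprime_dvdM pp) [pq|/IH [r rs pr]].
  by exists q; rewrite ?mem_head.
by exists r; rewrite // in_cons rs orbT.
Qed.

Lemma rprime_irreducible p : rprime p -> rirreducible p.
Proof.
case=> p0 pN pP; split=> // a b pE.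
have key c d : p = c * d -> rdvd p c -> d \is a GRing.unit.
  move=> pcd [q cE]; apply/unitrP; exists q.
  have qd1 : q * d = 1 by apply: (mulfI p0); rewrite mulr1 [RHS]pcd cE; ring.
  by split=> //; rewrite mulrC.
have : rdvd p (a * b) by rewrite -pE; apply: rdvd_refl.
case/pP=> [pa|pb]; first by right; apply: key pa.
by left; apply: key pb; rewrite mulrC.
Qed.

Lemma rprime_dvd_sym p q : rprime p -> rprime q -> rdvd p q -> rdvd q p.
Proof.
move=> pp pq [r qE]; have [_ /negP pN _] := pp.
have [_ _ /(_ _ _ qE) [rU|/pN //]] := rprime_irreducible pq.
by exists r^-1; rewrite qE mulKr.
Qed.

Lemma prime_factored_unit u : u \is a GRing.unit -> prime_factored 0 u.
Proof. by move=> uU; exists u, [::]; split=> //; rewrite big_nil mulr1. Qed.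

Lemma prime_factored_mul m1 m2 a b :
  prime_factored m1 a -> prime_factored m2 b -> prime_factored (m1 + m2) (a * b).
Proof.
case=> [u [s [uU ss sp ->]]] [v [t [vU st tp ->]]]; exists (u * v), (s ++ t).
split; rewrite ?unitrM ?uU ?size_cat ?ss ?st //; last first.
  by rewrite big_cat mulrACA.
by move=> p; rewrite mem_cat => /orP[/sp|/tp].
Qed.

Lemma prime_factored_prime p : rprime p -> prime_factored 1 p.
Proof.
move=> pp; exists 1, [:: p]; split; rewrite ?unitr1 ?big_seq1 ?mul1r //.
by move=> q; rewrite inE => /eqP ->.
Qed.

Lemma prime_factored_split m a b : prime_factored m (a * b) ->
  exists i j, [/\ m = (i + j)%N, prime_factored i a & prime_factored j b].
Proof.
case=> [u [s [uU <- sp abE]]]; elim: s a b sp abE => [|p s IH] a b sp.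
  rewrite big_nil mulr1 => abE; exists 0%N, 0%N.
  by move: uU; rewrite -abE unitrM => /andP[aU bU]; split=> //;
    apply: prime_factored_unit.
rewrite big_cons mulrCA => abE.
have pp : rprime p by apply: sp; rewrite mem_head.
have sp' q : q \in s -> rprime q by move=> qs; apply: sp; rewrite in_cons qs orbT.
have : rdvd p (a * b) by exists (u * \prod_(j <- s) j); rewrite abE mulrC.
case/(rprime_dvdM pp) => [[q aE]|[q bE]].
  have [|i [j [szE qi bj]]] := IH q b sp'.
    by apply: (mulfI (rprime_neq0 pp)); rewrite -abE aE; ring.
  exists (1 + i)%N, j; split=> //=; first by rewrite szE.
  by rewrite aE mulrC; apply: prime_factored_mul => //; apply: prime_factored_prime.
have [|i [j [szE ai qj]]] := IH a q sp'.
  by apply: (mulfI (rprime_neq0 pp)); rewrite -abE bE; ring.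
exists i, (1 + j)%N; split=> //=; first by rewrite szE addnCA.
by rewrite bE mulrC; apply: prime_factored_mul => //; apply: prime_factored_prime.
Qed.

Lemma prime_factored0_unit a : prime_factored 0 a -> a \is a GRing.unit.
Proof. by case=> [u [s [uU /size0nil -> _ ->]]]; rewrite big_nil mulr1. Qed.

Lemma rprime_mul_unit u p : u \is a GRing.unit -> rprime p -> rprime (u * p).
Proof.
move=> uU [p0 pN pP]; split=> [||a b].
- by rewrite mulf_neq0 // (memPn _ _ uU) // unitr0.
- by rewrite unitrM uU.
have up c : rdvd (u * p) c <-> rdvd p c.
  split=> -[q ->]; first by exists (q * u); rewrite mulrA.
  by exists (q / u); rewrite mulrA mulrVK.
by rewrite !up; apply: pP.
Qed.

End Divisibility.

(** The factors are prime, not just irreducible, so uniqueness is built in and only existence has to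
    be proved. *)
Definition factorial_domain (R : idomainType) : Prop :=
  forall a : R, a != 0 -> exists m, prime_factored m a.

Lemma factorial_irreducible_prime (R : idomainType) (p : R) :
  factorial_domain R -> rirreducible p -> rprime p.
Proof.
move=> fR [p0 pN pI]; have [m [u [s [uU _ sp pE]]]] := fR p p0.
case: s sp pE => [|q s] sp pE.
  by move: pN; rewrite pE big_nil mulr1 uU.
have qp : rprime q by apply: sp; rewrite mem_head.
rewrite pE big_cons mulrCA; rewrite big_cons mulrCA in pE.
have [|vU] := pI _ _ pE; first by case: qp => _ /negbTE ->.
by rewrite mulrC; apply: rprime_mul_unit.
Qed.

Lemma rdvd_morph (R S : idomainType) (f : {rmorphism R -> S}) a b :
  rdvd a b -> rdvd (f a) (f b).
Proof. by case=> q ->; exists (f q); rewrite rmorphM. Qed.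

Section Isomorphism.
Context {R S : idomainType} (f : {rmorphism R -> S}) (g : {rmorphism S -> R}).
Hypotheses (fK : cancel f g) (gK : cancel g f).

Lemma iso_rdvd a b : rdvd (f a) (f b) <-> rdvd a b.
Proof.
by split=> [/(rdvd_morph g)|/(rdvd_morph f)//]; rewrite !fK.
Qed.

Lemma iso_unit a : (f a \is a GRing.unit) = (a \is a GRing.unit).
Proof.
by apply/idP/idP=> [/(rmorph_unit g)|/(rmorph_unit f)//]; rewrite fK.
Qed.

Lemma iso_rprime a : rprime (f a) <-> rprime a.
Proof.
split=> -[a0 aN aP]; split.
- by apply: contraNneq a0 => ->; rewrite rmorph0.
- by rewrite -iso_unit.
- by move=> b c; rewrite -!iso_rdvd rmorphM; apply: aP.
- by apply: contraNneq a0 => /(congr1 g); rewrite fK rmorph0 => ->.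
- by rewrite iso_unit.
by move=> b c; rewrite -[b]gK -[c]gK -rmorphM !iso_rdvd; apply: aP.
Qed.

Lemma iso_factorial : factorial_domain S -> factorial_domain R.
Proof.
move=> fS a a0; have fa0 : f a != 0.
  by apply: contraNneq a0 => /(congr1 g); rewrite fK rmorph0 => ->.
have [m [u [s [uU ss sp faE]]]] := fS _ fa0.
exists m, (g u), (map g s); split.
- by apply: rmorph_unit.
- by rewrite size_map.
- by move=> _ /mapP[p /sp pp ->]; apply/iso_rprime; rewrite gK.
by rewrite -[a]fK faE rmorphM rmorph_prod big_map.
Qed.

End Isomorphism.

Section GaussLemma.
Context {R : idomainType}.
Implicit Types p q g h : {poly R}.

Lemma rdvd_polyCP (c : R) p : rdvd c%:P p <-> forall i, rdvd c p`_i.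
Proof.
split=> [[q ->] i|cp]; first by exists q`_i; rewrite coefMC.
have /all_sig [F FE] i : {q | p`_i = q * c}.
  exact: cid (cp i).
exists (\poly_(i < size p) F i); apply/polyP=> i; rewrite coefMC coef_poly.
case: ltnP => [_|pi]; first exact: FE.
by rewrite mul0r nth_default.
Qed.

(* The product of the lowest coefficients not divisible by [c] is, modulo [c],
   the coefficient of the product at the sum of their indices. *)
Lemma rprime_polyC (c : R) : rprime c -> rprime c%:P.
Proof.
move=> cp; have [c0 cN cP] := cp; split.
- by rewrite polyC_eq0.
- by apply: contraNN cN; rewrite poly_unitE coefC => /andP[].
move=> p q cpq; have [|cNp] := pselect (rdvd c%:P p); first by left.
have [|cNq] := pselect (rdvd c%:P q); [by right | exfalso].
move/rdvd_polyCP/existsNP: cNp => cNp; move/rdvd_polyCP/existsNP: cNq => cNq.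
have exP (r : {poly R}) : (exists i, ~ rdvd c r`_i) -> exists i, `[< ~ rdvd c r`_i >].
  by case=> i ri; exists i; apply/asboolP.
pose i := ex_minn (exP _ cNp); pose j := ex_minn (exP _ cNq).
have [ci iP] : ~ rdvd c p`_i /\ forall k, (k < i)%N -> rdvd c p`_k.
  rewrite /i; case: ex_minnP => k /asboolP ck kmin; split=> // l lk.
  by apply/not_notP => cl; move: (kmin l); rewrite leqNgt lk => /(_ (asboolT cl)).
have [cj jP] : ~ rdvd c q`_j /\ forall k, (k < j)%N -> rdvd c q`_k.
  rewrite /j; case: ex_minnP => k /asboolP ck kmin; split=> // l lk.
  by apply/not_notP => cl; move: (kmin l); rewrite leqNgt lk => /(_ (asboolT cl)).
have ij : (i < (i + j).+1)%N by rewrite ltnS leq_addr.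
move/rdvd_polyCP: cpq => /(_ (i + j)%N); rewrite coefM (bigD1 (Ordinal ij)) //=.
rewrite addKn addrC => cpq; suff /cP[] : rdvd c (p`_i * q`_j) by [].
apply: rdvd_addr cpq; apply: rdvd_sum => k; rewrite -val_eqE /= neq_ltn => /orP[ki|ki].
  by apply: rdvd_mulr; apply: iP.
by apply: rdvd_mull; apply: jP; have := ltn_ord k; lia.
Qed.

(** The primes of [c] are cancelled one at a time: each stays prime in [{poly R}], hence divides [g]
    or [q]. A factorization up to a constant thus becomes an exact one with the same degrees. *)
Lemma strip_const g h q (c : R) m : c != 0 -> prime_factored m c ->
  c *: h = g * q ->
  exists g' q', [/\ h = g' * q', size g' = size g & size q' = size q].
Proof.
move=> c0 [u [s [uU _ sp cE]]]; rewrite {}cE in c0 *.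
elim: s g h q sp c0 => [|p s IH] g h q sp c0 ghq.
  exists (u^-1 *: g), q; split=> //; last by rewrite size_scale // invr_eq0 (memPn _ _ uU) ?unitr0.
  by rewrite -scalerAl -ghq big_nil mulr1 scalerA mulVr // scale1r.
have pp : rprime p by apply: sp; rewrite mem_head.
have p0 := rprime_neq0 pp.
have sp' r : r \in s -> rprime r by move=> rs; apply: sp; rewrite in_cons rs orbT.
have c0' : u * \prod_(j <- s) j != 0.
  by move: c0; rewrite big_cons mulrCA mulf_eq0 negb_or => /andP[].
have pC0 : p%:P != 0 by rewrite polyC_eq0.
have : rdvd p%:P (g * q).
  exists ((u * \prod_(j <- s) j) *: h).
  by rewrite -ghq big_cons [RHS]mulrC mul_polyC scalerA mulrCA.
case/(rprime_dvdM (rprime_polyC pp)) => -[r rE].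
  have [|g' [q' [hE sg sq]]] := IH r h q sp' c0'.
    apply: (mulfI pC0); rewrite mulrA [p%:P * r]mulrC -rE -ghq big_cons.
    by rewrite mul_polyC scalerA mulrCA.
  by exists g', q'; split=> //; rewrite rE mulrC mul_polyC size_scale.
have [|g' [q' [hE sg sq]]] := IH g h r sp' c0'.
  apply: (mulfI pC0); rewrite mulrCA [p%:P * r]mulrC -rE -ghq big_cons.
  by rewrite mul_polyC scalerA mulrCA.
by exists g', q'; split=> //; rewrite rE mulrC mul_polyC size_scale.
Qed.

Lemma strip_const_primitive h q p (c : R) m : c != 0 -> prime_factored m c ->
  (forall r, rprime r -> ~ rdvd r%:P p) -> c *: h = q * p -> rdvd p h.
Proof.
move=> c0 [u [s [uU _ sp cE]]] pprim; rewrite {}cE in c0 *.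
elim: s q sp c0 => [|r s IH] q sp c0 hqp.
  exists (u^-1 *: q).
  by rewrite -scalerAl -hqp big_nil mulr1 scalerA mulVr // scale1r.
have pr : rprime r by apply: sp; rewrite mem_head.
have sp' l : l \in s -> rprime l by move=> ls; apply: sp; rewrite in_cons ls orbT.
have c0' : u * \prod_(j <- s) j != 0.
  by move: c0; rewrite big_cons mulrCA mulf_eq0 negb_or => /andP[].
have : rdvd r%:P (q * p).
  exists ((u * \prod_(j <- s) j) *: h).
  by rewrite -hqp big_cons [RHS]mulrC mul_polyC scalerA mulrCA.
case/(rprime_dvdM (rprime_polyC pr)) => [[l lE]|/(pprim _ pr)//].
apply: (IH l sp' c0'); have rC0 : r%:P != 0 by rewrite polyC_eq0 rprime_neq0.
apply: (mulfI rC0); rewrite mulrA [r%:P * l]mulrC -lE -hqp big_cons.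
by rewrite mul_polyC scalerA mulrCA.
Qed.

Hypothesis fR : factorial_domain R.

Lemma poly_irreducible_primitive p : rirreducible p -> (1 < size p)%N ->
  forall r, rprime r -> ~ rdvd r%:P p.
Proof.
move=> [p0 _ pI] sp r [r0 rN _] [q pE]; have [qU|rU] := pI _ _ pE.
  move: sp; rewrite pE mulrC mul_polyC size_scale //.
  by move: qU; rewrite poly_unitE => /andP[/eqP ->].
by move: rU rN; rewrite poly_unitE coefC eqxx => /andP[_ ->].
Qed.

Import Pdiv.Idomain.

(** Here [%|] is divisibility up to a nonzero constant, that is, over the fraction field;
    primitivity of [p] turns it into divisibility in [{poly R}]. *)
Lemma poly_irreducible_dvd p h : rirreducible p -> (1 < size p)%N ->
  p %| h -> rdvd p h.
Proof.
move=> pI sp /dvdpP [[c q] /= c0 hE]; have [m mP] := fR c0.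
exact: strip_const_primitive c0 mP (poly_irreducible_primitive pI sp) hE.
Qed.

(** Stripping constants turns the gcd over the fraction field into an exact factor of [p]. By
    irreducibility it is constant or associate to [p], and in the second case [p] would divide
    [x]. *)
Lemma poly_irreducible_coprime p x : rirreducible p -> (1 < size p)%N ->
  ~ rdvd p x -> coprimep p x.
Proof.
move=> pI sp px; have [p0 pN pf] := pI.
have /dvdpP [[c q] /= c0 pE] := dvdp_gcdl p x.
have [m mP] := fR c0; have [q' [g' [pE' sq sg]]] := strip_const c0 mP pE.
have [qU|gU] := pf _ _ pE'; last first.
  by rewrite /coprimep -sg; move: gU; rewrite poly_unitE => /andP[].
case: px; apply: poly_irreducible_dvd => //.
apply: dvdp_trans (dvdp_gcdr p x).
have /size1_polyC qE : (size q <= 1)%N.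
  by rewrite -sq; move: qU; rewrite poly_unitE => /andP[/eqP ->].
apply/dvdpP; exists (q`_0, c%:P) => /=; last by rewrite mul_polyC pE -mul_polyC -qE.
apply/eqP=> q00; move/eqP: pE.
by rewrite qE q00 polyC0 mul0r scale_poly_eq0 (negbTE c0) (negbTE p0).
Qed.

Lemma poly_irreducible_prime p : rirreducible p -> rprime p.
Proof.
move=> pI; have [p0 pN pf] := pI.
have [sp|sp] := ltnP 1 (size p); last first.
  have pE : p = (p`_0)%:P by apply: size1_polyC.
  rewrite pE; apply: rprime_polyC; apply: factorial_irreducible_prime => //; split.
  - by apply: contraNneq p0 => p00; rewrite pE p00.
  - apply: contraNN pN => p0U; rewrite poly_unitE p0U andbT.
    by rewrite pE size_polyC (memPn _ _ p0U) ?unitr0.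
  move=> a b pab; have [||] := pf a%:P b%:P; first by rewrite pE pab polyCM.
    by rewrite poly_unitE coefC eqxx => /andP[_ ->]; left.
  by rewrite poly_unitE coefC eqxx => /andP[_ ->]; right.
split=> // x y [z xyE].
have [|px] := pselect (rdvd p x); [by left | right].
apply: poly_irreducible_dvd => //.
have /Gauss_dvdpr <- := poly_irreducible_coprime pI sp px.
by rewrite xyE dvdp_mulIr.
Qed.

Lemma factorial_poly : factorial_domain {poly R}.
Proof.
move=> a a0; have [m mP] : exists m, prime_factored m (lead_coef a).
  by apply: fR; rewrite lead_coef_eq0.
(* The measure, degree plus number of primes of the leading coefficient, is additive on products and
   positive on nonunits ([pos] below), so it drops on proper factors. *)
have [k] := ubnP ((size a).-1 + m)%N; elim: k => // k IH in a m a0 mP *.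
rewrite ltnS => amk.
have [aU|aN] := boolP (a \is a GRing.unit).
  by exists 0%N; apply: prime_factored_unit.
have [aI|aNI] := pselect (rirreducible a).
  by exists 1%N; apply: prime_factored_prime; apply: poly_irreducible_prime.
have [b [c [aE bN cN]]] : exists b c, [/\ a = b * c,
    b \isn't a GRing.unit & c \isn't a GRing.unit].
  apply/not_notP => H; apply: aNI; split=> // b c aE.
  have [bU|bN] := boolP (b \is a GRing.unit); first by left.
  have [cU|cN] := boolP (c \is a GRing.unit); first by right.
  by case: H; exists b, c.
have [b0 c0] : b != 0 /\ c != 0.
  by move: a0; rewrite aE mulf_eq0 negb_or => /andP[].
move: mP; rewrite aE lead_coefM => /prime_factored_split [i [j [mij bi cj]]].
have pos (d : {poly R}) l : d != 0 -> d \isn't a GRing.unit ->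
    prime_factored l (lead_coef d) -> (0 < (size d).-1 + l)%N.
  move=> d0 dN dl; rewrite lt0n; apply: contraNN dN; rewrite addn_eq0.
  case/andP=> sd /eqP l0; rewrite {}l0 in dl.
  have sd1 : size d = 1%N by move: sd d0; rewrite -size_poly_eq0; case: (size d) => [|[]].
  move: (prime_factored0_unit dl); rewrite /lead_coef sd1 /= => dU.
  by rewrite poly_unitE sd1 eqxx.
have sa : (size a).-1 = ((size b).-1 + (size c).-1)%N.
  rewrite aE size_mul //; move: b0 c0; rewrite -!size_poly_gt0; lia.
have [bp cp] := (pos _ _ b0 bN bi, pos _ _ c0 cN cj).
have [|mb mbP] := IH b i b0 bi; first by lia.
have [|mc mcP] := IH c j c0 cj; first by lia.
by exists (mb + mc)%N; apply: prime_factored_mul.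
Qed.

End GaussLemma.

(* The gcd computation takes place over the fraction field of [A], where [f p]
   and [f w] are coprime by Gauss's lemma; [c] is obtained by clearing
   denominators in a Bezout relation. *)
Lemma iso_elimination (A B : idomainType) (f : {rmorphism B -> {poly A}})
    (g : {rmorphism {poly A} -> B}) (p w : B) :
    cancel f g -> cancel g f -> factorial_domain A ->
    rprime p -> (1 < size (f p))%N -> ~ rdvd p w ->
  exists c u v, c != 0 /\ g c%:P = u * p + v * w.
Proof.
move=> fK gK fA pp sp pw.
have Pp : rprime (f p) by apply/(iso_rprime fK gK).
have PW : ~ rdvd (f p) (f w) by move/(iso_rdvd fK).
have := poly_irreducible_coprime fA (rprime_irreducible Pp) sp PW.
case/Pdiv.Idomain.Bezout_coprimepP => -[u v] /= /Pdiv.Idomain.eqp_size.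
rewrite size_poly1 => /eqP/size_poly1P [c c0 uvE].
exists c, (g u), (g v); split=> //.
by rewrite -uvE rmorphD !rmorphM !fK.
Qed.

(** * Polynomial rings: elimination and the Nullstellensatz for hypersurfaces *)

Lemma mpoly_ring_ind (R : comNzRingType) n (P : {mpoly R[n]} -> Prop) :
  (forall c, P c%:MP) -> (forall i, P 'X_i) ->
  (forall p q, P p -> P q -> P (p + q)) ->
  (forall p q, P p -> P q -> P (p * q)) -> forall p, P p.
Proof.
move=> PC PX PD PM p; rewrite (mpolyE p).
apply: (big_ind P); [by rewrite -mpolyC0; apply: PC | exact: PD | move=> m _].
rewrite -mul_mpolyC; apply: (PM) => //; rewrite mpolyXE_id.
apply: (big_ind P) => [||i _]; [by rewrite -mpolyC1; apply: PC | exact: PM |].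
by elim: (m i) => [|k IH]; rewrite ?expr0 -?mpolyC1 // exprS; apply: PM.
Qed.

Lemma mpoly_rmorph_ext (R S : comNzRingType) n (f g : {rmorphism {mpoly R[n]} -> S}) :
  (forall c, f c%:MP = g c%:MP) -> (forall i, f 'X_i = g 'X_i) -> f =1 g.
Proof.
move=> fgC fgX; apply: mpoly_ring_ind => // p q fp fq.
  by rewrite !rmorphD fp fq.
by rewrite !rmorphM fp fq.
Qed.

Lemma mderivXU (R : nzRingType) n (i j : 'I_n) :
  ('X_i : {mpoly R[n]})^`M(j) = (i == j)%:R.
Proof.
rewrite mderivX mnm1E; case: eqVneq => [->|_]; last by rewrite scale0r.
rewrite scale1r [X in 'X_[X]](_ : _ = 0%MM) ?mpolyX0 //.
by apply/mnmP => l; rewrite mnmBE subnn mnm0E.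
Qed.

Section SingleOut.
Context {K : numClosedFieldType} {n : nat} (e : 'I_n.+1).
Implicit Types (p : {mpoly K[n.+1]}) (q : {mpoly K[n]}) (P : {poly {mpoly K[n]}}).

(** Polynomials are read as univariate in x_e over the ring in the other variables. The index [e] is
    arbitrary because the variable to eliminate is one along which a given prime has a nonzero
    derivative. *)
Definition split_var_gen (i : 'I_n.+1) : {poly {mpoly K[n]}} :=
  if unlift e i is Some j then ('X_j)%:P else 'X.

Definition split_var : {mpoly K[n.+1]} -> {poly {mpoly K[n]}} :=
  mmap (polyC \o @mpolyC n K) split_var_gen.
HB.instance Definition _ := GRing.RMorphism.on split_var.

Definition widen_var : {mpoly K[n]} -> {mpoly K[n.+1]} :=
  comp_mpoly [tuple 'X_(lift e j) | j < n].
HB.instance Definition _ := GRing.RMorphism.on widen_var.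

Definition join_var : {poly {mpoly K[n]}} -> {mpoly K[n.+1]} :=
  horner_eval ('X_e : {mpoly K[n.+1]}) \o map_poly widen_var.
HB.instance Definition _ := GRing.RMorphism.on join_var.

Lemma split_varC c : split_var c%:MP = (c%:MP)%:P.
Proof. by rewrite /split_var mmapC. Qed.

Lemma split_varX i : split_var 'X_i = split_var_gen i.
Proof. by rewrite /split_var mmapX mmap1U. Qed.

Lemma widen_varC c : widen_var c%:MP = c%:MP.
Proof. by rewrite /widen_var comp_mpolyC. Qed.

Lemma widen_varX j : widen_var 'X_j = 'X_(lift e j).
Proof. by rewrite /widen_var comp_mpolyXU -tnth_nth tnth_mktuple. Qed.

Lemma join_varC q : join_var q%:P = widen_var q.
Proof. by rewrite /join_var /= map_polyC /horner_eval /= hornerC. Qed.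

Lemma join_varX : join_var 'X = 'X_e.
Proof. by rewrite /join_var /= map_polyX /horner_eval /= hornerX. Qed.

Lemma split_varK : cancel split_var join_var.
Proof.
apply: (mpoly_rmorph_ext (f := join_var \o split_var) (g := idfun)) => [c|i].
  by rewrite /= split_varC join_varC widen_varC.
rewrite /= split_varX /split_var_gen.
case: unliftP => [j|] ->; first by rewrite join_varC widen_varX.
by rewrite join_varX.
Qed.

Lemma join_varK : cancel join_var split_var.
Proof.
have wK q : split_var (widen_var q) = q%:P.
  apply: (mpoly_rmorph_ext (f := split_var \o widen_var) (g := polyC)) => [c|j].
    by rewrite /= widen_varC split_varC.
  rewrite /= widen_varX split_varX.
  by rewrite /split_var_gen liftK.
elim/poly_ind => [|P q IH]; first by rewrite !rmorph0.
by rewrite !(rmorphD, rmorphM) /= IH join_varC wK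
  join_varX split_varX /split_var_gen unlift_none.
Qed.

Lemma meval_widen_var q (v : 'I_n.+1 -> K) :
  (widen_var q).@[v] = q.@[v \o lift e].
Proof.
rewrite /widen_var comp_mpoly_meval; apply: meval_eq => j /=.
by rewrite tnth_mktuple mevalXU.
Qed.

Lemma meval_join_var P (v : 'I_n.+1 -> K) :
  (join_var P).@[v] = (map_poly (meval (v \o lift e)) P).[v e].
Proof.
elim/poly_ind: P => [|P q IH]; first by rewrite !rmorph0 horner0.
rewrite !(rmorphD, rmorphM) /= IH join_varX join_varC.
by rewrite mevalXU meval_widen_var map_polyX map_polyC /= !hornerE.
Qed.

Lemma mderiv_widen_var q : (widen_var q)^`M(e) = 0.
Proof.
elim/mpoly_ring_ind: q => [c|j|p q pe qe|p q pe qe].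
- by rewrite widen_varC mderivC.
- by rewrite widen_varX mderivXU eq_sym (negbTE (neq_lift e j)).
- by rewrite rmorphD mderivD pe qe addr0.
by rewrite rmorphM mderivM pe qe mulr0 mul0r addr0.
Qed.

Lemma mderiv_join_var P : (join_var P)^`M(e) = join_var P^`().
Proof.
elim/poly_ind: P => [|P q IH]; first by rewrite deriv0 !rmorph0 mderiv0.
rewrite derivD derivC addr0 derivM derivX mulr1.
rewrite !(rmorphD, rmorphM) /= mderivD mderivM IH join_varX join_varC.
by rewrite mderiv_widen_var addr0 mderivXU eqxx mulr1.
Qed.

End SingleOut.

Opaque split_var join_var widen_var.

Section MpolyFactorial.
Context {K : numClosedFieldType}.

Lemma factorial_mpoly n : factorial_domain {mpoly K[n]}.
Proof.
elim: n => [|n IH].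
  move=> p p0; exists 0%N; apply: prime_factored_unit.
  rewrite (nvar0_mpolyC p) in p0 *; apply: rmorph_unit; rewrite unitfE.
  by apply: contraNneq p0 => ->.
apply: (@iso_factorial _ {poly {mpoly K[n]}} (split_var ord0) (join_var ord0)).
- exact: split_varK.
- exact: join_varK.
exact: factorial_poly.
Qed.

Lemma poly_nonroot (p : {poly K}) : p != 0 -> exists x, p.[x] != 0.
Proof.
move=> p0; apply/not_existsP => H.
have pall : all (root p) (map (fun i => i%:R) (iota 0 (size p))).
  by apply/allP => _ /mapP[i _ ->]; rewrite rootE; apply: contra_notT (H i%:R).
suff /(max_poly_roots p0 pall) : uniq [seq i%:R : K | i <- iota 0 (size p)].
  by rewrite size_map size_iota ltnn.
by rewrite map_inj_uniq ?iota_uniq // => i j /eqP; rewrite eqr_nat => /eqP.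
Qed.

Lemma mpoly_nonroot n (p : {mpoly K[n]}) : p != 0 -> exists v, p.@[v] != 0.
Proof.
elim: n p => [|n IH] p p0.
  exists (fun=> 0); rewrite (nvar0_mpolyC p) in p0 *; rewrite mevalC.
  by apply: contraNneq p0 => ->.
have P0 : split_var ord0 p != 0.
  by apply: contraNneq p0 => P0; rewrite -(split_varK ord0 p) P0 rmorph0.
have [w wP] : exists w, (lead_coef (split_var ord0 p)).@[w] != 0.
  by apply: IH; rewrite lead_coef_eq0.
have Pw0 : map_poly (meval w) (split_var ord0 p) != 0.
  apply: contraNneq wP => /(congr1 (coefp (size (split_var ord0 p)).-1)).
  by rewrite /= coef_map coef0 /= => /eqP.
have [x xP] := poly_nonroot Pw0.
exists (fun i => if unlift ord0 i is Some j then w j else x).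
rewrite -(split_varK ord0 p) meval_join_var unlift_none.
rewrite (_ : map_poly _ _ = map_poly (meval w) (split_var ord0 p)) //.
apply: eq_map_poly => q; apply: meval_eq => j /=; by rewrite liftK.
Qed.

Lemma mpoly_eval_eq0 n (p : {mpoly K[n]}) : (forall v, p.@[v] = 0) -> p = 0.
Proof.
move=> p0; apply/eqP/negPn/negP => /mpoly_nonroot [v].
by rewrite p0 eqxx.
Qed.

Lemma mpoly_eval_ext n (p q : {mpoly K[n]}) :
  (forall v, p.@[v] = q.@[v]) -> p = q.
Proof.
move=> pq; apply/eqP; rewrite -subr_eq0; apply/eqP/mpoly_eval_eq0 => v.
by rewrite mevalB pq subrr.
Qed.

Lemma mderiv_all0 n (p : {mpoly K[n]}) :
  (forall i, p^`M(i) = 0) -> p = (p@_0%MM)%:MP.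
Proof.
move=> dp0; apply/mpolyP => m; rewrite mcoeffC.
have [->|m0] := eqVneq m 0%MM; first by rewrite mulr1.
rewrite mulr0; have [i mi] : exists i, m i != 0%N.
  apply/existsP; apply: contraNT m0 => /existsPn mi; apply/eqP/mnmP => i.
  by rewrite mnm0E; apply/eqP/negPn/mi.
have := congr1 (mcoeff (m - U_(i))%MM) (dp0 i); rewrite mcoeff_deriv mcoeff0 submK.
  by move/eqP; rewrite mulrn_eq0 /= => /eqP.
by rewrite lep1mP.
Qed.

Lemma mpolyC_unit n (c : K) : (c%:MP_[n] \is a GRing.unit) = (c != 0).
Proof.
apply/idP/idP => [|c0]; last by apply: rmorph_unit; rewrite unitfE.
by apply: contraTneq => ->; rewrite mpolyC0 unitr0.
Qed.

Lemma rprime_mderiv n (p : {mpoly K[n]}) : rprime p -> exists i, p^`M(i) != 0.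
Proof.
move=> [p0 pN _]; apply/existsP; apply: contraNT pN => /existsPn dp0.
have pE : p = (p@_0%MM)%:MP.
  by apply: mderiv_all0 => i; apply/eqP/negPn/dp0.
rewrite pE mpolyC_unit; apply: contraNneq p0 => p00.
by rewrite pE p00 mpolyC0.
Qed.

Lemma size_split_var n (e : 'I_n.+1) (p : {mpoly K[n.+1]}) :
  p^`M(e) != 0 -> (1 < size (split_var e p))%N.
Proof.
move=> dp; rewrite ltnNge; apply: contraNN dp => /size1_polyC PE.
by rewrite -(split_varK e p) mderiv_join_var PE derivC rmorph0.
Qed.

(** The role of [r] is that of a resultant: it lies in the ideal of [p] and [w] and is free of x_e.
    It serves the Nullstellensatz and starts the descent in [constant_residue]. *)
Lemma elimination n (e : 'I_n.+1) (p w : {mpoly K[n.+1]}) :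
    rprime p -> p^`M(e) != 0 -> ~ rdvd p w ->
  exists r u v, r != 0 /\ widen_var e r = u * p + v * w.
Proof.
move=> pp /size_split_var sP pw.
have [r [u [v]]] := @iso_elimination {mpoly K[n]} {mpoly K[n.+1]} (split_var e)
  (join_var e) p w (split_varK e) (join_varK e) (@factorial_mpoly n) pp sP pw.
by case=> r0 rE; exists r, u, v; rewrite -join_varC.
Qed.

(** If [p] did not divide [g], elimination would give a nonzero [r] in the ideal of [p] and [g],
    vanishing wherever [p] does. But a point off [r] and off the leading coefficient of [p] lifts to
    a zero of [p]. *)
Theorem nullstellensatz_prime n (p g : {mpoly K[n]}) : rprime p ->
  (forall v, p.@[v] = 0 -> g.@[v] = 0) -> rdvd p g.
Proof.
case: n => [|n] in p g * => pp pg; have [e dp] := rprime_mderiv pp; first by move: (ltn_ord e).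
have [//|npg] := pselect (rdvd p g).
have [r [u [v [r0 rE]]]] := elimination pp dp npg.
pose P := split_var e p.
have sP : (1 < size P)%N by apply: size_split_var.
have lP0 : lead_coef P != 0 by rewrite lead_coef_eq0 -size_poly_gt0 (ltn_trans _ sP).
have [x] := mpoly_nonroot (mulf_neq0 r0 lP0).
rewrite mevalM mulf_eq0 negb_or => /andP[rx Px].
have [y] : exists y, root (map_poly (meval x) P) y.
  by apply: closed_rootP; rewrite size_map_poly_id0 // neq_ltn sP orbT.
rewrite rootE => /eqP yP.
pose z i := if unlift e i is Some j then x j else y.
have zl : z \o lift e =1 x by move=> j; rewrite /z /= liftK.
have pz : p.@[z] = 0.
  rewrite -(split_varK e p) meval_join_var {2}/z unlift_none -[RHS]yP.
  by congr _.[_]; apply: eq_map_poly => q; apply: meval_eq.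
move/eqP: rx; case; rewrite -(meval_eq _ zl) -meval_widen_var rE.
by rewrite mevalD !mevalM pz (pg _ pz) !mulr0 addr0.
Qed.

End MpolyFactorial.

(** * Linear vector fields and reduced equations *)

Section MpolyDegree.
Context {R : idomainType} {n : nat}.
Implicit Types p q : {mpoly R[n]}.

Lemma msize_leP p k :
  reflect (forall m, m \in msupp p -> (mdeg m < k)%N) (msize p <= k)%N.
Proof. by rewrite msizeE; apply: (iffP (bigmax_leqP_seq _ _ _ _)) => H m; auto. Qed.

Lemma msize_mderiv p i : (msize p^`M(i) <= (msize p).-1)%N.
Proof.
apply/msize_leP => m; rewrite mcoeff_msupp mcoeff_deriv => pm.
have : (m + U_(i))%MM \in msupp p.
  by rewrite mcoeff_msupp; apply: contraNneq pm => ->; rewrite mul0rn.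
by move/msize_mdeg_lt; rewrite mdegD mdeg1; lia.
Qed.

Lemma msize_sum_le (I : Type) (r : seq I) (P : pred I) (F : I -> {mpoly R[n]}) k :
  (forall i, P i -> (msize (F i) <= k)%N) ->
  (msize (\sum_(i <- r | P i) F i) <= k)%N.
Proof.
move=> Fk; elim/big_ind: _ => //; first by rewrite msize0.
by move=> p q pk qk; rewrite (leq_trans (msizeD_le _ _)) // geq_max pk.
Qed.

Lemma rdvd_msize p q : q != 0 -> rdvd p q -> (msize p <= msize q)%N.
Proof.
move=> q0 [r qE]; move: q0; rewrite qE mulf_eq0 negb_or => /andP[r0 p0].
rewrite msizeM //; move: r0; rewrite -msize_poly_eq0; lia.
Qed.

Lemma rdvd_scalar p q : p != 0 -> rdvd p q -> (msize q <= msize p)%N ->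
  exists c, q = c *: p.
Proof.
move=> p0 [r ->]; have [-> _|r0] := eqVneq r 0; first by exists 0; rewrite mul0r scale0r.
rewrite msizeM // => rp; exists (r@_0%MM); rewrite -mul_mpolyC.
congr (_ * _); apply: msize1_polyC.
by move: rp p0; rewrite -msize_poly_eq0; case: (msize p); lia.
Qed.

End MpolyDegree.

Section VectorFields.
Context {K : numClosedFieldType} {n : nat}.
Implicit Types (p q f : {mpoly K[n]}) (B : 'M[K]_n) (d : 'rV[{mpoly K[n]}]_n).

(* Matrices act on row vectors from the right, so the vector field of [B] at
   [x] is [x *m B]; it is the field [linear_vfield B^T] of the statement. *)
Definition lin_row B : 'rV[{mpoly K[n]}]_n := \row_i \sum_j B j i *: 'X_j.

Definition lie_deriv B p : {mpoly K[n]} := vfield_apply (lin_row B) p.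

Lemma vfield_applyM d p q :
  vfield_apply d (p * q) = vfield_apply d p * q + p * vfield_apply d q.
Proof.
rewrite /vfield_apply mulr_suml mulr_sumr -big_split; apply: eq_bigr => i _ /=.
by rewrite mderivM; ring.
Qed.

Lemma vfield_apply_is_linear d : linear (vfield_apply d).
Proof.
move=> c p q; rewrite /vfield_apply scaler_sumr -big_split; apply: eq_bigr => i _ /=.
by rewrite mderivD mderivZ mulrDr scalerAr.
Qed.
HB.instance Definition _ d := GRing.isLinear.Build K {mpoly K[n]} {mpoly K[n]} _
  (vfield_apply d) (vfield_apply_is_linear d).

Lemma vfield_applyX d i : vfield_apply d 'X_i = d 0 i.
Proof.
rewrite /vfield_apply (bigD1 i) //= big1 ?addr0 => [|j ij].
  by rewrite mderivXU eqxx mulr1.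
by rewrite mderivXU eq_sym (negbTE ij) mulr0.
Qed.

Lemma vfield_applyC d c : vfield_apply d c%:MP = 0.
Proof. by rewrite /vfield_apply big1 // => i _; rewrite mderivC mulr0. Qed.

Lemma vfield_applyDl d1 d2 p :
  vfield_apply (d1 + d2) p = vfield_apply d1 p + vfield_apply d2 p.
Proof.
by rewrite /vfield_apply -big_split; apply: eq_bigr => i _; rewrite mxE mulrDl.
Qed.

Lemma vfield_applyZl r d p : vfield_apply (r *: d) p = r * vfield_apply d p.
Proof.
by rewrite /vfield_apply mulr_sumr; apply: eq_bigr => i _; rewrite mxE mulrA.
Qed.

Lemma lin_row_linear_vfield A : lin_row A^T = linear_vfield A.
Proof. by apply/rowP => i; rewrite !mxE; apply: eq_bigr => j _; rewrite mxE. Qed.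

Lemma lin_row_is_linear (c : K) B1 B2 :
  lin_row (c *: B1 + B2) = c%:MP *: lin_row B1 + lin_row B2.
Proof.
apply/rowP => i; rewrite !mxE mulr_sumr -big_split; apply: eq_bigr => j _ /=.
by rewrite !mxE scalerDl mul_mpolyC scalerA.
Qed.

Lemma lie_deriv_linear c B1 B2 p :
  lie_deriv (c *: B1 + B2) p = c *: lie_deriv B1 p + lie_deriv B2 p.
Proof.
by rewrite /lie_deriv lin_row_is_linear vfield_applyDl vfield_applyZl mul_mpolyC.
Qed.

Lemma lie_deriv0 p : lie_deriv 0 p = 0.
Proof.
have := lie_deriv_linear (-1) 0 0 p; rewrite scaler0 addr0 scaleN1r.
by rewrite addNr.
Qed.

Lemma lie_deriv_sum (I : finType) (y : I -> K) (F : I -> 'M[K]_n) p :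
  lie_deriv (\sum_i y i *: F i) p = \sum_i y i *: lie_deriv (F i) p.
Proof.
apply: (big_rec2 (fun B r => lie_deriv B p = r)) => [|i B r _ <-].
  exact: lie_deriv0.
by rewrite lie_deriv_linear.
Qed.

Lemma msize_lin_row B i : (msize (lin_row B 0%R i) <= 2)%N.
Proof.
rewrite mxE; apply: msize_sum_le => j _.
by rewrite (leq_trans (msizeZ_le _ _)) // msizeX mdeg1.
Qed.

Lemma msize_lie_deriv B p : (msize (lie_deriv B p) <= msize p)%N.
Proof.
apply: msize_sum_le => i _; have [->|q0] := eqVneq (p^`M(i)) 0.
  by rewrite mulr0 msize0.
have := msize_mderiv p i; have := msize_lin_row B i.
have [->|l0] := eqVneq (lin_row B 0 i) 0; first by rewrite mul0r msize0.
rewrite msizeM //; move: q0; rewrite -msize_poly_eq0.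
by move: (msize _) (msize _) (msize _) => a b c; lia.
Qed.

Definition lie_stab f B : Prop := exists c, lie_deriv B f = c *: f.

(** A linear field does not raise the degree, so the cofactor is a constant. *)
Lemma rdvd_lie_stab f B : f != 0 -> rdvd f (lie_deriv B f) -> lie_stab f B.
Proof. by move=> f0 /rdvd_scalar; apply=> //; apply: msize_lie_deriv. Qed.

Lemma lin_row_eval B (x : 'rV[K]_n) i : (lin_row B 0 i).@[x 0] = (x *m B) 0 i.
Proof.
rewrite !mxE rmorph_sum; apply: eq_bigr => j _ /=.
by rewrite mevalZ mevalXU mulrC.
Qed.

Lemma lie_deriv_eval B p (x : 'rV[K]_n) :
  (lie_deriv B p).@[x 0] = \sum_i (x *m B) 0 i * (p^`M(i)).@[x 0].
Proof.
rewrite /lie_deriv /vfield_apply rmorph_sum; apply: eq_bigr => i _.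
by rewrite /= mevalM lin_row_eval.
Qed.

Lemma mderiv_lin_row B i j : (lin_row B 0 i)^`M(j) = (B j i)%:MP.
Proof.
rewrite mxE raddf_sum (bigD1 j) //= big1 ?addr0 => [|l lj].
  by rewrite mderivZ mderivXU eqxx -mul_mpolyC mulr1.
by rewrite mderivZ mderivXU (negbTE lj) scaler0.
Qed.

Lemma lin_row_coef0 B i : (lin_row B 0 i)@_0%MM = 0.
Proof.
rewrite mxE raddf_sum big1 //= => j _.
by rewrite mcoeffZ mcoeffX -mdeg_eq0 mdeg1 mulr0.
Qed.

(* Comparing linear terms, a polynomial combination of linear fields which is
   itself linear may be taken with constant coefficients. *)
Lemma lin_row_comb (I : finType) (c : I -> {mpoly K[n]}) (F : I -> 'M[K]_n) B :
  lin_row B = \sum_k c k *: lin_row (F k) -> B = \sum_k (c k)@_0%MM *: F k.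
Proof.
move=> BE; apply/matrixP => j i; rewrite summxE.
have := congr1 (fun d => ((d 0 i)^`M(j))@_0%MM) BE.
rewrite mderiv_lin_row mcoeffC eqxx mulr1 summxE.
rewrite (raddf_sum (mderiv j)) (raddf_sum (mcoeff _)) => ->.
apply: eq_bigr => k _; rewrite [in LHS]mxE [in RHS]mxE /= mderivM mderiv_lin_row.
by rewrite mcoeffD !rmorphM /= lin_row_coef0 mulr0 add0r mcoeffC eqxx mulr1.
Qed.

End VectorFields.

Section PolynomialCurves.
Context {K : numClosedFieldType} {n : nat}.
Implicit Types (p : {mpoly K[n]}) (g : 'I_n -> {poly K}).

Definition curve g : {mpoly K[n]} -> {poly K} := mmap polyC g.
HB.instance Definition _ g := GRing.RMorphism.on (curve g).

Lemma curveC g c : curve g c%:MP = c%:P.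
Proof. by rewrite /curve mmapC. Qed.

Lemma curveX g i : curve g 'X_i = g i.
Proof. by rewrite /curve mmapX mmap1U. Qed.

Lemma curveZ g c p : curve g (c *: p) = c *: curve g p.
Proof. by rewrite -mul_mpolyC rmorphM /= curveC mul_polyC. Qed.

Lemma horner_curve g p t : (curve g p).[t] = p.@[fun i => (g i).[t]].
Proof.
elim/mpoly_ring_ind: p => [c|i|p q pE qE|p q pE qE].
- by rewrite curveC mevalC hornerC.
- by rewrite curveX mevalXU.
- by rewrite rmorphD mevalD hornerD pE qE.
by rewrite rmorphM mevalM hornerM pE qE.
Qed.

Lemma deriv_curve g p : (curve g p)^`() = \sum_i curve g p^`M(i) * (g i)^`().
Proof.
elim/mpoly_ring_ind: p => [c|i|p q pE qE|p q pE qE].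
- by rewrite curveC derivC big1 // => i _; rewrite mderivC rmorph0 mul0r.
- rewrite curveX (bigD1 i) //= big1 ?addr0 => [|j ij].
    by rewrite mderivXU eqxx rmorph1 mul1r.
  by rewrite mderivXU eq_sym (negbTE ij) rmorph0 mul0r.
- rewrite rmorphD derivD pE qE -big_split; apply: eq_bigr => i _.
  by rewrite mderivD rmorphD mulrDl.
rewrite rmorphM derivM pE qE mulr_suml mulr_sumr -big_split; apply: eq_bigr => i _.
by rewrite /= mderivM rmorphD !rmorphM /=; ring.
Qed.

End PolynomialCurves.

(** * Prime factorization of a reduced equation *)

Section ReducedFactorization.
Context {K : numClosedFieldType} {n : nat}.
Implicit Types (p g f : {mpoly K[n]}).

Lemma primes_prod_dvd (I : eqType) (r : seq I) (F : I -> {mpoly K[n]}) g :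
  uniq r -> (forall i, i \in r -> rprime (F i)) ->
  (forall i j, i \in r -> j \in r -> i != j -> ~ rdvd (F i) (F j)) ->
  (forall i, i \in r -> rdvd (F i) g) -> rdvd (\prod_(i <- r) F i) g.
Proof.
elim: r g => [|i r IH] g.
  by move=> *; rewrite big_nil; apply: unit_rdvd; rewrite unitr1.
rewrite cons_uniq => /andP[ir ur] Fp Fnd Fg; have [q gE] := Fg i (mem_head _ _).
rewrite big_cons gE mulrC; apply: rdvd_mul (rdvd_refl _).
have rS j : j \in r -> j \in i :: r by rewrite in_cons orbC => ->.
apply: IH => // [j jr|j l jr lr|j jr].
- by apply: Fp; apply: rS.
- by apply: Fnd; apply: rS.
have := Fg j (rS j jr); rewrite gE => /(rprime_dvdM (Fp j (rS j jr))) [//|Fji].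
case: (Fnd j i (rS j jr) (mem_head _ _) _ Fji).
by apply: contraNneq ir => <-.
Qed.

Record reduced_factorization f s := ReducedFactorization {
  factor : 'I_s -> {mpoly K[n]};
  lead : K;
  lead_neq0 : lead != 0;
  factor_prime : forall i, rprime (factor i);
  factor_ndvd : forall i j, i != j -> ~ rdvd (factor i) (factor j);
  factorization : f = lead%:MP * \prod_i factor i
}.

Definition cofactor_of f s (F : reduced_factorization f s) i :=
  (lead F)%:MP * \prod_(j | j != i) factor F j.

Lemma reduced_factorizationP f :
  f != 0 -> (forall g k, rdvd f (g ^+ k) -> rdvd f g) ->
  exists s, inhabited (reduced_factorization f s).
Proof.
move=> f0 frad; have [m [u [s [uU _ sp fE]]]] := factorial_mpoly f0.
have uE : u = (u@_0%MM)%:MP.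
  by move: uU; rewrite unfold_in /= => /andP[/eqP].
exists (size s); split; apply: (@ReducedFactorization f (size s) (tnth (in_tuple s)) (u@_0%MM)).
- by rewrite -(mpolyC_unit n) -uE.
- by move=> i; apply: sp; rewrite (tnth_nth 0) mem_nth.
- move=> i j ij [a FE]; set F := tnth _ in FE.
  have Fip : rprime (F i) by apply: sp; rewrite /F (tnth_nth 0) mem_nth.
  have fE' : f = u * \prod_(i < size s) F i by rewrite fE big_tnth.
  pose r := u * \prod_(l | (l != i) && (l != j)) F l.
  have fE2 : f = r * a * F i ^+ 2.
    rewrite fE' (bigD1 i) //= (bigD1 j) //=; last by rewrite eq_sym.
    by rewrite FE /r; ring.
  (* A repeated prime contradicts radicality: [f] divides the square of [f / F i], hence [f / F i]
     itself, and [F i] would be a unit. *)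
  have : rdvd f ((r * a * F i) ^+ 2) by exists (r * a); rewrite fE2; ring.
  move/frad => [t tE]; apply: (rprime_ndvd1 Fip); exists t.
  apply: (mulfI (_ : r * a * F i != 0)); last by rewrite mulr1 {1}tE fE2; ring.
  by move: f0; rewrite fE2 exprS expr1 mulrA mulf_eq0 => /norP[].
by rewrite -uE fE big_tnth.
Qed.

Section Factors.
Context {f : {mpoly K[n]}} {s : nat} (F : reduced_factorization f s).

Lemma factor_cofactor i : f = factor F i * cofactor_of F i.
Proof. by rewrite [f in LHS](factorization F) (bigD1 i) //= mulrCA. Qed.

Lemma factor_dvd i : rdvd (factor F i) f.
Proof. by exists (cofactor_of F i); rewrite mulrC; apply: factor_cofactor. Qed.

Lemma factor_neq0 i : factor F i != 0.
Proof. exact/rprime_neq0/factor_prime. Qed.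

Lemma reduced_neq0 : f != 0.
Proof.
rewrite (factorization F) mulf_neq0 ?mpolyC_eq0 ?lead_neq0 //.
by apply/prodf_neq0 => i _; apply: factor_neq0.
Qed.

Lemma factor_dvd_cofactor i j : i != j -> rdvd (factor F i) (cofactor_of F j).
Proof.
move=> ij; apply/rdvd_mull; rewrite (bigD1 i) //=; exact/rdvd_mulr/rdvd_refl.
Qed.

Lemma factor_ndvd_cofactor i : ~ rdvd (factor F i) (cofactor_of F i).
Proof.
move/(rprime_dvdM (factor_prime F i)) => [].
  by apply: rprime_ndvd_unit; rewrite ?mpolyC_unit ?lead_neq0 //; apply: factor_prime.
rewrite -big_filter => /(rprime_dvd_prod (factor_prime F i)) [j].
by rewrite mem_filter eq_sym => /andP[ji _]; apply: factor_ndvd.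
Qed.

Lemma reduced_dvd g : (forall i, rdvd (factor F i) g) -> rdvd f g.
Proof.
move=> Fg; rewrite (factorization F).
have [q gE] := @primes_prod_dvd _ (index_enum 'I_s) (factor F) g
  (index_enum_uniq _) (fun i _ => factor_prime F i) (fun i j _ _ => factor_ndvd (i := i) (j := j))
  (fun i _ => Fg i).
exists ((lead F)^-1%:MP * q); rewrite gE.
rewrite [RHS](_ : _ = ((lead F)^-1%:MP * (lead F)%:MP) * (q * \prod_i factor F i)); last by ring.
by rewrite -mpolyCM mulVf ?lead_neq0 // mul1r.
Qed.

Lemma prime_dvd_reduced p : rprime p -> rdvd p f -> exists i, rdvd (factor F i) p.
Proof.
move=> pp pf; have : rdvd p ((lead F)%:MP * \prod_i factor F i).
  by rewrite -factorization.
move=> /(rprime_dvdM pp) [].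
  by move/rprime_ndvd_unit => []; rewrite // mpolyC_unit lead_neq0.
move/(rprime_dvd_prod pp) => [i _ pi]; exists i.
by apply: rprime_dvd_sym => //; apply: factor_prime.
Qed.

Lemma nullstellensatz_reduced g :
  (forall v, f.@[v] = 0 -> g.@[v] = 0) -> rdvd f g.
Proof.
move=> fg; apply: reduced_dvd => i; apply: nullstellensatz_prime (factor_prime F i) _.
by move=> v iv; apply: fg; rewrite (factor_cofactor i) mevalM iv mul0r.
Qed.

End Factors.

Lemma prime_ndvd_mderiv p e : p^`M(e) != 0 -> ~ rdvd p p^`M(e).
Proof.
move=> dp /(rdvd_msize dp); have := msize_mderiv p e.
by move: dp; rewrite -msize_poly_eq0; move: (msize _) (msize _) => a b; lia.
Qed.

End ReducedFactorization.

(** * Saito's criterion *)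

Section SaitoCriterion.
Context {K : numClosedFieldType} {n : nat}.
Implicit Types (f : {mpoly K[n]}) (d : 'rV[{mpoly K[n]}]_n).

Definition lin_mx m (B : 'I_m -> 'M[K]_n) : 'M[{mpoly K[n]}]_(m, n) :=
  \matrix_(k < m) lin_row (B k).

Lemma lin_mxE m (B : 'I_m -> 'M[K]_n) k i : lin_mx B k i = lin_row (B k) 0 i.
Proof. by rewrite !mxE. Qed.

Lemma row_lin_mx m (B : 'I_m -> 'M[K]_n) k : row k (lin_mx B) = lin_row (B k).
Proof. by rewrite rowK. Qed.

Lemma mulmx_lin_mx m (B : 'I_m -> 'M[K]_n) (c : 'rV_m) :
  c *m lin_mx B = \sum_k c 0 k *: lin_row (B k).
Proof. by rewrite mulmx_sum_row; apply: eq_bigr => k _; rewrite row_lin_mx. Qed.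

Lemma factor_ndvd_mderiv f s (F : reduced_factorization f s) i e :
  (factor F i)^`M(e) != 0 -> ~ rdvd (factor F i) f^`M(e).
Proof.
move=> dF; have -> : f^`M(e) = factor F i * (cofactor_of F i)^`M(e) +
    (factor F i)^`M(e) * cofactor_of F i.
  by rewrite [in LHS](factor_cofactor F i) mderivM addrC.
move/(rdvd_addr (rdvd_mulr _ (rdvd_refl _)))/(rprime_dvdM (factor_prime F i)).
by case=> [/(prime_ndvd_mderiv dF)|/factor_ndvd_cofactor].
Qed.

Section FreeBasis.
Context {f : {mpoly K[n]}} {m : nat} {B : 'I_m -> 'M[K]_n}.
Local Notation M := (lin_mx B).
Hypothesis f0 : f != 0.
Hypothesis M_basis : forall d, log_vfield f d -> exists! c, d = c *m M.

Lemma log_rows_mul p (T : 'M[{mpoly K[n]}]_(p, n)) :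
  (forall k, log_vfield f (row k T)) -> exists C : 'M_(p, m), T = C *m M.
Proof.
move=> Tlog; have /all_sig [c cE] k : {c | row k T = c *m M}.
  by have /cid [c [-> _]] := M_basis (Tlog k); exists c.
exists (\matrix_k c k); apply/row_matrixP => k.
by rewrite row_mul rowK -cE.
Qed.

(** The fields f d/dx_k are logarithmic, which gives [C]. Then (M C - f) M = 0, and uniqueness of
    coefficients gives the second equation. *)
Lemma basis_inverse : exists C : 'M_(n, m), C *m M = f%:M /\ M *m C = f%:M.
Proof.
have [k|C CM] := log_rows_mul (T := f%:M).
  exists f^`M(k); rewrite /vfield_apply (bigD1 k) //= big1 ?addr0 => [|i ik].
    by rewrite !mxE eqxx mulrC.
  by rewrite !mxE eq_sym (negbTE ik) mul0r.
exists C; split=> //; apply/eqP; rewrite -subr_eq0; apply/eqP/row_matrixP => k.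
have [|c [_ cU]] := M_basis (d := 0).
  by exists 0; rewrite mul0r /vfield_apply big1 // => i _; rewrite mxE mul0r.
rewrite row0 -(cU 0) ?mul0mx //; apply/esym/cU; rewrite -row_mul mulmxBl.
by rewrite -mulmxA -CM scalar_mxC subrr row0.
Qed.

(** The traces of [C *m M] and [M *m C] agree, so [n] copies of [f] equal [m] copies, in
    characteristic zero. *)
Lemma free_basis_size : m = n.
Proof.
have [C [CM MC]] := basis_inverse.
have := mxtrace_mulC C M; rewrite CM MC !mxtrace_scalar => /(congr1 (mcoeff (mlead f))).
rewrite !mcoeffMn => /mulrIn -> //.
by rewrite mleadc_eq0.
Qed.

End FreeBasis.

(** Cramer's rule makes [f] divide [\det M] times each partial derivative of [f], hence [\det M],
    since no factor of [f] divides all these partials. The quotient [h] must then be shown to have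
    no prime; such a prime would divide [\det f%:M], so be a factor of [f]. *)
Theorem saito f s (F : reduced_factorization f s) (B : 'I_n -> 'M[K]_n) :
  (forall k, log_vfield f (row k (lin_mx B))) ->
  (forall d, log_vfield f d -> exists! c, d = c *m lin_mx B) ->
  exists2 h : K, h != 0 & \det (lin_mx B) = h%:MP * f.
Proof.
set M := lin_mx B => M_log M_basis; have f0 := reduced_neq0 F.
have [C [CM _]] := basis_inverse M_basis.
have detM0 : \det M != 0.
  have := congr1 determinant CM; rewrite det_mulmx det_scalar => detCM.
  by apply: contraNneq (expf_neq0 n f0) => M0; rewrite -detCM M0 mulr0.
have fdetM a : rdvd f (\det M * f^`M(a)).
  pose grad := \col_i f^`M(i).
  have -> : \det M * f^`M(a) = \sum_k \adj M a k * (M *m grad) k 0.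
    have := congr1 (fun A => (A *m grad) a 0) (mul_adj_mx M).
    by rewrite -mulmxA mul_scalar_mx !mxE => <-.
  apply: rdvd_sum => k _; apply: rdvd_mull; have [q qE] := M_log k.
  exists q; rewrite -qE mxE /vfield_apply; apply: eq_bigr => i _.
  by rewrite !mxE.
have [h hE] : rdvd f (\det M).
  apply: (reduced_dvd (F := F)) => i; have [e de] := rprime_mderiv (factor_prime F i).
  have := rdvd_trans (factor_dvd F i) (fdetM e).
  by case/(rprime_dvdM (factor_prime F i)) => // /(factor_ndvd_mderiv de).
have h0 : h != 0 by apply: contraNneq detM0 => h0; rewrite hE h0 mul0r.
suff hU : h \is a GRing.unit.
  have hC : h = (h@_0%MM)%:MP by move: hU; rewrite unfold_in /= => /andP[/eqP].
  exists (h@_0%MM); last by rewrite -hC.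
  by rewrite -(mpolyC_unit n) -hC.
have [[|l] [u [ps [uU sz ps_p hf]]]] := factorial_mpoly h0.
  by rewrite hf (size0nil sz) big_nil mulr1.
case: ps => // p ps in sz ps_p hf; have pp : rprime p by apply: ps_p; rewrite mem_head.
have ph : rdvd p h.
  by exists (u * \prod_(q <- ps) q); rewrite hf big_cons mulrA mulrAC.
have pf : rdvd p f.
  apply: (rprime_dvdX (m := n) pp); rewrite -det_scalar -CM det_mulmx hE.
  exact/rdvd_mull/rdvd_mulr.
have [i Fip] := prime_dvd_reduced F pp pf.
have [e de] := rprime_mderiv (factor_prime F i).
(* Tangential fields along [f = 0] together with [f d/dx_e] have determinant
   [f * (df/dx_e)^(n-1)], so [h] divides a power of [df/dx_e]. *)
pose T : 'M[{mpoly K[n]}]_n := \matrix_(a, b)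
  if a == e then f *+ (b == e) else f^`M(e) *+ (b == a) - f^`M(a) *+ (b == e).
have [a|C' TE] := log_rows_mul M_basis (T := T).
  rewrite /log_vfield; suff -> : vfield_apply (row a T) f = (f^`M(a) *+ (a == e)) * f.
    by exists (f^`M(a) *+ (a == e)).
  rewrite /vfield_apply; have [->|ae] := eqVneq a e.
    rewrite (bigD1 e) //= big1 ?addr0 => [|b be]; rewrite !mxE eqxx.
      by rewrite !mulr1n mulrC.
    by rewrite (negbTE be) mul0r.
  rewrite mul0r (bigD1 e) //= (bigD1 a) //= big1 ?addr0 => [|b /andP[be ba]].
    rewrite !mxE (negbTE ae) eqxx eq_sym (negbTE ae) eqxx /=; ring.
  by rewrite !mxE (negbTE ae) (negbTE ba) (negbTE be) subrr mul0r.
have detT : \det T = f * f^`M(e) ^+ n.-1.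
  rewrite (expand_det_row _ e) (bigD1 e) //= big1 ?addr0 => [|b be]; last first.
    by rewrite !mxE eqxx (negbTE be) mul0r.
  rewrite !mxE !eqxx mulr1n /cofactor -signr_odd addnn odd_double expr0 mul1r.
  congr (_ * _); rewrite -det_scalar; congr (\det _); apply/matrixP => a b.
  rewrite !mxE !(eq_sym _ e) !(negbTE (neq_lift _ _)) subr0 eq_sym.
  by rewrite (inj_eq lift_inj).
move: detT; rewrite TE det_mulmx -/M hE => detT.
have /(rdvd_trans ph)/(rdvd_trans Fip) : rdvd h (f^`M(e) ^+ n.-1).
  by exists (\det C'); apply: (mulfI f0); rewrite -detT; ring.
by move/(rprime_dvdX (factor_prime F i))/(factor_ndvd_mderiv de).
Qed.

Record saito_basis (D : set 'rV[K]_n) f (s : nat) := SaitoBasis {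
  saito_fact : reduced_factorization f s;
  saito_mx : 'I_n -> 'M[K]_n;
  saito_const : K;
  saito_const_neq0 : saito_const != 0;
  saito_det : \det (lin_mx saito_mx) = saito_const%:MP * f;
  saito_lie : forall k, lie_stab f (saito_mx k);
  saito_span : forall B, lie_stab f B -> exists y : 'I_n -> K,
    B = \sum_k y k *: saito_mx k
}.

Lemma lie_stab_log f B : lie_stab f B -> log_vfield f (lin_row B).
Proof. by case=> c cE; exists c%:MP; rewrite mul_mpolyC. Qed.

Lemma linear_free_divisor_saito (D : set 'rV[K]_n) : linear_free_divisor D ->
  exists f s, [/\ (1 < msize f)%N, D = zeros [set f] & inhabited (saito_basis D f s)].
Proof.
case=> f [f1 frad DE] [m [A [A_log A_basis]]].
have f0 : f != 0 by apply: contraTneq f1 => ->; rewrite msize0.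
have [s [F]] := reduced_factorizationP f0 frad.
pose B k := (A k)^T.
have M_log k : log_vfield f (row k (lin_mx B)).
  by rewrite row_lin_mx lin_row_linear_vfield; apply: A_log.
have M_basis d : log_vfield f d -> exists! c, d = c *m lin_mx B.
  have BE c : c *m lin_mx B = \sum_k c 0 k *: linear_vfield (A k).
    rewrite mulmx_lin_mx; apply: eq_bigr => k _.
    by rewrite lin_row_linear_vfield.
  by move/A_basis => [c [cE cU]]; exists c; split=> [|c']; rewrite BE //; apply: cU.
exists f, s; split=> //.
move: (free_basis_size f0 M_basis) => mn; subst m.
have [h h0 hE] := saito F M_log M_basis.
split; apply: (@SaitoBasis D f s F B h) => // [k|B' /lie_stab_log/M_basis [c [cE _]]].
  have := M_log k; rewrite row_lin_mx; exact: rdvd_lie_stab.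
exists (fun k => (c 0 k)@_0%MM).
by apply: (lin_row_comb (c := fun k => c 0 k)); rewrite cE mulmx_lin_mx.
Qed.

End SaitoCriterion.

(** * Linear substitutions and the commutant *)

Section LinearSubstitution.
Context {K : numClosedFieldType} {n : nat}.
Implicit Types (p q : {mpoly K[n]}) (A B g h : 'M[K]_n) (x : 'rV[K]_n).

Lemma mpoly_eval_rV_ext p q :
  (forall x, p.@[x 0] = q.@[x 0]) -> p = q.
Proof.
move=> pq; apply: mpoly_eval_ext => v.
have vE : (\row_i v i : 'rV_n) 0 =1 v by move=> i; rewrite mxE.
by rewrite -!(meval_eq _ vE).
Qed.

(** Pullback of functions along [x |-> x *m g]; the right action on points makes it a left action on
    polynomials. *)
Definition mact g : {mpoly K[n]} -> {mpoly K[n]} :=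
  comp_mpoly [tuple lin_row g 0 i | i < n].
HB.instance Definition _ g := GRing.RMorphism.on (mact g).

Lemma mactC g c : mact g c%:MP = c%:MP.
Proof. by rewrite /mact comp_mpolyC. Qed.

Lemma mactX g i : mact g 'X_i = lin_row g 0 i.
Proof. by rewrite /mact comp_mpolyXU -tnth_nth tnth_mktuple. Qed.

Lemma mactZ g c p : mact g (c *: p) = c *: mact g p.
Proof. by rewrite -!mul_mpolyC rmorphM /= mactC. Qed.

Lemma mact_eval g p x : (mact g p).@[x 0] = p.@[(x *m g) 0].
Proof.
rewrite /mact comp_mpoly_meval; apply: meval_eq => i.
by rewrite tnth_mktuple lin_row_eval.
Qed.

Lemma mactM g h p : mact g (mact h p) = mact (g *m h) p.
Proof. by apply: mpoly_eval_rV_ext => x; rewrite !mact_eval mulmxA. Qed.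

Lemma mact1 p : mact 1%:M p = p.
Proof. by apply: mpoly_eval_rV_ext => x; rewrite mact_eval mulmx1. Qed.

Lemma mactK g : g \in unitmx -> cancel (mact g) (mact (invmx g)).
Proof. by move=> gU p; rewrite mactM mulVmx // mact1. Qed.

Lemma mactVK g : g \in unitmx -> cancel (mact (invmx g)) (mact g).
Proof. by move=> gU p; rewrite mactM mulmxV // mact1. Qed.

Lemma lin_row_mul A B i : \sum_j B j i *: lin_row A 0 j = lin_row (A *m B) 0 i.
Proof.
apply: mpoly_eval_rV_ext => x; rewrite lin_row_eval mulmxA rmorph_sum mxE.
by apply: eq_bigr => j _; rewrite /= mevalZ lin_row_eval mulrC.
Qed.

Lemma lie_derivX B i : lie_deriv B 'X_i = lin_row B 0 i.
Proof. exact: vfield_applyX. Qed.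

Lemma lie_derivC B c : lie_deriv B c%:MP = 0.
Proof. exact: vfield_applyC. Qed.

Lemma lie_derivM B p q : lie_deriv B (p * q) = lie_deriv B p * q + p * lie_deriv B q.
Proof. exact: vfield_applyM. Qed.

HB.instance Definition _ B := GRing.Linear.copy (lie_deriv B) (vfield_apply (lin_row B)).

Lemma lie_derivD B p q : lie_deriv B (p + q) = lie_deriv B p + lie_deriv B q.
Proof. exact: linearD. Qed.

Lemma lie_derivZ B c p : lie_deriv B (c *: p) = c *: lie_deriv B p.
Proof. exact: linearZ. Qed.

Lemma lie_deriv_lin_row A B i : lie_deriv A (lin_row B 0 i) = lin_row (A *m B) 0 i.
Proof.
rewrite [lin_row B 0 i]mxE linear_sum -lin_row_mul; apply: eq_bigr => j _.
by rewrite linearZ /= lie_derivX.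
Qed.

Lemma lin_rowB A B i : lin_row (A - B) 0 i = lin_row A 0 i - lin_row B 0 i.
Proof.
have := lin_row_is_linear (-1) B A; rewrite scaleN1r addrC => ->.
by rewrite !mxE mpolyCN mpolyC1 mulN1r addrC.
Qed.

Lemma lie_bracket A B p :
  lie_deriv A (lie_deriv B p) - lie_deriv B (lie_deriv A p)
  = lie_deriv (A *m B - B *m A) p.
Proof.
elim/mpoly_ring_ind: p => [c|i|p q pE qE|p q pE qE].
- by rewrite !lie_derivC !linear0 addr0.
- by rewrite !lie_derivX !lie_deriv_lin_row -lin_rowB.
- by rewrite !lie_derivD -pE -qE; ring.
by rewrite !(lie_derivM, lie_derivD) -pE -qE; ring.
Qed.

Lemma lie_deriv_mact g B p : g \in unitmx ->
  lie_deriv B (mact g p) = mact g (lie_deriv (invmx g *m B *m g) p).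
Proof.
move=> gU; elim/mpoly_ring_ind: p => [c|i|p q pE qE|p q pE qE].
- by rewrite mactC !lie_derivC rmorph0.
- rewrite mactX lie_deriv_lin_row lie_derivX [in RHS]mxE rmorph_sum.
  rewrite (eq_bigr (fun j => (invmx g *m B *m g) j i *: lin_row g 0 j)).
    by rewrite lin_row_mul !mulmxA mulmxV // mul1mx.
  by move=> j _; rewrite /= mactZ mactX.
- by rewrite rmorphD !lie_derivD rmorphD pE qE.
by rewrite rmorphM !lie_derivM rmorphD !rmorphM /= pE qE.
Qed.

Lemma lie_stab_mact g f B : g \in unitmx ->
  lie_stab (mact g f) B <-> lie_stab f (invmx g *m B *m g).
Proof.
move=> gU; split=> -[c cE]; exists c; last by rewrite lie_deriv_mact // cE mactZ.
apply: (can_inj (mactK gU)); by rewrite -lie_deriv_mact // cE mactZ.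
Qed.

Lemma lie_stab_scale c f B : lie_stab f B -> lie_stab (c *: f) B.
Proof. by case=> l lE; exists l; rewrite lie_derivZ lE !scalerA mulrC. Qed.

Lemma lie_stab_comb (I : finType) (y : I -> K) (F : I -> 'M[K]_n) f :
  (forall i, lie_stab f (F i)) -> lie_stab f (\sum_i y i *: F i).
Proof.
move=> Ff; have /all_sig [c cE] i : {c | lie_deriv (F i) f = c *: f} := cid (Ff i).
exists (\sum_i y i * c i); rewrite lie_deriv_sum scaler_suml.
by apply: eq_bigr => i _; rewrite cE scalerA.
Qed.

Lemma lie_stab_bracket f A B : lie_stab f A -> lie_stab f B ->
  lie_stab f (A *m B - B *m A).
Proof.
case=> [a aE] [b bE]; exists 0; rewrite -lie_bracket aE bE !lie_derivZ aE bE.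
by rewrite !scalerA mulrC subrr scale0r.
Qed.

End LinearSubstitution.

Section Commutant.
Context {K : numClosedFieldType} {n : nat} {D : set 'rV[K]_n}.
Context {f : {mpoly K[n]}} {s : nat} (S : saito_basis D f s).

(* If [P] commutes with the basis, then [M(x(1+tP)) = M(x)(1+tP)], and taking
   determinants [f(x(1+tP)) = det(1+tP) f(x)]; now differentiate at [t = 0]. *)
Lemma commutant_lie_stab (P : 'M[K]_n) :
  (forall k, P *m saito_mx S k = saito_mx S k *m P) -> lie_stab f P.
Proof.
move=> PB; pose Q := 1%:M + 'X *: map_mx polyC P : 'M[{poly K}]_n.
(* This is the trace of [P]; leaving it as the derivative of a determinant avoids computing it. *)
exists ((\det Q)^`().[0]); apply: mpoly_eval_rV_ext => x.
pose g i : {poly K} := (x 0 i)%:P + (x *m P) 0 i *: 'X.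
have gE : curve g f = (f.@[x 0])%:P * \det Q.
  have h0 : (saito_const S)%:P != 0 by rewrite polyC_eq0 saito_const_neq0.
  apply: (mulfI h0); rewrite -[in LHS](curveC g) -rmorphM -saito_det -det_map_mx mulrA -polyCM.
  rewrite -[saito_const S in RHS](mevalC (x 0)) -mevalM -saito_det -det_map_mx -det_map_mx.
  rewrite -det_mulmx; congr (\det _); apply/matrixP => k i.
  have gl A j : curve g (lin_row A 0 j) = ((x *m A) 0 j)%:P + (x *m P *m A) 0 j *: 'X.
    rewrite !mxE rmorph_sum raddf_sum scaler_suml -big_split; apply: eq_bigr => l _.
    by rewrite /= curveZ curveX scalerDr scalerA -mul_polyC -polyCM mulrC [A l j * _]mulrC.
  have Mx j : map_mx polyC (map_mx (meval (x 0)) (lin_mx (saito_mx S))) k j =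
      ((x *m saito_mx S k) 0 j)%:P.
    by rewrite 2!mxE lin_mxE lin_row_eval.
  rewrite mulmxDr mulmx1 -scalemxAr [LHS]mxE lin_mxE /= gl [RHS]mxE Mx; congr (_ + _).
  rewrite -mulmxA PB mulmxA [RHS]mxE mulrC -mul_polyC; congr (_ * _).
  rewrite [RHS]mxE [in LHS]mxE raddf_sum; apply: eq_bigr => j _.
  by rewrite Mx /= [map_mx _ _ _ _]mxE polyCM.
have := congr1 (fun p => (p^`()).[0]) gE.
rewrite deriv_curve derivM derivC mul0r add0r hornerM hornerC mevalZ mulrC => <-.
rewrite lie_deriv_eval horner_sum; apply: eq_bigr => i _.
rewrite hornerM horner_curve mulrC derivD derivC derivZ derivX add0r.
rewrite !hornerE /= mulr1; congr (_ * _); apply: meval_eq => j.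
by rewrite !hornerE.
Qed.

Lemma lie_stab1 : lie_stab f 1%:M.
Proof. by apply: commutant_lie_stab => k; rewrite mul1mx mulmx1. Qed.

Lemma saito_free (y : 'I_n -> K) : \sum_k y k *: saito_mx S k = 0 -> y =1 fun=> 0.
Proof.
move=> y0; have M0 : \det (lin_mx (saito_mx S)) != 0.
  by rewrite saito_det mulf_neq0 ?mpolyC_eq0 ?saito_const_neq0 // (reduced_neq0 (saito_fact S)).
have : (\row_k (y k)%:MP) *m lin_mx (saito_mx S) = 0.
  rewrite mulmx_lin_mx; apply/rowP => i; rewrite summxE [RHS]mxE.
  apply: mpoly_eval_rV_ext => x; rewrite rmorph_sum meval0.
  transitivity ((x *m \sum_k y k *: saito_mx S k) 0 i); last by rewrite y0 mulmx0 mxE.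
  rewrite mulmx_sumr summxE; apply: eq_bigr => k _.
  by rewrite 2!mxE /= mevalM mevalC lin_row_eval -scalemxAr [in RHS]mxE.
move/(congr1 (mulmx^~ (\adj (lin_mx (saito_mx S))))).
rewrite -mulmxA mul_mx_adj mul0mx mul_mx_scalar => /eqP.
move=> H k; have /eqP := congr1 (fun A : 'rV__ => A 0 k) (eqP H).
by rewrite !mxE mulf_eq0 (negbTE M0) mpolyC_eq0 => /eqP.
Qed.

End Commutant.

(** * Jordan decomposition and replicas *)

Section JordanDecomposition.
Context {K : numClosedFieldType}.

(** For [k] large, [q] evaluated at a matrix with eigenvalues [rs] is its semisimple part. *)
Lemma chinese_roots (k : nat) (rs : seq K) : uniq rs ->
  exists q : {poly K}, forall z, z \in rs -> ('X - z%:P) ^+ k %| q - z%:P.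
Proof.
elim: rs => [|z rs IH] /=; first by exists 0.
case/andP=> zrs /IH [q qP]; pose Q := \prod_(w <- rs) ('X - w%:P) ^+ k.
have /Bezout_eq1_coprimepP [[u v] /= uv1] : coprimep Q (('X - z%:P) ^+ k).
  rewrite coprimep_sym /Q big_seq; elim/big_ind: _ => [|x y cx cy|w wrs].
  - by rewrite coprimep1.
  - by rewrite coprimepMr cx.
  rewrite coprimep_expl // coprimep_expr // coprimep_XsubC root_XsubC.
  by apply: contraNneq zrs => <-.
exists (q + (z%:P - q) * (u * Q)) => w; rewrite in_cons => /orP[/eqP ->|wrs].
  rewrite (_ : _ + _ - _ = (q - z%:P) * (1 - u * Q)); last by ring.
  by rewrite -uv1 addrAC subrr add0r; apply/dvdp_mull/dvdp_mull/dvdpp.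
rewrite addrAC; apply: dvdp_add; first exact: qP.
apply/dvdp_mull/dvdp_mull; rewrite /Q (big_rem w) //=; exact/dvdp_mulr/dvdpp.
Qed.

Lemma jordan_decomposition n (A : 'M[K]_n.+1) :
  exists P d N, [/\ P \in unitmx, A = invmx P *m (diag_mx d + N) *m P,
    diag_mx d *m N = N *m diag_mx d & exists k, N ^+ k = 0].
Proof.
have [r rE] := closed_field_poly_normal (char_poly A).
rewrite (monicP (char_poly_monic A)) scale1r in rE.
pose rs := undup r; have urs : uniq rs := undup_uniq r.
pose R := \prod_(z <- rs) ('X - z%:P) : {poly K}; pose k := size r.
have cR : char_poly A %| R ^+ k.
  rewrite rE /k; have : {subset r <= rs} by move=> z; rewrite mem_undup.
  elim: (r) => [|z l IH] lrs; first by rewrite big_nil expr0 dvdpp.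
  rewrite big_cons exprS dvdp_mul //.
    by rewrite dvdp_XsubCl root_prod_XsubC lrs ?mem_head.
  by apply: IH => w wl; rewrite lrs // in_cons wl orbT.
(* With the exponent [k.+1] instead of [k], each ['X - z%:P] divides [q - z%:P] without a case
   distinction on [k]. *)
have [q qP] := chinese_roots k.+1 urs.
have horner0 p : R ^+ k %| p -> horner_mx A p = 0.
  move=> /(dvdp_trans cR)/(dvdp_trans (mxminpoly_dvd_char A)).
  by rewrite dvd_mxminpoly => /eqP.
pose S := horner_mx A q; pose N0 := horner_mx A ('X - q).
have AE : A = S + N0 by rewrite /S /N0 -rmorphD addrC subrK /= horner_mx_X.
have SN : S *m N0 = N0 *m S by rewrite /S /N0 !mulmxE -!rmorphM mulrC.
have N0k : N0 ^+ k = 0.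
  rewrite /N0 -rmorphXn; apply: horner0; apply: dvdp_exp2r.
  apply: uniq_roots_dvdp; last by rewrite uniq_rootsE.
  apply/allP => z zrs; rewrite -dvdp_XsubCl (_ : _ - q = ('X - z%:P) - (q - z%:P)); last by ring.
  by apply: dvdp_sub => //; apply: dvdp_trans (qP z zrs); rewrite exprS dvdp_mulr.
have [P PU /diagonalizable_forPex [d /(simmxP PU) PS]] : diagonalizable S.
  apply/diagonalizableP; exists rs => //; apply/mxminpoly_minP.
  rewrite rmorph_prod (eq_bigr (fun z => horner_mx A (q - z%:P))) => [|z _].
    rewrite -rmorph_prod; apply: horner0; rewrite /R -prodrXl big_seq [X in _ %| X]big_seq.
    elim/big_rec2: _ => [|z x y zrs yx]; first exact: dvdpp.
    by apply: dvdp_mul => //; apply: dvdp_trans (qP z zrs); rewrite exprSr dvdp_mulr.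
  by rewrite !rmorphB /= !horner_mx_C horner_mx_X.
have SE : S = invmx P *m diag_mx d *m P by rewrite -mulmxA -PS mulKmx.
have dE : diag_mx d = P *m S *m invmx P by rewrite PS mulmxK.
have NX l : (P *m N0 *m invmx P) ^+ l = P *m N0 ^+ l *m invmx P.
  elim: l => [|l IH]; first by rewrite !expr0 mulmx1 mulmxV.
  by rewrite !exprS IH -!mulmxE !mulmxA mulmxKV.
exists P, d, (P *m N0 *m invmx P); split=> //.
- by rewrite mulmxDr mulmxDl -SE !mulmxA mulVmx // mul1mx mulmxKV.
- by rewrite dE !mulmxA !mulmxKV // -![P *m _ *m _]mulmxA SN.
by exists k; rewrite NX N0k mulmx0 mul0mx.
Qed.

Lemma mxtrace_nilpotent n (N : 'M[K]_n.+1) k : N ^+ k = 0 -> \tr N = 0.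
Proof.
move=> Nk; have mX : mxminpoly N %| 'X^k.
  by rewrite dvd_mxminpoly rmorphXn /= horner_mx_X Nk.
have [r rE] := closed_field_poly_normal (char_poly N).
rewrite (monicP (char_poly_monic N)) scale1r in rE.
have r0 z : z \in r -> z = 0.
  move=> zr; have : root (char_poly N) z by rewrite rE root_prod_XsubC.
  rewrite -root_mxminpoly => /(root_dvdp mX); rewrite rootE hornerXn expf_eq0.
  by case/andP=> _ /eqP.
have cE : char_poly N = 'X^(size r).
  rewrite rE (eq_big_seq (fun _ => 'X)) => [|z /r0 ->]; last by rewrite subr0.
  by rewrite big_const_seq count_predT iter_mulr_1.
have szr : size r = n.+1.
  by have := size_char_poly N; rewrite cE size_polyXn => -[].
have := @char_poly_trace _ _ N (ltn0Sn n).
rewrite cE szr coefXn /= ltn_eqF // => /esym/eqP.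
by rewrite oppr_eq0 => /eqP.
Qed.

End JordanDecomposition.

Section Replicas.
Context {K : numClosedFieldType} {n : nat}.
Implicit Types (p q : {mpoly K[n]}) (d : 'rV[K]_n).

(** The eigenvalue of the diagonal field of [d] on the monomial [m]. *)
Definition weight d (m : 'X_{1..n}) : K := \sum_i (m i)%:R * d 0 i.

Lemma lie_deriv_diag_coef d p m :
  (lie_deriv (diag_mx d) p)@_m = weight d m * p@_m.
Proof.
have lX l : lie_deriv (diag_mx d) 'X_[l] = weight d l *: 'X_[l].
  rewrite /lie_deriv /vfield_apply scaler_suml; apply: eq_bigr => i _.
  have -> : lin_row (diag_mx d) 0 i = d 0 i *: 'X_i.
    rewrite mxE (bigD1 i) //= big1 ?addr0 => [|j ji].
      by rewrite !mxE eqxx mulr1n.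
    by rewrite !mxE (negbTE ji) mulr0n scale0r.
  rewrite mderivX; case: (eqVneq (l i) 0%N) => [->|li].
    by rewrite scale0r mulr0 mul0r scale0r.
  rewrite -scalerAl -scalerAr -mpolyXD addmC submK ?lep1mP //.
  by rewrite scalerA mulrC.
rewrite [p in LHS]mpolyE (linear_sum (lie_deriv _)) (raddf_sum (mcoeff _)) /=.
have [mp|mp] := boolP (m \in msupp p).
  rewrite (bigD1_seq m) ?msupp_uniq //= big1 ?addr0 => [|l lm].
    by rewrite lie_derivZ lX !mcoeffZ mcoeffX eqxx mulr1 mulrC.
  by rewrite lie_derivZ lX !mcoeffZ mcoeffX (negbTE lm) !mulr0.
rewrite (memN_msupp_eq0 mp) mulr0 big1_seq // => l /andP[_ lp].
rewrite lie_derivZ lX !mcoeffZ mcoeffX.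
have -> : (l == m) = false by apply: contraNF mp => /eqP <-.
by rewrite !mulr0.
Qed.

Lemma lie_deriv_diagP d p c :
  (forall m, m \in msupp p -> weight d m = c) -> lie_deriv (diag_mx d) p = c *: p.
Proof.
move=> dp; apply/mpolyP => m; rewrite lie_deriv_diag_coef mcoeffZ.
have [mp|mp] := boolP (m \in msupp p); first by rewrite dp.
by rewrite (memN_msupp_eq0 mp) !mulr0.
Qed.

End Replicas.

Section JordanReplicas.
Context {K : numClosedFieldType} {n : nat}.
Implicit Types (p q : {mpoly K[n.+1]}) (d : 'rV[K]_n.+1) (N A : 'M[K]_n.+1).

Lemma iter_lie0 N j : iter j (lie_deriv N) 0 = 0.
Proof. by elim: j => //= j ->; rewrite linear0. Qed.

Lemma iter_lieD N j p q :
  iter j (lie_deriv N) (p + q) = iter j (lie_deriv N) p + iter j (lie_deriv N) q.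
Proof. by elim: j => //= j ->; rewrite lie_derivD. Qed.

Lemma iter_lieM N a b p q :
  iter a (lie_deriv N) p = 0 -> iter b (lie_deriv N) q = 0 ->
  iter (a + b) (lie_deriv N) (p * q) = 0.
Proof.
have [l] := ubnP (a + b)%N; elim: l a b p q => // l IH [|a] [|b] p q abl.
- by move=> /= -> _; rewrite mul0r.
- by move=> /= -> _; rewrite mul0r -iterS iter_lie0.
- by move=> _ /= ->; rewrite mulr0 -iterS iter_lie0.
move=> pa qb; rewrite addSn iterSr lie_derivM iter_lieD.
rewrite [X in X + _](_ : _ = 0) ?add0r; last by apply: IH; rewrite -?iterSr //; lia.
by rewrite -addSnnS; apply: IH; rewrite -?iterSr //; lia.
Qed.

Lemma lie_deriv_locally_nilpotent N k p : N ^+ k = 0 ->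
  exists j, iter j (lie_deriv N) p = 0.
Proof.
move=> Nk; elim/mpoly_ring_ind: p => [c|i|p q [a pa] [b qb]|p q [a pa] [b qb]].
- by exists 1%N; rewrite /= lie_derivC.
- exists k.+1; have lX l : iter l.+1 (lie_deriv N) 'X_i = lin_row (N ^+ l.+1) 0 i.
    elim: l => [|l IH]; first by rewrite /= lie_derivX expr1.
    by rewrite iterS IH lie_deriv_lin_row [in RHS]exprS.
  rewrite lX exprS Nk mulr0 mxE big1 // => j _.
  by rewrite mxE scale0r.
- exists (a + b)%N; rewrite iter_lieD [X in _ + X]iterD qb iter_lie0 addr0.
  by rewrite addnC iterD pa iter_lie0.
by exists (a + b)%N; apply: iter_lieM.
Qed.

(* The semisimple part acts diagonally on monomials and commutes with the
   locally nilpotent action of [N], so on an eigenvector [p] both act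
   separately by the eigenvalue. *)
Lemma lie_deriv_jordan d N k c p :
  diag_mx d *m N = N *m diag_mx d -> N ^+ k = 0 ->
  lie_deriv (diag_mx d + N) p = c *: p ->
  (forall m, m \in msupp p -> weight d m = c) /\ lie_deriv N p = 0.
Proof.
(* [T] commutes with the action of [N] and agrees with its negative on [p], so some iterate of [T]
   kills [p]. As [T] is diagonal on monomials, it is already zero on those of [p]. *)
move=> dN Nk pE; pose T q := lie_deriv (diag_mx d) q - c *: q.
have lDN q : lie_deriv (diag_mx d + N) q = lie_deriv (diag_mx d) q + lie_deriv N q.
  by have := lie_deriv_linear 1 (diag_mx d) N q; rewrite !scale1r.
have Tp : T p = - lie_deriv N p by rewrite /T -pE lDN; ring.
have TN q : T (lie_deriv N q) = lie_deriv N (T q).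
  rewrite /T linearB /= lie_derivZ; congr (_ - _); apply/eqP.
  by rewrite -subr_eq0 lie_bracket dN subrr lie_deriv0.
have TZ a q : T (a *: q) = a *: T q.
  by rewrite /T lie_derivZ scalerBr !scalerA mulrC.
have TNi j q : T (iter j (lie_deriv N) q) = iter j (lie_deriv N) (T q).
  by elim: j => //= j IH; rewrite TN IH.
have Ti j : iter j T p = (-1) ^+ j *: iter j (lie_deriv N) p.
  elim: j => [|j IH]; first by rewrite scale1r.
  rewrite iterS IH TZ TNi Tp -scaleN1r exprSr -scalerA; congr (_ *: _).
  by elim: j {IH} => //= j ->; rewrite lie_derivZ.
have Tm j q m : (iter j T q)@_m = (weight d m - c) ^+ j * q@_m.
  elim: j => [|j IH]; first by rewrite mul1r.
  by rewrite iterS {1}/T mcoeffB lie_deriv_diag_coef mcoeffZ IH exprS; ring.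
have [j pj] := lie_deriv_locally_nilpotent p Nk.
have wc m : m \in msupp p -> weight d m = c.
  rewrite mcoeff_msupp => pm; have := Tm j p m.
  rewrite Ti pj scaler0 mcoeff0 => /esym/eqP.
  by rewrite mulf_eq0 (negbTE pm) orbF expf_eq0 => /andP[_]; rewrite subr_eq0 => /eqP.
split=> //; apply/eqP; rewrite -oppr_eq0 -Tp /T.
by rewrite (lie_deriv_diagP wc) subrr.
Qed.

End JordanReplicas.

(** * Natural exponents satisfying the relations of given eigenvalues *)

Section IntegerReplica.
Context {K : numClosedFieldType} {n : nat}.

(** The kernel over [K] of a rational matrix is spanned by rational vectors; if these all had equal
    entries at [a] and [b], so would [d]. *)
Lemma rational_relations L (M : 'M[rat]_(n, L)) (d : 'rV[K]_n) a b :
  d *m map_mx ratr M = 0 -> d 0 a != d 0 b ->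
  exists r : 'rV[rat]_n, r *m M = 0 /\ r 0 a != r 0 b.
Proof.
move=> dM dab.
have /submxP [y dE] : (d <= map_mx ratr (kermx M))%MS.
  by rewrite map_kermx; apply/sub_kermxP.
apply/not_existsP => H; move/eqP: dab; apply.
have ab i : kermx M i a = kermx M i b.
  apply/eqP/negPn/negP => neq; apply: (H (row i (kermx M))).
  by split; [rewrite -row_mul mulmx_ker row0 | rewrite [row i _ 0 a]mxE [row i _ 0 b]mxE].
rewrite dE !mxE; apply: eq_bigr => i _.
by rewrite [map_mx _ _ i a]mxE [map_mx _ _ i b]mxE ab.
Qed.

(** The shift [C] makes the exponents nonnegative; on monomials of a fixed degree it only adds a
    constant to the weight. *)
Lemma clear_denominators (r : 'rV[rat]_n) : exists e : 'I_n -> nat, exists q C : rat,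
  q != 0 /\ forall i, (e i)%:R = r 0 i * q + C.
Proof.
pose z i := numq (r 0 i) * \prod_(j | j != i) denq (r 0 j).
pose q := \prod_j denq (r 0 j); pose C := (\sum_j `|z j|)%N.
have zE i : (z i)%:~R = r 0 i * q%:~R :> rat.
  rewrite /z /q [in RHS](bigD1 i) //= !rmorphM /= mulrA; congr (_ * _).
  exact: numqE.
exists (fun i => `|(z i + C%:Z)%R|%N), q%:~R, C%:R; split=> [|i].
  by rewrite intr_eq0; apply/prodf_neq0 => j _; apply: denq_neq0.
rewrite -zE !pmulrn -intrD; congr (_%:~R).
rewrite gez0_abs // -lerBlDl sub0r; apply: le_trans (_ : `|z i|%N%:Z <= _).
  by rewrite abszE -normrN ler_norm.
by rewrite lez_nat /C (bigD1 i) //= leq_addr.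
Qed.

(** Equality of weights is a system of linear relations on [d] whose coefficients, the differences
    [m - m0], are integers. A polynomial supported on [ms] is then semi-invariant under the torus
    with entries t^(e i), which still separates [a] from [b]. *)
Lemma nat_replica (ms : seq 'X_{1..n}) (d : 'rV[K]_n) c deg a b :
  (forall m, m \in ms -> weight d m = c) -> (forall m, m \in ms -> mdeg m = deg) ->
  d 0 a != d 0 b -> exists (e : 'I_n -> nat) E,
    (forall m, m \in ms -> (\sum_i m i * e i)%N = E) /\ e a != e b.
Proof.
move=> msc msdeg dab; pose m0 := nth 0%MM ms 0.
pose M : 'M[rat]_(n, size ms) := \matrix_(i, l) ((nth 0%MM ms l i)%:R - (m0 i)%:R).
have ms_l (l : 'I_(size ms)) : nth 0%MM ms l \in ms by rewrite mem_nth.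
have ms_0 (l : 'I_(size ms)) : m0 \in ms.
  by rewrite mem_nth // (leq_ltn_trans _ (ltn_ord l)).
have [|r [rM rab]] := rational_relations (M := M) _ dab.
  apply/rowP => l; rewrite !mxE.
  transitivity (weight d (nth 0%MM ms l) - weight d m0).
    rewrite /weight -sumrB; apply: eq_bigr => i _.
    by rewrite !mxE rmorphB /= !ratr_nat; ring.
  by rewrite !msc ?ms_l ?ms_0 ?subrr //.
have [e [q [C [q0 eE]]]] := clear_denominators r.
exists e, (\sum_i m0 i * e i)%N; split; last first.
  apply: contraNneq rab => eab; have := eE a; rewrite eab eE => /addIr/(mulIf q0) ->.
  by [].
move=> m mms; have lm : (index m ms < size ms)%N by rewrite index_mem.
have key (m' : 'X_{1..n}) : m' \in ms ->
    (\sum_i m' i * e i)%:R = (\sum_i (m' i)%:R * r 0 i) * q + deg%:R * C :> rat.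
  move=> m'ms; rewrite -(msdeg _ m'ms) mdegE natr_sum natr_sum !mulr_suml -big_split.
  by apply: eq_bigr => i _; rewrite natrM eE /=; ring.
apply/eqP; rewrite -(eqr_nat rat) (key m) // (key m0); last exact: ms_0 (Ordinal lm).
rewrite -subr_eq0 opprD addrACA subrr addr0 -mulrBl mulf_eq0; apply/orP; left.
have /rowP/(_ (Ordinal lm)) := rM; rewrite !mxE => rM0.
rewrite -sumrB -[X in _ == X]rM0; apply/eqP; apply: eq_bigr => i _.
by rewrite mxE /= nth_index //; ring.
Qed.

End IntegerReplica.

(** * One-parameter subgroups *)

Section TruncatedExponential.
Context {K : numClosedFieldType}.

Definition exp_poly (k : nat) (t : K) : {poly K} :=
  \poly_(i < k) (t ^+ i / i`!%:R).

Lemma fact_neq0 i : i`!%:R != 0 :> K.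
Proof. by rewrite pnatr_eq0 -lt0n fact_gt0. Qed.

Lemma exp_polyM k s t :
  exists q, exp_poly k s * exp_poly k t = exp_poly k (s + t) + q * 'X^k.
Proof.
exists (drop_poly k (exp_poly k s * exp_poly k t)).
rewrite -[LHS](poly_take_drop k); congr (_ + _).
apply/polyP => i; rewrite coef_take_poly coef_poly; case: ltnP => // ik.
rewrite coefM addrC exprDn mulr_suml; apply: eq_bigr => j _.
have ji : (j <= i)%N by rewrite -ltnS.
rewrite !coef_poly (leq_ltn_trans ji ik) (leq_ltn_trans (leq_subr _ _) ik).
rewrite -(bin_fact ji) !natrM -mulr_natl.
have b0 : 'C(i, j)%:R != 0 :> K by rewrite pnatr_eq0 -lt0n bin_gt0.
by field; rewrite b0 !fact_neq0.
Qed.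

Context {n : nat}.
Implicit Types (N X : 'M[K]_n.+1).

(** For [N ^+ k = 0] this is the full exponential of tN; being polynomial in [t], its values form a
    Zariski connected family. *)
Definition exp_mx k N t : 'M[K]_n.+1 := \sum_(i < k) (t ^+ i / i`!%:R) *: N ^+ i.

Lemma exp_mxE k N t : exp_mx k N t = horner_mx N (exp_poly k t).
Proof.
rewrite /exp_poly poly_def rmorph_sum; apply: eq_bigr => i _ /=.
by rewrite -mul_polyC rmorphM rmorphXn /= horner_mx_C horner_mx_X -mulmxE mul_scalar_mx.
Qed.

Lemma exp_mxM k N s t : N ^+ k = 0 ->
  exp_mx k N s *m exp_mx k N t = exp_mx k N (s + t).
Proof.
move=> Nk; rewrite !exp_mxE mulmxE -rmorphM; have [q ->] := exp_polyM k s t.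
by rewrite rmorphD rmorphM rmorphXn /= horner_mx_X Nk mulr0 addr0.
Qed.

Lemma exp_mx0 k N : exp_mx k.+1 N 0 = 1%:M.
Proof.
rewrite /exp_mx big_ord_recl big1 ?addr0 => [|i _].
  by rewrite expr0 fact0 divr1 scale1r expr0.
by rewrite exprS mul0r mul0r scale0r.
Qed.

Lemma poly_eval_eq0 (p : {poly K}) : (forall t, p.[t] = 0) -> p = 0.
Proof.
move=> p0; apply/eqP/negPn/negP => /poly_nonroot [t].
by rewrite p0 eqxx.
Qed.

Lemma deriv0_const (p : {poly K}) t : p^`() = 0 -> p.[t] = p.[0].
Proof.
move=> dp; suff /size1_polyC -> : (size p <= 1)%N by rewrite !hornerC.
apply/leq_sizeP => -[//|i] _; have /polyP/(_ i) := dp.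
by rewrite coef_deriv coef0 => /eqP; rewrite mulrn_eq0 => /eqP.
Qed.

(** The commutator of [X] with the exponential is a polynomial in [t] with linear coefficient X N -
    N X; the truncation at [k.+2] keeps the linear term. *)
Lemma exp_mx_comm k N X : N ^+ k.+2 = 0 ->
  (forall t, X *m exp_mx k.+2 N t = exp_mx k.+2 N t *m X) -> X *m N = N *m X.
Proof.
move=> Nk XE; apply/matrixP => a b; apply/eqP; rewrite -subr_eq0; apply/eqP.
pose p := \poly_(i < k.+2) ((X *m N ^+ i - N ^+ i *m X) a b / i`!%:R).
have : p = 0.
  apply: poly_eval_eq0 => t; have /matrixP/(_ a b)/eqP := XE t.
  rewrite -subr_eq0 => /eqP <-; rewrite horner_poly /exp_mx mulmx_sumr mulmx_suml.
  rewrite !summxE -sumrB; apply: eq_bigr => i _.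
  by rewrite -scalemxAr -scalemxAl !mxE; ring.
by move/polyP/(_ 1%N); rewrite coef_poly coef0 /= divr1 expr1 !mxE.
Qed.

(** Along the curve x exp(tN) the derivative of [p] is the value of [lie_deriv N p], so [p] is
    constant there. *)
Lemma mact_exp_mx k N (p : {mpoly K[n.+1]}) t : N ^+ k.+1 = 0 ->
  lie_deriv N p = 0 -> mact (exp_mx k.+1 N t) p = p.
Proof.
move=> Nk Np; apply: mpoly_eval_rV_ext => x; rewrite mact_eval.
pose g i : {poly K} := \poly_(l < k.+1) ((x *m N ^+ l) 0 i / l`!%:R).
have gE u i : (g i).[u] = (x *m exp_mx k.+1 N u) 0 i.
  rewrite horner_poly /exp_mx mulmx_sumr summxE; apply: eq_bigr => l _.
  by rewrite -scalemxAr [in RHS]mxE; ring.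
have cE u : (curve g p).[u] = p.@[(x *m exp_mx k.+1 N u) 0].
  by rewrite horner_curve; apply: meval_eq => i; rewrite gE.
rewrite -cE -[x in RHS]mulmx1 -(exp_mx0 k N) -cE; apply: deriv0_const.
transitivity (curve g (lie_deriv N p)); last by rewrite Np rmorph0.
rewrite deriv_curve /lie_deriv /vfield_apply rmorph_sum.
apply: eq_bigr => i _; rewrite rmorphM /= mulrC; congr (_ * _).
rewrite mxE rmorph_sum; apply/polyP => l; rewrite coef_deriv coef_sum /=.
transitivity ((x *m N ^+ l.+1) 0 i / l`!%:R *+ (l < k.+1)%N).
  rewrite coef_poly; case: ltnP => lk.
    have -> : (l < k.+1)%N by lia.
    rewrite factS natrM -mulr_natr mulr1n.
    by field; rewrite fact_neq0 nat1r pnatr_eq0.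
  rewrite mul0rn; case: ltnP => // lk'; have -> : l = k by lia.
  by rewrite Nk mulmx0 mxE mul0r.
rewrite exprSr -mulmxE mulmxA [in LHS]mxE mulr_suml -sumrMnl.
apply: eq_bigr => j _; rewrite curveZ curveX coefZ coef_poly.
case: ltnP => _; rewrite ?mulr0 ?mulr0n // mulr1n; ring.
Qed.

End TruncatedExponential.

(** * Connectedness of polynomial families *)

Section PolynomialFamilies.
Context {K : numClosedFieldType} {n : nat}.

(** Two polynomials not vanishing on the curve are both nonzero at a common parameter. The zeros of
    [q] are the excluded parameters: [q] is 1 for exponentials and ['X] for tori. *)
Lemma curve_irreducible m (A : set 'rV[K]_m) (g : 'I_m -> {poly K}) (q : {poly K}) :
  q != 0 -> A = [set v | exists2 t, q.[t] != 0 & v = \row_i (g i).[t]] ->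
  zariski_irreducible A.
Proof.
move=> q0 AE; split.
  have [t qt] := poly_nonroot q0; exists (\row_i (g i).[t]).
  by rewrite AE; exists t.
move=> Z1 Z2 [S1 ->] [S2 ->] AZ; apply: contrapT => /not_orP [AZ1 AZ2].
have key S : ~ (A `<=` zeros S) -> exists2 p, S p & q * curve g p != 0.
  move/existsNP => [v /not_implyP [Av]] /existsNP [p /not_implyP [Sp pv]].
  exists p => //; move: Av; rewrite AE => -[t qt vE].
  apply: contra_not_neq pv => /(congr1 (horner^~ t)); rewrite hornerM horner0.
  move/eqP; rewrite mulf_eq0 (negbTE qt) horner_curve vE => /eqP <-.
  by apply: meval_eq => i; rewrite mxE.
have [p1 S1p p1g] := key _ AZ1; have [p2 S2p p2g] := key _ AZ2.
have [t] := poly_nonroot (mulf_neq0 p1g p2g).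
rewrite !hornerM !mulf_eq0 => /norP[/norP[qt p1t] /norP[_ p2t]].
have vA : A (\row_i (g i).[t]) by rewrite AE; exists t.
have rE p : p.@[(\row_i (g i).[t] : 'rV__) 0] = (curve g p).[t].
  by rewrite horner_curve; apply: meval_eq => i; rewrite mxE.
case: (AZ _ vA) => [/(_ _ S1p)|/(_ _ S2p)]; rewrite rE => /eqP.
  by rewrite (negbTE p1t).
by rewrite (negbTE p2t).
Qed.

Lemma irreducible_connected m (A : set 'rV[K]_m) :
  zariski_irreducible A -> zariski_connected A.
Proof. by case=> A0 AI; split=> // Z1 Z2 Z1c Z2c AZ _; apply: AI. Qed.

Lemma curve_connected_GL (H : set 'M[K]_n) (g : 'M[{poly K}]_n) (q : {poly K}) :
  q != 0 -> H = [set h | exists2 t, q.[t] != 0 & h = map_mx (horner^~ t) g] ->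
  connected_GL H.
Proof.
move=> q0 HE; apply: irreducible_connected.
apply: (@curve_irreducible _ _ (fun i => mxvec g 0 i) q) => //.
have vE t : mxvec (map_mx (horner^~ t) g) = \row_i (mxvec g 0 i).[t].
  by apply/rowP => i; rewrite -map_mxvec !mxE.
apply/seteqP; split=> [_ [h + <-]|_ [t qt ->]].
  by rewrite HE => -[t qt ->]; exists t.
exists (map_mx (horner^~ t) g) => //.
by rewrite HE; exists t.
Qed.

End PolynomialFamilies.

(** * The group of a linear free divisor *)

Section AssociatedGroup.
Context {K : numClosedFieldType} {n : nat} {D : set 'rV[K]_n.+1}.
Context {f : {mpoly K[n.+1]}} {s : nat} (S : saito_basis D f s).
Hypothesis DE : D = zeros [set f].
Implicit Types (g h X A : 'M[K]_n.+1) (H : set 'M[K]_n.+1).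

Lemma divisorP x : D x <-> f.@[x 0] = 0.
Proof.
by rewrite DE; split=> [/(_ f erefl)|fx _ ->].
Qed.

(** The cofactor for [g] is inverse to the pullback of the one for [invmx g], so it is a unit of the
    polynomial ring, hence a constant. *)
Lemma mact_semi_invariant g (p : {mpoly K[n.+1]}) : g \in unitmx -> p != 0 ->
  rdvd p (mact g p) -> rdvd p (mact (invmx g) p) ->
  exists2 c, c != 0 & mact g p = c *: p.
Proof.
move=> gU p0 [r rE] [r' r'E].
have rr' : mact g r' * r = 1.
  apply: (mulIf p0); rewrite mul1r -mulrA -rE -rmorphM -r'E.
  by rewrite /= mactVK.
have rU : r \is a GRing.unit by apply/unitrP; exists (mact g r'); rewrite rr' mulrC rr'.
have rC : r = (r@_0%MM)%:MP by move: (rU); rewrite unfold_in /= => /andP[/eqP].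
exists (r@_0%MM); first by rewrite -(mpolyC_unit n.+1) -rC.
by rewrite -mul_mpolyC -rC.
Qed.

Lemma preserves_semi_invariant H : subgroup_GL H -> preserves H D ->
  forall g, H g -> exists2 c, c != 0 & mact g f = c *: f.
Proof.
move=> [HU _ _ HV] HD g Hg.
have fg h : H h -> rdvd f (mact h f).
  move=> Hh; apply: (nullstellensatz_reduced (saito_fact S)) => v fv.
  pose x : 'rV_n.+1 := \row_i v i.
  have vE p : p.@[v] = p.@[x 0] by apply: meval_eq => i; rewrite mxE.
  rewrite vE mact_eval; apply/divisorP; rewrite -(HD h Hh); exists x => //.
  by apply/divisorP; rewrite -vE.
apply: mact_semi_invariant; [exact: HU | | exact: fg | by apply/fg/HV].
exact: reduced_neq0 (saito_fact S).
Qed.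

Lemma semi_invariant_preserves H : subgroup_GL H ->
  (forall g, H g -> exists c, mact g f = c *: f) -> preserves H D.
Proof.
move=> [HU _ _ HV] Hf g Hg.
have sub h x : H h -> D x -> D (x *m h).
  move=> Hh /divisorP fx; apply/divisorP; have [c cE] := Hf h Hh.
  by rewrite -mact_eval cE mevalZ fx mulr0.
apply/seteqP; split=> [_ [x Dx <-]|x Dx]; first exact: sub.
exists (x *m invmx g); first by apply: sub => //; apply: HV.
by rewrite mulmxKV // HU.
Qed.

Context {G : set 'M[K]_n.+1} (G_assoc : associated_group D G).

Lemma associated_unit g : G g -> g \in unitmx.
Proof. by case: G_assoc => -[GU _ _ _] _ _ _; apply: GU. Qed.

Lemma associated_inv g : G g -> G (invmx g).
Proof. by case: G_assoc => -[_ _ _ GV] _ _ _; apply: GV. Qed.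

Lemma associated_semi_invariant g : G g -> exists2 c, c != 0 & mact g f = c *: f.
Proof. by case: G_assoc => GG _ GD _; apply: preserves_semi_invariant GG GD g. Qed.

Lemma sub_associated_group H : subgroup_GL H -> connected_GL H ->
  (forall g, H g -> exists c, mact g f = c *: f) -> H `<=` G.
Proof.
move=> HG Hc Hf; case: G_assoc => _ _ _; apply=> //.
exact: semi_invariant_preserves.
Qed.

Lemma lie_stab_conj g A : G g -> lie_stab f A -> lie_stab f (invmx g *m A *m g).
Proof.
move=> Gg fA; apply/lie_stab_mact; first exact: associated_unit.
have [c _ ->] := associated_semi_invariant Gg.
exact: lie_stab_scale.
Qed.

Lemma map_horner_mul (P Q : 'M[K]_n.+1) (Y : 'M[{poly K}]_n.+1) t :
  map_mx (horner^~ t) (map_mx polyC P *m Y *m map_mx polyC Q) =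
  P *m map_mx (horner^~ t) Y *m Q.
Proof.
have polyCK A : map_mx (horner_eval t) (map_mx polyC A) = A.
  by move=> *; apply/matrixP => i j; rewrite !mxE /horner_eval hornerC.
rewrite -[LHS]/(map_mx (horner_eval t) _) !map_mxM.
by rewrite !polyCK.
Qed.

(** The family conjugated back by [P] is a connected group fixing [f] up to constants, so it lies in
    [G] by maximality. The matrix [P] is the change of coordinates of a Jordan decomposition. *)
Lemma one_parameter_comm (P X : 'M[K]_n.+1) (E : K -> 'M[K]_n.+1)
    (Y : 'M[{poly K}]_n.+1) (q : {poly K}) :
  P \in unitmx -> q != 0 -> (forall t, E t = map_mx (horner^~ t) Y) ->
  (exists2 t, q.[t] != 0 & E t = 1%:M) ->
  (forall t u, q.[t] != 0 -> q.[u] != 0 ->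
     exists2 w, q.[w] != 0 & E t *m E u = E w) ->
  (forall t, q.[t] != 0 -> exists2 w, q.[w] != 0 & E t *m E w = 1%:M) ->
  (forall t, q.[t] != 0 -> exists c, mact (E t) (mact P f) = c *: mact P f) ->
  (forall g, G g -> X *m g = g *m X) ->
  forall t, q.[t] != 0 -> (P *m X *m invmx P) *m E t = E t *m (P *m X *m invmx P).
Proof.
move=> PU q0 EY [t1 qt1 E1] EM EV Ef XG.
pose H := [set h | exists2 t, q.[t] != 0 & h = invmx P *m E t *m P].
have cM A B : (invmx P *m A *m P) *m (invmx P *m B *m P) = invmx P *m (A *m B) *m P.
  by rewrite !mulmxA mulmxK.
have HU h : H h -> h \in unitmx.
  case=> t qt ->; have [w _ /mulmx1_unit [EU _]] := EV t qt.
  by rewrite !unitmx_mul unitmx_inv PU EU.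
have HG : subgroup_GL H.
  split=> [//||_ _ [t qt ->] [u qu ->]|h Hh].
  - by exists t1 => //; rewrite E1 mulmx1 mulVmx.
  - by have [w qw tu] := EM t u qt qu; exists w => //; rewrite cM tu.
  have hU := HU h Hh; case: Hh => t qt hE; have [w qw tw] := EV t qt.
  exists w => //; rewrite -[RHS](mulKmx hU) hE cM tw mulmx1 mulVmx // mulmx1.
  by [].
have Hc : connected_GL H.
  apply: (@curve_connected_GL _ _ _
    (map_mx polyC (invmx P) *m Y *m map_mx polyC P) q) => //.
  apply/seteqP; split=> h [t qt ->]; exists t => //.
    by rewrite map_horner_mul -EY.
  by rewrite map_horner_mul -EY.
have HsG : H `<=` G.
  apply: sub_associated_group => // _ [t qt ->]; have [c cE] := Ef t qt.
  by exists c; rewrite -!mactM cE mactZ mactK.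
move=> t qt; have /XG XE : G (invmx P *m E t *m P) by apply: HsG; exists t.
have := congr1 (fun A => P *m A *m invmx P) XE.
by rewrite !mulmxA mulmxV // mul1mx mulmxK // => ->.
Qed.

Lemma mact_diag_mx (p : {mpoly K[n.+1]}) (e : 'I_n.+1 -> nat) E t :
  (forall m, m \in msupp p -> (\sum_i m i * e i)%N = E) ->
  mact (diag_mx (\row_i t ^+ e i)) p = t ^+ E *: p.
Proof.
move=> pE; apply: mpoly_eval_rV_ext => x; rewrite mact_eval mevalZ !mevalE.
rewrite mulr_sumr; apply: eq_big_seq => m /pE mE.
rewrite mulrCA; congr (_ * _); rewrite -mE expr_sum -big_split.
apply: eq_bigr => i _ /=; rewrite mul_mx_diag !mxE exprMn -exprM mulrC.
by rewrite [(m i * _)%N]mulnC.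
Qed.

Lemma diag_mxM (d e : 'rV[K]_n.+1) :
  diag_mx d *m diag_mx e = diag_mx (\row_i (d 0 i * e 0 i)).
Proof.
apply/matrixP => i j; rewrite mul_diag_mx !mxE.
by case: eqP => [->|_]; rewrite ?mulr1n // !mulr0n mulr0.
Qed.

(* By the Jordan decomposition it suffices that [X] commutes with the
   unipotent group [exp(tN)] and with the tori of integral weights obtained
   from the relations between the eigenvalues. *)
Lemma commute_group_lie X A : (forall g, G g -> X *m g = g *m X) ->
  lie_stab f A -> X *m A = A *m X.
Proof.
move=> XG [c cE]; have [P [d [N [PU AE dN [k Nk]]]]] := jordan_decomposition A.
pose f' := mact P f; have f'0 : f' != 0.
  apply: contraNneq (reduced_neq0 (saito_fact S)) => /(congr1 (mact (invmx P))).
  by rewrite /f' mactK // rmorph0 => ->.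
have [wt Nf'] : (forall m, m \in msupp f' -> weight d m = c) /\ lie_deriv N f' = 0.
  by apply: lie_deriv_jordan dN Nk _; rewrite lie_deriv_mact // -AE cE mactZ.
(* The identity lies in the Lie algebra, so [f'] is homogeneous, as [nat_replica] requires. *)
have deg m : m \in msupp f' -> mdeg m = mdeg (mlead f').
  have [c1 c1E] := lie_stab1 S.
  have : lie_deriv (diag_mx (const_mx 1)) f' = c1 *: f'.
    by rewrite diag_const_mx lie_deriv_mact // mulmx1 mulVmx // c1E mactZ.
  move=> L1 m'f; apply/eqP; rewrite -(eqr_nat K); apply/eqP.
  have wc l : l \in msupp f' -> (mdeg l)%:R = c1.
    rewrite mcoeff_msupp => l0; have := congr1 (mcoeff l) L1.
    rewrite lie_deriv_diag_coef mcoeffZ => /(mulIf l0) <-.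
    by rewrite mdegE natr_sum; apply: eq_bigr => i _; rewrite mxE mulr1.
  by rewrite !wc // mlead_supp.
pose X' := P *m X *m invmx P.
have XE : X = invmx P *m X' *m P by rewrite /X' !mulmxA mulVmx // mul1mx mulmxKV.
have Nk2 : N ^+ k.+2 = 0 by rewrite -addn2 exprD Nk mul0r.
have X'N : X' *m N = N *m X'.
  apply: (exp_mx_comm Nk2) => t.
  pose Y : 'M[{poly K}]_n.+1 := \matrix_(a, b) \poly_(i < k.+2) ((N ^+ i) a b / i`!%:R).
  apply: (@one_parameter_comm P X (exp_mx k.+2 N) Y 1) => //.
  - by rewrite oner_neq0.
  - move=> u; apply/matrixP => a b; rewrite !mxE horner_poly summxE.
    by apply: eq_bigr => i _; rewrite mxE; ring.
  - by exists 0; rewrite ?exp_mx0 // hornerC oner_neq0.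
  - by move=> u v _ _; exists (u + v); rewrite ?exp_mxM // hornerC oner_neq0.
  - by move=> u _; exists (- u); rewrite ?exp_mxM ?subrr ?exp_mx0 // hornerC oner_neq0.
  - by move=> u _; exists 1; rewrite scale1r mact_exp_mx.
  by rewrite hornerC oner_neq0.
have X'd : X' *m diag_mx d = diag_mx d *m X'.
  (* The claim is that the entry of [X'] at (a, b) vanishes where [d] takes different values; a
     torus with different exponents at [a] and [b] shows it. *)
  apply/matrixP => a b; rewrite mul_mx_diag mul_diag_mx [LHS]mxE [RHS]mxE.
  have [->|dab] := eqVneq (d 0 a) (d 0 b); first by rewrite mulrC.
  have [e [E [eE eab]]] := nat_replica wt deg dab.
  pose Y : 'M[{poly K}]_n.+1 := diag_mx (\row_i 'X^(e i)).
  pose Et t : 'M[K]_n.+1 := diag_mx (\row_i t ^+ e i).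
  (* At the parameter 2, distinct natural exponents give distinct powers. *)
  have : X' *m Et 2 = Et 2 *m X'.
    apply: (@one_parameter_comm P X Et Y 'X) => //.
    - by rewrite polyX_eq0.
    - move=> t; apply/matrixP => i j; rewrite !mxE.
      by case: eqP => _; rewrite ?mulr1n ?mulr0n ?hornerXn ?horner0.
    - exists 1; rewrite ?hornerX ?oner_neq0 // -diag_const_mx; congr diag_mx.
      by apply/rowP => i; rewrite !mxE expr1n.
    - move=> t u; rewrite !hornerX => t0 u0; exists (t * u); first by rewrite hornerX mulf_neq0.
      by rewrite diag_mxM; congr diag_mx; apply/rowP => i; rewrite !mxE exprMn.
    - move=> t; rewrite !hornerX => t0; exists t^-1; first by rewrite hornerX invr_eq0.
      rewrite diag_mxM -diag_const_mx; congr diag_mx; apply/rowP => i.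
      by rewrite !mxE -exprMn mulfV // expr1n.
    - by move=> t _; exists (t ^+ E); apply: mact_diag_mx.
    by rewrite hornerX pnatr_eq0.
  rewrite /Et mul_mx_diag mul_diag_mx; move: (X') => Y' /matrixP/(_ a b)/eqP.
  rewrite !mxE mulrC -subr_eq0 -mulrBl mulf_eq0 subr_eq0 -!natrX eqr_nat eqn_exp2l //.
  by rewrite eq_sym (negbTE eab) => /eqP ->; rewrite mul0r mulr0.
have X'S : X' *m (diag_mx d + N) = (diag_mx d + N) *m X'.
  by rewrite mulmxDr mulmxDl X'N X'd.
rewrite AE; move: (X') (diag_mx d + N) X'S XE => Y T YT ->.
by rewrite !mulmxA !mulmxK // -[invmx P *m Y *m T]mulmxA YT !mulmxA.
Qed.

End AssociatedGroup.

(** * Logarithmic forms and characters *)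

(* [closed_eta] says that the 1-form [eta / (p q)] is closed; the constant below
   is its residue along [p = 0]. *)
Section ConstantResidue.
Context {K : numClosedFieldType} {n : nat}.
Context {p q : {mpoly K[n.+1]}} {eta : 'I_n.+1 -> {mpoly K[n.+1]}}.
Hypotheses (pp : rprime p) (npq : ~ rdvd p q).
Hypothesis closed_eta : forall a b,
  p * q * ((eta b)^`M(a) - (eta a)^`M(b)) =
  (p * q)^`M(a) * eta b - (p * q)^`M(b) * eta a.

(** This derivation kills [p], so it is tangent to the hypersurface [p = 0]. *)
Let tangent e a (g : {mpoly K[n.+1]}) := p^`M(e) * g^`M(a) - p^`M(a) * g^`M(e).

Let tangentM e a g h : tangent e a (g * h) = tangent e a g * h + g * tangent e a h.
Proof. by rewrite /tangent !mderivM; ring. Qed.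

Let tangentD e a g h : tangent e a (g + h) = tangent e a g + tangent e a h.
Proof. by rewrite /tangent !mderivD; ring. Qed.

Let tangentZ e a c g : tangent e a (c *: g) = c *: tangent e a g.
Proof. by rewrite /tangent !mderivZ -!scalerAr scalerBr. Qed.

Let tangent_p e a : tangent e a p = 0.
Proof. by rewrite /tangent mulrC subrr. Qed.

Let tangentX e a g m : g * tangent e a (g ^+ m) = m%:R * tangent e a g * g ^+ m.
Proof.
elim: m => [|m IH].
  by rewrite !mul0r expr0 /tangent -mpolyC1 !mderivC !mulr0 subrr mulr0.
by rewrite exprS tangentM IH -natr1; ring.
Qed.

(** The closedness equation is reduced modulo [p], where [q] can be cancelled. *)
Let eta_proportional a b : exists t, p^`M(a) * eta b - p^`M(b) * eta a = p * t.
Proof.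
have : rdvd p (q * (p^`M(a) * eta b - p^`M(b) * eta a)).
  exists (q * ((eta b)^`M(a) - (eta a)^`M(b)) - (q^`M(a) * eta b - q^`M(b) * eta a)).
  have := closed_eta a b; rewrite !mderivM => E.
  rewrite mulrBl [_ * p]mulrC mulrA E; ring.
by case/(rprime_dvdM pp) => [//|[t tE]]; exists t; rewrite tE mulrC.
Qed.

(** Quotient rule cleared of denominators: [eta e] over [q] dp/dx_e restricts to the residue on
    [p = 0], and its tangential derivatives vanish there. *)
Let tangent_ratio e a : exists t,
  (q * p^`M(e)) * tangent e a (eta e) =
  eta e * tangent e a (q * p^`M(e)) + p * t.
Proof.
have [th E1] := eta_proportional a e.
have p0 : p != 0 by apply: rprime_neq0.
have E2 : q * ((eta e)^`M(a) - (eta a)^`M(e)) =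
    q^`M(a) * eta e - q^`M(e) * eta a + q * th.
  apply: (mulfI p0); rewrite mulrA closed_eta !mderivM mulrDr [p * (q * th)]mulrCA -E1; ring.
have := congr1 (mderiv e) E1; rewrite mderivB !mderivM => E3.
rewrite (mderiv_comm a e) in E3.
set s := p^`M(e) in E1 E3 *.
exists (s * q^`M(e) * th - s * q * th^`M(e) + q * s^`M(e) * th).
rewrite /tangent !mderivM -/s; apply/eqP; rewrite -subr_eq0; apply/eqP.
move/eqP: E1; rewrite -subr_eq0 => /eqP E1.
move/eqP: E2; rewrite -subr_eq0 => /eqP E2.
move/eqP: E3; rewrite -subr_eq0 => /eqP E3.
(* An explicit combination of closedness [E2], proportionality [E1] and the derivative [E3] of [E1]
   along x_e, which stands in the place of 0. *)
rewrite [LHS](_ : _ = s ^+ 2 * (q * ((eta e)^`M(a) - (eta a)^`M(e)) -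
    (q^`M(a) * eta e - q^`M(e) * eta a + q * th))
  - q * s * 0 + (s * q^`M(e) + q * s^`M(e)) * (p^`M(a) * eta e - s * eta a - p * th)).
  by rewrite E1 E2 !mulr0 subrr addr0.
rewrite -{1}E3; ring.
Qed.

(** The ratio u/v has zero tangential derivatives; [c] is its value at a point [x] of [p = 0] with
    v(x) nonzero, and [w = u - c v] is to be divisible by [p]. Otherwise elimination gives a nonzero
    polynomial free of x_e in the ideal of [w] and [p]. Its derivatives stay in [I], the polynomials
    that some power of [v] brings into this ideal, and one of them is a nonzero constant; evaluating
    at [x] is absurd. *)
Theorem constant_residue : exists c : K, forall a,
  rdvd p (eta a - c *: (q * p^`M(a))).
Proof.
have [e de] := rprime_mderiv pp.
set s := p^`M(e) in de; pose v := q * s; pose u := eta e.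
have nv : ~ rdvd p v.
  by case/(rprime_dvdM pp) => // /(prime_ndvd_mderiv de).
have [x [px vx]] : exists x, p.@[x] = 0 /\ v.@[x] != 0.
  apply: contrapT => H; apply: nv; apply: nullstellensatz_prime pp _ => x px.
  by apply/eqP/negPn/negP => vx; apply: H; exists x.
pose c := u.@[x] / v.@[x]; exists c.
pose w := u - c *: v.
have wx : w.@[x] = 0 by rewrite mevalB mevalZ /c mulfVK // subrr.
have wT a : exists t, v * tangent e a w = w * tangent e a v + p * t.
  have [t tE] := tangent_ratio e a; exists t.
  have -> : tangent e a w = tangent e a u - c *: tangent e a v.
    by rewrite /w -scaleN1r tangentD !tangentZ scaleN1r.
  have vE : v * tangent e a u = u * tangent e a v + p * t by exact: tE.
  by rewrite mulrBr vE /w -!mul_mpolyC; ring.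
pose I g := exists m al be, v ^+ m * g = al * w + be * p.
have IT a g : I g -> g^`M(e) = 0 -> I g^`M(a).
  case=> m [al [be gE]] dg; have [t tE] := wT a.
  exists m.+2, (q * (v * tangent e a al + al * tangent e a v - m%:R * tangent e a v * al)),
    (q * (al * t + v * tangent e a be - m%:R * tangent e a v * be)).
  have Tg : tangent e a g = s * g^`M(a) by rewrite /tangent dg mulr0 subr0.
  have H : v * (v ^+ m * tangent e a g) =
      v * tangent e a (v ^+ m * g) - m%:R * tangent e a v * (v ^+ m * g).
    have vX := tangentX e a v m.
    have -> : v * tangent e a (v ^+ m * g) =
        v * tangent e a (v ^+ m) * g + v ^+ m.+1 * tangent e a g.
      by rewrite (tangentM e a (v ^+ m) g) exprS; ring.
    by rewrite vX exprS; ring.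
  have -> : v ^+ m.+2 * g^`M(a) = q * (v * (v ^+ m * tangent e a g)).
    by rewrite Tg !exprS /v; ring.
  rewrite H gE tangentD (tangentM e a al w) (tangentM e a be p) tangent_p mulr0 addr0.
  have -> : v * (tangent e a al * w + al * tangent e a w + tangent e a be * p) =
      v * tangent e a al * w + al * (w * tangent e a v + p * t) + v * tangent e a be * p.
    by rewrite -tE; ring.
  ring.
have IF k : forall g, (msize g <= k)%N -> g != 0 -> g^`M(e) = 0 -> ~ I g.
  elim: k => [|k IH] g gk g0 dg gI.
    by move: gk g0; rewrite leqn0 msize_poly_eq0 => ->.
  have [da|] := pselect (forall a, g^`M(a) = 0); last first.
    move/existsNP => [a /eqP da]; apply: (IH g^`M(a)) (IT a g gI dg) => //.
      apply: leq_trans (msize_mderiv _ _) _; move: gk; move: (msize _) => l; lia.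
    by rewrite mderiv_comm dg linear0.
  case: gI => m [al [be /(congr1 (meval x))]].
  rewrite (mderiv_all0 da) mevalD !mevalM px wx !mulr0 addr0 mevalC rmorphXn /= => /eqP.
  rewrite mulf_eq0 expf_eq0 (negbTE vx) andbF /= => /eqP g00.
  by move: g0; rewrite (mderiv_all0 da) g00 mpolyC0 eqxx.
have pw : rdvd p w.
  apply: contrapT => npw; have [r [al [be [r0 rE]]]] := elimination pp de npw.
  have W0 : widen_var e r != 0.
    apply: contraNneq r0 => /(congr1 (split_var e)).
    rewrite -join_varC join_varK rmorph0 => /eqP; by rewrite polyC_eq0.
  apply: (IF _ _ (leqnn _) W0 (mderiv_widen_var e r)).
  by exists 0%N, be, al; rewrite mul1r rE addrC.
(* The component [e] is settled; proportionality of [eta] and dp along [p = 0] transfers it to every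
   [a]. *)
move=> a; have : rdvd p (s * (eta a - c *: (q * p^`M(a)))).
  have [t tE] := eta_proportional a e; have [l lE] := pw.
  exists (p^`M(a) * l - t); rewrite mulrBl -mulrA -lE [t * p]mulrC -tE /w /u /v -/s.
  rewrite -!mul_mpolyC; ring.
by case/(rprime_dvdM pp) => // /(prime_ndvd_mderiv de).
Qed.

End ConstantResidue.

(** * Characters of the factors and their logarithmic forms *)

Section Characters.
Context {K : numClosedFieldType} {n : nat} {D : set 'rV[K]_n.+1}.
Context {f : {mpoly K[n.+1]}} {s : nat} (S : saito_basis D f s).
Implicit Types (A B g X : 'M[K]_n.+1) (p : {mpoly K[n.+1]}).

Local Notation F := (saito_fact S).
Local Notation B_ := (saito_mx S).

(* Meaningful only when [p] is an eigenvector of [A], whose eigenvalue it is. *)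
Definition character p A : K := (lie_deriv A p)@_(mlead p) / mleadc p.

Lemma character_eq p A c : p != 0 -> lie_deriv A p = c *: p -> character p A = c.
Proof. by move=> p0 cE; rewrite /character cE mcoeffZ mulfK // mleadc_eq0. Qed.

Lemma character_sum p (I : finType) (y : I -> K) (C : I -> 'M[K]_n.+1) :
  character p (\sum_i y i *: C i) = \sum_i y i * character p (C i).
Proof.
rewrite /character lie_deriv_sum (raddf_sum (mcoeff _)) mulr_suml.
by apply: eq_bigr => i _; rewrite /= mcoeffZ mulrA.
Qed.

Lemma factor_lie A i : lie_stab f A ->
  lie_deriv A (factor F i) = character (factor F i) A *: factor F i.
Proof.
move=> [c cE]; have F0 := factor_neq0 F i.
suff /(rdvd_lie_stab F0) [l lE] : rdvd (factor F i) (lie_deriv A (factor F i)).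
  by rewrite (character_eq F0 lE).
have : rdvd (factor F i) (lie_deriv A (factor F i) * cofactor_of F i).
  apply: (rdvd_addr (b := factor F i * lie_deriv A (cofactor_of F i))).
    exact/rdvd_mulr/rdvd_refl.
  rewrite addrC -lie_derivM -factor_cofactor cE -mul_mpolyC.
  exact/rdvd_mull/factor_dvd.
by case/(rprime_dvdM (factor_prime F i)) => // /factor_ndvd_cofactor.
Qed.

Section GroupInvariance.
Hypothesis DE : D = zeros [set f].
Context {G : set 'M[K]_n.+1} (G_assoc : associated_group D G).

(** Each fixed [x] imposes one polynomial condition on the entries of [w]. *)
Lemma zariski_closed_vanishing (P : set 'rV[K]_n.+1) p :
  zariski_closed [set w : 'rV[K]_(n.+1 * n.+1) |
    forall x : 'rV_n.+1, P x -> p.@[(x *m vec_mx w) 0] = 0].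
Proof.
pose q (x : 'rV[K]_n.+1) : {mpoly K[n.+1 * n.+1]} :=
  p \mPo [tuple \sum_j x 0 j *: 'X_(mxvec_index j i) | i < n.+1].
have qE x (w : 'rV_(n.+1 * n.+1)) : (q x).@[w 0] = p.@[(x *m vec_mx w) 0].
  rewrite /q comp_mpoly_meval; apply: meval_eq => i.
  rewrite tnth_mktuple rmorph_sum mxE; apply: eq_bigr => j _.
  by rewrite /= mevalZ mevalXU mxE.
exists [set r | exists2 x, P x & r = q x]; apply/seteqP; split=> w wP.
  by move=> _ [x Px ->]; rewrite qE; apply: wP.
by move=> x Px; rewrite -qE; apply: wP; exists x.
Qed.

Lemma mact_dvd_vanishing i p g :
  rdvd (factor F i) (mact g p) <->
  (forall x : 'rV_n.+1, (factor F i).@[x 0] = 0 ->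
     p.@[(x *m vec_mx (mxvec g)) 0] = 0).
Proof.
split=> [[q qE] x xi|H].
  by rewrite mxvecK -mact_eval qE mevalM xi mulr0.
apply: nullstellensatz_prime (factor_prime F i) _ => v vi.
pose x : 'rV_n.+1 := \row_i v i.
have vE r : r.@[v] = r.@[x 0] by apply: meval_eq => l; rewrite mxE.
have := H x; rewrite mxvecK -mact_eval -!vE; exact.
Qed.

(* Each [g] in [G] permutes the factors of [f]; the subsets of [G] where the
   [i]-th factor is fixed, resp. moved, are closed, disjoint and cover [G]. *)
Lemma factor_dvd_mact i g : G g -> rdvd (factor F i) (mact g (factor F i)).
Proof.
pose Z p : set 'rV[K]_(n.+1 * n.+1) := [set w | forall x : 'rV_n.+1,
  (factor F i).@[x 0] = 0 -> p.@[(x *m vec_mx w) 0] = 0].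
have ZP h p : rdvd (factor F i) (mact h p) <-> Z p (mxvec h) := mact_dvd_vanishing i p h.
have ZC p : zariski_closed (Z p) by apply: zariski_closed_vanishing.
have fact h : G h -> exists2 c, c != 0 &
    mact h (factor F i) * mact h (cofactor_of F i) = c *: (factor F i * cofactor_of F i).
  move=> Gh; have [c c0 cE] := associated_semi_invariant S DE G_assoc Gh.
  by exists c => //; rewrite -rmorphM -factor_cofactor.
have cover h : G h -> Z (factor F i) (mxvec h) \/ Z (cofactor_of F i) (mxvec h).
  move=> Gh; rewrite -!ZP; have [c _ cE] := fact h Gh.
  apply: rprime_dvdM (factor_prime F i) _.
  by rewrite cE -mul_mpolyC; apply/rdvd_mull/rdvd_mulr/rdvd_refl.
(* If the factor divided both pullbacks, its square would divide [f]. *)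
have disjoint h : G h -> Z (factor F i) (mxvec h) -> ~ Z (cofactor_of F i) (mxvec h).
  move=> Gh; rewrite -!ZP => H1 H2; have [c c0 cE] := fact h Gh.
  have := rdvd_mul H1 H2; rewrite cE -mul_mpolyC mulrCA.
  move/(rdvd_mul2l (factor_neq0 F i))/(rprime_dvdM (factor_prime F i)).
  case; last exact: factor_ndvd_cofactor.
  by apply: rprime_ndvd_unit (factor_prime F i) _; rewrite mpolyC_unit.
case: G_assoc => -[_ G1 _ _] [_ Gc] _ _.
have [w [h Gh <-]||sub|sub] := Gc _ _ (ZC (factor F i)) (ZC (cofactor_of F i)).
- exact: cover.
- apply/seteqP; split=> // w [[[h Gh <-] Z1] Z2]; exact: disjoint Z1 Z2.
- by move=> Gg; apply/ZP/sub; exists g.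
have : Z (cofactor_of F i) (mxvec 1%:M) by apply: sub; exists 1%:M.
case/(disjoint _ G1); rewrite -?ZP ?mact1; exact: rdvd_refl.
Qed.

Lemma character_conj i g A : G g -> lie_stab f A ->
  character (factor F i) (invmx g *m A *m g) = character (factor F i) A.
Proof.
move=> Gg fA; have F0 := factor_neq0 F i.
have gU := associated_unit G_assoc Gg.
have [c c0 cE] : exists2 c, c != 0 & mact g (factor F i) = c *: factor F i.
  apply: mact_semi_invariant => //; first exact: factor_dvd_mact.
  by apply: factor_dvd_mact; apply: (associated_inv G_assoc).
have fA' := lie_stab_conj S DE G_assoc Gg fA.
have := lie_deriv_mact A (factor F i) gU.
rewrite cE lie_derivZ (factor_lie i fA) (factor_lie i fA') mactZ cE !scalerA.
move/(congr1 (mcoeff (mlead (factor F i)))); rewrite !mcoeffZ mulrC => /eqP.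
rewrite -subr_eq0 [_ * mleadc _]mulrC -mulrBr !mulf_eq0 mleadc_eq0 (negbTE F0) /=.
by rewrite [_ * c]mulrC -mulrBr mulf_eq0 (negbTE c0) subr_eq0 => /eqP.
Qed.

End GroupInvariance.

Lemma lin_row_sum (I : finType) (y : I -> K) (C : I -> 'M[K]_n.+1) j :
  lin_row (\sum_i y i *: C i) 0 j = \sum_i (y i)%:MP * lin_row (C i) 0 j.
Proof.
apply: mpoly_eval_rV_ext => x; rewrite lin_row_eval rmorph_sum mulmx_sumr summxE.
apply: eq_bigr => i _.
by rewrite /= mevalM mevalC lin_row_eval -scalemxAr mxE.
Qed.

(* [sum_k chi_k B_k^*], for the dual basis [B_k^*] of the fields [B_k], is a
   closed logarithmic form [eta / f]; it equals [sum_i c_i dF_i / F_i] with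
   constant residues [c_i], up to a regular form which vanishes on linear
   fields at the origin. *)
Theorem character_log (X : 'M[K]_n.+1) :
  (forall k, X *m B_ k = B_ k *m X) ->
  exists c : 'I_s -> K, forall A, lie_stab f A ->
    \tr (A *m X) = \sum_i c i * character (factor F i) A.
Proof.
move=> XB; set M := lin_mx B_; pose h := saito_const S.
have h0 : h%:MP_[n.+1] != 0 by rewrite mpolyC_eq0 saito_const_neq0.
have f0 := reduced_neq0 F.
have detM : \det M = h%:MP * f by exact: saito_det.
have detM0 : \det M != 0 by rewrite detM mulf_neq0.
pose chi A := \tr (A *m X).
have chi_sum y : chi (\sum_k y k *: B_ k) = \sum_k y k * chi (B_ k).
  rewrite /chi mulmx_suml raddf_sum; apply: eq_bigr => k _ /=.
  by rewrite -scalemxAl mxtraceZ.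
have chi_bracket k l : chi (B_ k *m B_ l - B_ l *m B_ k) = 0.
  rewrite /chi mulmxBl raddfB /= -mulmxA -XB mulmxA mxtrace_mulC -mulmxA.
  by rewrite mulmxA subrr.
(* By Cramer's rule, the numerator over [f] of the form with value [chi (B_ k)] on each basis
   field. *)
pose etac := h^-1%:MP *: (\adj M *m \col_k (chi (B_ k))%:MP).
pose eta i := etac i 0.
pose pair A := \sum_j lin_row A 0 j * eta j.
have pairB k : pair (B_ k) = (chi (B_ k))%:MP * f.
  transitivity ((M *m etac) k 0).
    by rewrite [RHS]mxE; apply: eq_bigr => j _; rewrite lin_mxE.
  rewrite /etac -scalemxAr mulmxA mul_mx_adj detM mul_scalar_mx scalerA mulrA.
  rewrite -mpolyCM mulVf ?saito_const_neq0 // mul1r.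
  by rewrite 2!mxE mulrC.
have pair_span A : lie_stab f A -> pair A = (chi A)%:MP * f.
  move=> /(saito_span S) [y ->]; rewrite chi_sum raddf_sum mulr_suml /pair.
  transitivity (\sum_k (y k)%:MP * pair (B_ k)); last first.
    by apply: eq_bigr => k _; rewrite pairB mulrA -mpolyCM.
  rewrite /pair; under [RHS]eq_bigr do rewrite mulr_sumr.
  rewrite exchange_big; apply: eq_bigr => j _.
  by rewrite lin_row_sum mulr_suml; apply: eq_bigr => k _; rewrite mulrA.
(* The coefficients of f^2 d(eta / f). They are tested on pairs of basis fields by Cartan's formula,
   in which [chi] of a bracket is zero. *)
pose Om : 'M_n.+1 := \matrix_(i, j) (f * ((eta j)^`M(i) - (eta i)^`M(j)) -
  (f^`M(i) * eta j - f^`M(j) * eta i)).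
pose P k l := \sum_j lin_row (B_ l) 0 j * lie_deriv (B_ k) (eta j).
have PE k l : P k l = lie_deriv (B_ k) (pair (B_ l)) - pair (B_ k *m B_ l).
  rewrite /pair (linear_sum (lie_deriv _)) /= -sumrB; apply: eq_bigr => j _.
  by rewrite lie_derivM lie_deriv_lin_row addrC addKr.
have PP k l : P k l - P l k =
    (chi (B_ l))%:MP * lie_deriv (B_ k) f - (chi (B_ k))%:MP * lie_deriv (B_ l) f.
  rewrite !PE !pairB !lie_derivM !lie_derivC !mul0r !add0r.
  have : pair (B_ k *m B_ l) - pair (B_ l *m B_ k) = 0.
    transitivity (pair (B_ k *m B_ l - B_ l *m B_ k)).
      by rewrite /pair -sumrB; apply: eq_bigr => j _; rewrite lin_rowB mulrBl.
    rewrite pair_span ?chi_bracket ?mul0r //.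
    by apply: lie_stab_bracket; apply: saito_lie.
  by move=> /eqP; rewrite subr_eq0 => /eqP ->; ring.
have MOm : M *m Om *m M^T = 0.
  apply/matrixP => k l; rewrite !mxE.
  transitivity (f * (P k l - P l k) -
      (lie_deriv (B_ k) f * pair (B_ l) - lie_deriv (B_ l) f * pair (B_ k))); last first.
    by rewrite PP !pairB; ring.
  transitivity (\sum_j \sum_i (f * (lin_row (B_ l) 0 j * (lin_row (B_ k) 0 i * (eta j)^`M(i))
      - lin_row (B_ k) 0 i * (lin_row (B_ l) 0 j * (eta i)^`M(j)))
      - (lin_row (B_ k) 0 i * f^`M(i) * (lin_row (B_ l) 0 j * eta j)
        - lin_row (B_ l) 0 j * f^`M(j) * (lin_row (B_ k) 0 i * eta i)))).
    apply: eq_bigr => j _; rewrite mxE mulr_suml; apply: eq_bigr => i _.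
    by rewrite [Om i j]mxE [M^T _ _]mxE !lin_mxE; ring.
  under eq_bigr do rewrite sumrB -mulr_sumr sumrB sumrB -mulr_suml -!mulr_sumr.
  rewrite sumrB -mulr_sumr sumrB sumrB -mulr_suml -mulr_sumr; congr (_ * (_ - _) - (_ - _)).
  by rewrite exchange_big; apply: eq_bigr => i _; rewrite -mulr_sumr.
have Om0 : Om = 0.
  have : \adj M *m (M *m Om *m M^T) *m \adj (M^T) = 0 by rewrite MOm mulmx0 mul0mx.
  rewrite -!mulmxA mul_mx_adj det_tr mulmxA mul_adj_mx mul_mx_scalar mul_scalar_mx.
  move: (Om) => Y /matrixP YE; apply/matrixP => i j; have := YE i j; rewrite !mxE => /eqP.
  by rewrite !mulf_eq0 (negbTE detM0) /= => /eqP.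
have residue i : exists c : K, forall a,
    rdvd (factor F i) (eta a - c *: (cofactor_of F i * (factor F i)^`M(a))).
  apply: constant_residue (factor_prime F i) (@factor_ndvd_cofactor _ _ _ _ F i) _ => a b.
  rewrite -factor_cofactor; apply/eqP; rewrite -subr_eq0; apply/eqP.
  by have /matrixP/(_ a b) := Om0; rewrite !mxE.
have /all_sig [c cP] i : {c : K | forall a,
    rdvd (factor F i) (eta a - c *: (cofactor_of F i * (factor F i)^`M(a)))} := cid (residue i).
(* Subtracting the polar part leaves a numerator divisible by every factor, hence by [f]. *)
pose theta a := eta a - \sum_i c i *: (cofactor_of F i * (factor F i)^`M(a)).
have /all_sig [t tE] a : {t | theta a = t * f}.
  apply: cid; apply: (reduced_dvd (F := F)) => i; rewrite /theta (bigD1 i) //= opprD addrA.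
  apply: rdvdB; first exact: cP.
  apply: rdvd_sum => j ji; rewrite -mul_mpolyC; apply/rdvd_mull/rdvd_mulr.
  by apply: factor_dvd_cofactor; rewrite eq_sym.
exists c => A fA; apply/eqP; rewrite -subr_eq0; apply/eqP.
suff : (chi A - \sum_i c i * character (factor F i) A)%:MP =
    \sum_a lin_row A 0 a * t a.
  move/(congr1 (mcoeff 0%MM)); rewrite mcoeffC eqxx mulr1 => ->.
  rewrite (raddf_sum (mcoeff 0%MM)) big1 // => a _.
  by rewrite /= (rmorphM (mcoeff 0%MM)) /= lin_row_coef0 mul0r.
apply: (mulIf f0); rewrite mulr_suml.
transitivity (\sum_a lin_row A 0 a * theta a); last first.
  by apply: eq_bigr => a _; rewrite tE mulrA.
rewrite (eq_bigr (fun a => lin_row A 0 a * eta a - lin_row A 0 a *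
  \sum_i c i *: (cofactor_of F i * (factor F i)^`M(a)))) => [|a _]; last exact: mulrBr.
rewrite sumrB -/(pair A) pair_span // mpolyCB mulrBl; congr (_ - _).
rewrite raddf_sum mulr_suml; under [RHS]eq_bigr do rewrite mulr_sumr.
rewrite exchange_big; apply: eq_bigr => i _ /=.
transitivity (c i *: (cofactor_of F i * lie_deriv A (factor F i))).
  rewrite (factor_lie i fA) -[X in _ * X = _](esym (factor_cofactor F i)).
  by rewrite -!mul_mpolyC mpolyCM; ring.
rewrite /lie_deriv /vfield_apply mulr_sumr scaler_sumr; apply: eq_bigr => a _.
by rewrite -!mul_mpolyC; ring.
Qed.

End Characters.

(** * Engel's theorem *)

Section VspaceOfPredicate.
Context {K : fieldType} {vT : vectType K}.

(** A subspace of maximal dimension inside [P] is all of [P]: any further vector would enlarge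
    it. *)
Lemma pred_vspace (P : vT -> Prop) : P 0 ->
  (forall c u v, P u -> P v -> P (c *: u + v)) ->
  exists V : {vspace vT}, forall u, u \in V <-> P u.
Proof.
move=> P0 Plin.
pose Q d := `[< exists V : {vspace vT}, \dim V = d /\ forall u, u \in V -> P u >].
have Q0 : exists d, Q d.
  exists 0%N; apply/asboolP; exists 0%VS; split; first exact: dimv0.
  by move=> u; rewrite memv0 => /eqP ->.
have Qb d : Q d -> (d <= \dim {:vT})%N.
  by move=> /asboolP [V [<- _]]; apply/dimvS/subvf.
case: (ex_maxnP Q0 Qb) => d /asboolP [V [Vd VP]] dmax.
exists V => u; split; first exact: VP.
move=> Pu; apply/negPn/negP => uV.
have : Q (\dim (V + <[u]>)).
  apply/asboolP; exists (V + <[u]>)%VS; split=> // w.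
  move=> /memv_addP [v vV [_ /vlineP [c ->] ->]].
  by rewrite addrC; apply: Plin => //; apply: VP.
move/dmax; rewrite -Vd; apply/negP; rewrite -ltnNge.
by rewrite (ltn_leqif (dimv_leqif_sup (addvSl _ _))) subv_add subvv -memvE.
Qed.

End VspaceOfPredicate.

Section Engel.
Context {K : fieldType} {n : nat}.
Implicit Types (U V Z x y : 'M[K]_n.+1) (h L : {vspace 'M[K]_n.+1}).

Definition act h U : 'M[K]_n.+1 := (\sum_(X <- vbasis h) U *m X)%MS.

Lemma act_sub h U V : (forall X, X \in h -> (U *m X <= V)%MS) -> (act h U <= V)%MS.
Proof.
move=> H; rewrite /act big_seq; elim/big_ind: _ => [|A B AV BV|X Xh].
- exact: sub0mx.
- by rewrite addsmx_sub AV.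
by apply: H; apply: vbasis_mem.
Qed.

Lemma act_mulr_sub h U V x :
  (forall X, X \in h -> (U *m X *m x <= V)%MS) -> (act h U *m x <= V)%MS.
Proof.
move=> H; rewrite /act big_seq; elim/big_ind: _ => [|A B AV BV|X Xh].
- by rewrite mul0mx sub0mx.
- by rewrite addsmxMr addsmx_sub AV.
by apply: H; apply: vbasis_mem.
Qed.

Lemma sub_act h U X : X \in h -> (U *m X <= act h U)%MS.
Proof.
move=> /coord_vbasis ->; rewrite mulmx_sumr; apply: summx_sub => i _.
rewrite -scalemxAr; apply: scalemx_sub; rewrite /act (big_nth 0) big_mkord size_tuple.
by rewrite (sumsmx_sup i) // tnth_nth.
Qed.

Lemma act_mono h U V : (U <= V)%MS -> (act h U <= act h V)%MS.
Proof.
move=> UV; apply: act_sub => X Xh.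
by apply: submx_trans (sub_act V Xh); apply: submxMr.
Qed.

Lemma iter_act_mono h j U V : (U <= V)%MS -> (iter j (act h) U <= iter j (act h) V)%MS.
Proof. by move=> UV; elim: j => //= j IH; apply: act_mono. Qed.

(** Equivalently, all products of [j] elements of [h] vanish. *)
Definition nil_algebra h : Prop := exists j, iter j (act h) 1%:M = 0.

Lemma prod_sub_iter_act h (s : seq 'M[K]_n.+1) : {subset s <= h} ->
  (\prod_(X <- s) X <= iter (size s) (act h) 1%:M)%MS.
Proof.
elim/last_ind: s => [|s X IH] sh; first by rewrite big_nil submx_refl.
rewrite -cats1 big_cat big_seq1 cats1 size_rcons /=.
have Xh : X \in h by apply: sh; rewrite mem_rcons mem_head.
apply: submx_trans (sub_act _ Xh); rewrite -mulmxE; apply: submxMr; apply: IH => Y Ys.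
by apply: sh; rewrite mem_rcons in_cons Ys orbT.
Qed.

Definition bracket x y := x *m y - y *m x.

Lemma bracketDl x y z : bracket (x + y) z = bracket x z + bracket y z.
Proof. by rewrite /bracket mulmxDl mulmxDr opprD addrACA. Qed.

Lemma bracketC x y : bracket x y = - bracket y x.
Proof. by rewrite /bracket opprB. Qed.

Lemma bracketZr c x y : bracket x (c *: y) = c *: bracket x y.
Proof. by rewrite /bracket -scalemxAr -scalemxAl scalerBr. Qed.

Lemma bracketDr x y z : bracket x (y + z) = bracket x y + bracket x z.
Proof. by rewrite /bracket mulmxDl mulmxDr opprD addrACA. Qed.

Definition subalgebra h : Prop := forall x y, x \in h -> y \in h -> bracket x y \in h.

(* [ad h] acts nilpotently on [L], as [h] generates a nilpotent associative
   algebra; the last nonzero class of an iterated bracket modulo [h] gives an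
   element normalizing [h]. *)
Lemma normalizer_grows h L : subalgebra L -> (h <= L)%VS -> nil_algebra h ->
  ~~ (L <= h)%VS ->
  exists2 x, x \in L /\ x \notin h & forall X, X \in h -> bracket X x \in h.
Proof.
move=> Lsub hL [N hN] /subvPn [y yL yh].
(* This holds for [i = N + N], since one side then carries at least [N] factors, and bracketing with
   an element of [h] lowers [i] by one. *)
pose van i z := forall s t : seq 'M[K]_n.+1, {subset s <= h} -> {subset t <= h} ->
  (i <= size s + size t)%N -> (\prod_(X <- s) X) * z * (\prod_(X <- t) X) = 0.
have big0 (s : seq 'M[K]_n.+1) : {subset s <= h} -> (N <= size s)%N -> \prod_(X <- s) X = 0.
  move=> sh Ns; rewrite -(cat_take_drop N s) big_cat /=.
  have := @prod_sub_iter_act h (take N s) (fun X Xs => sh X (mem_take Xs)).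
  by rewrite size_takel // hN submx0 => /eqP ->; rewrite mul0r.
have : van (N + N)%N y.
  move=> s t sh th; case: (leqP N (size s)) => [Ns _|sN stN].
    by rewrite (big0 s) // !mul0r.
  by rewrite (big0 t) ?mulr0 //; lia.
move: (N + N)%N => i; elim: i y yL yh => [|i IH] y yL yh yvan.
  have := yvan [::] [::] (fun _ => ltac:(by [])) (fun _ => ltac:(by [])) isT.
  by rewrite !big_nil mulr1 mul1r => y0; rewrite y0 mem0v in yh.
have [yn|] := pselect (forall X, X \in h -> bracket X y \in h); first by exists y.
move/existsNP => [X /not_implyP [Xh Xy]].
apply: (IH (bracket X y)).
- by apply: Lsub => //; apply: (subvP hL).
- exact/negP.
move=> s t sh th ist.
have sXh : {subset s ++ [:: X] <= h}.
  by move=> Z; rewrite mem_cat inE => /orP[/sh|/eqP ->].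
have Xth : {subset X :: t <= h} by move=> Z; rewrite inE => /orP[/eqP ->|/th].
have E1 := yvan _ _ sXh th; rewrite size_cat addn1 addSn big_cat big_seq1 /= in E1.
have E2 := yvan _ _ sh Xth; rewrite /= addnS big_cons in E2.
have {}E1 := E1 ist; have {}E2 := E2 ist; rewrite !mulrA in E1 E2.
by rewrite /bracket !mulmxE mulrBr mulrBl !mulrA E1 E2 subrr.
Qed.

(** As [x] normalizes [h], it preserves the filtration [U j] by iterated images under [h]. Within a
    layer only powers of [x] count, so [e] steps descend one layer and [N * e] steps reach zero. *)
Lemma nil_algebra_extend h x e : subalgebra h -> nil_algebra h -> x ^+ e = 0 ->
  (forall X, X \in h -> bracket X x \in h) -> nil_algebra (h + <[x]>).
Proof.
move=> hsub [N hN] xe hx; pose U j := iter j (act h) 1%:M.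
have Ux j : (U j *m x <= U j)%MS.
  elim: j => [|j IH]; first exact: submx1.
  apply: act_mulr_sub => X Xh.
  rewrite -mulmxA (_ : X *m x = x *m X + bracket X x); last by rewrite /bracket addrC subrK.
  rewrite mulmxDr; apply: addmx_sub; last exact/sub_act/hx.
  by rewrite mulmxA; apply: submx_trans (sub_act _ Xh); apply: submxMr.
pose h' := (h + <[x]>)%VS.
have step j i Z : (Z <= U j)%MS ->
    (iter i (act h') Z <= U j *m x ^+ i + U j.+1)%MS.
  move=> ZU; elim: i => [|i IH].
    by rewrite expr0 mulmx1; apply: submx_trans ZU (addsmxSl _ _).
  rewrite iterS; apply: act_sub => _ /memv_addP [X Xh [_ /vlineP [c ->] ->]].
  apply: submx_trans (submxMr _ IH) _; rewrite mulmxDr addmx_sub //.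
    rewrite addsmxMr addsmx_sub; apply/andP; split; last first.
      apply: submx_trans (addsmxSr _ _).
      have UU : (U j.+1 <= U j)%MS.
        by elim: j {ZU IH Z} => [|j IHj]; [apply: submx1 | apply: act_mono].
      by apply: submx_trans (act_mono h UU); apply: sub_act.
    apply: submx_trans (addsmxSr _ _); apply: submx_trans (sub_act _ Xh).
    apply: submxMr; elim: (i) => [|l IHl]; first by rewrite expr0 mulmx1.
    by rewrite exprSr -mulmxE mulmxA; apply: submx_trans (submxMr _ IHl) (Ux j).
  rewrite -scalemxAr; apply: scalemx_sub; rewrite addsmxMr addsmxS //.
  by rewrite exprSr -mulmxE mulmxA.
exists (N * e)%N; suff : (iter (N * e) (act h') 1%:M <= U N)%MS.
  by rewrite /U hN submx0 => /eqP.
elim: (N) => [|j IH]; first by rewrite mul0n.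
rewrite mulSn iterD; apply: submx_trans (step j e _ IH) _.
by rewrite xe mulmx0 adds0mx.
Qed.

Theorem engel L : subalgebra L -> (forall x, x \in L -> exists e, x ^+ e = 0) ->
  nil_algebra L.
Proof.
move=> Lsub Lnil.
have [h [hL hsub hnil Lh]] : exists h,
    [/\ (h <= L)%VS, subalgebra h, nil_algebra h & (\dim L <= \dim h)%N].
  have : (\dim L <= \dim L)%N by [].
  elim: {1 3}(\dim L) => [|d IH] dL.
    exists 0%VS; split=> //; first exact: sub0v.
      by move=> x y; rewrite !memv0 => /eqP -> /eqP ->; rewrite /bracket mulmx0 subrr.
    exists 1%N; apply/eqP; rewrite -submx0 /=; apply: act_sub => X.
    by rewrite memv0 => /eqP ->; rewrite mulmx0 sub0mx.
  have [h [hL hsub hnil dh]] := IH (ltnW dL).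
  have [Lh|nLh] := boolP (L <= h)%VS.
    by exists h; split=> //; apply: leq_trans dL (dimvS Lh).
  have [x [xL xh] hx] := normalizer_grows Lsub hL hnil nLh.
  have [e xe] := Lnil x xL.
  exists (h + <[x]>)%VS; split.
  - by rewrite subv_add hL -memvE.
  - move=> _ _ /memv_addP [X Xh [_ /vlineP [c ->] ->]] /memv_addP [Y Yh [_ /vlineP [b ->] ->]].
    apply: (subvP (addvSl h <[x]>)).
    have xX Z : Z \in h -> bracket x Z \in h by move=> Zh; rewrite bracketC rpredN hx.
    have cxE Z : bracket (c *: x) Z = c *: bracket x Z.
      by rewrite bracketC bracketZr -scalerN -bracketC.
    rewrite bracketDl !bracketDr !cxE !bracketZr.
    have xx : bracket x x = 0 by rewrite /bracket subrr.
    rewrite xx !scaler0 addr0; apply: rpredD; last exact/rpredZ/xX.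
    by apply: rpredD; [apply: hsub | apply/rpredZ/hx].
  - exact: nil_algebra_extend hnil xe hx.
  apply: leq_ltn_trans dh _.
  by rewrite (ltn_leqif (dimv_leqif_sup (addvSl _ _))) subv_add subvv -memvE.
suff <- : h = L by [].
by apply/eqP; rewrite -(eqP (_ : h == L)) // eqEdim hL.
Qed.

End Engel.

(** * Semisimple modules *)

Section IdempotentTrace.
Context {K : numFieldType} {n : nat}.

Lemma mxtrace_idempotent (A : 'M[K]_n) : A *m A = A -> \tr A = (\rank A)%:R.
Proof.
move=> AA; rewrite -[A in LHS]mulmx_base mxtrace_mulC.
suff -> : row_base A *m col_base A = 1%:M by rewrite mxtrace1.
apply: (row_full_inj (col_base_full A)); apply: (row_free_inj (row_base_free A)).
by rewrite mulmx1 mulmx_base mulmxA mulmx_base -mulmxA mulmx_base.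
Qed.

End IdempotentTrace.

Section Decomposition.
Context {K : numClosedFieldType} {n : nat} {G : set 'M[K]_n}.
Context {k : nat} (W : 'I_k -> 'M[K]_n) (W_dec : irreducible_decomposition G W).

Definition component_proj i : 'M[K]_n  :=
  locked (proj_mx (W i) (\sum_(j | j != i) W j)%MS).
Local Notation pr := component_proj.

Lemma component_cap i : (W i :&: \sum_(j | j != i) W j)%MS = 0.
Proof. by case: W_dec => _ _ /mxdirect_sumsP; apply. Qed.

Lemma component_proj_sub m i (A : 'M_(m, n)) : (A *m pr i <= W i)%MS.
Proof. by rewrite /component_proj -lock proj_mx_sub. Qed.

Lemma component_proj_id m i (A : 'M_(m, n)) : (A <= W i)%MS -> A *m pr i = A.
Proof. by rewrite /component_proj -lock; apply/proj_mx_id/component_cap. Qed.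

Lemma component_proj_0 m i j (A : 'M_(m, n)) : i != j -> (A <= W j)%MS -> A *m pr i = 0.
Proof.
move=> ij Aj; rewrite /component_proj -lock; apply: proj_mx_0; first exact: component_cap.
by rewrite (sumsmx_sup j) // eq_sym.
Qed.

Lemma component_ext m (A B : 'M_(n, m)) : (forall i, W i *m A = W i *m B) -> A = B.
Proof.
move=> AB; have : (1%:M <= \sum_i W i)%MS by case: W_dec => _ ->; rewrite submx_refl.
case/sub_sumsmxP => u uE; rewrite -[A]mul1mx -[B]mul1mx uE !mulmx_suml.
by apply: eq_bigr => i _; rewrite -!mulmxA AB.
Qed.

Lemma component_projK i : pr i *m pr i = pr i.
Proof. by rewrite component_proj_id // -[pr i]mul1mx component_proj_sub. Qed.

Lemma component_proj_ortho i j : i != j -> pr i *m pr j = 0.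
Proof.
move=> ij; apply: (component_proj_0 (j := i)); first by rewrite eq_sym.
by rewrite -[pr i]mul1mx component_proj_sub.
Qed.

Lemma component_proj_sum : \sum_i pr i = 1%:M.
Proof.
apply: component_ext => i; rewrite mulmx_sumr mulmx1 (bigD1 i) //= big1 ?addr0.
  by rewrite component_proj_id.
by move=> j ji; apply: component_proj_0 ji _.
Qed.

Lemma component_neq0 i : W i != 0.
Proof. by case: W_dec => /(_ i) []. Qed.

Lemma component_proj_neq0 i : pr i != 0.
Proof.
apply: contraNneq (component_neq0 i) => p0.
by rewrite -[W i](@component_proj_id _ i) ?p0 ?mulmx0.
Qed.

Lemma component_proj_comm i g : G g -> pr i *m g = g *m pr i.
Proof.
move=> Gg; apply: component_ext => j; have Wg : (W j *m g <= W j)%MS.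
  by case: W_dec => /(_ j) [Wj _ _] _ _; apply: Wj.
rewrite !mulmxA; have [->|ij] := eqVneq i j.
  by rewrite (component_proj_id Wg) component_proj_id.
by rewrite (component_proj_0 ij Wg) (component_proj_0 ij (submx_refl _)) mul0mx.
Qed.

Lemma component_proj_trace i : \tr (pr i) != 0.
Proof.
rewrite mxtrace_idempotent ?component_projK // pnatr_eq0 mxrank_eq0.
exact: component_proj_neq0.
Qed.

Lemma component_proj_trace2 i j : \tr (pr i *m pr j) = \tr (pr i) *+ (i == j).
Proof.
have [->|ij] := eqVneq; first by rewrite component_projK.
by rewrite component_proj_ortho // mxtrace0.
Qed.

(** By simplicity a nonzero off-diagonal block of [Y] would be an isomorphism. A diagonal block has
    an eigenvalue, and its eigenspace is a nonzero submodule, hence the whole summand. *)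
Lemma schur_commutant (Y : 'M[K]_n) :
  (forall i j, i != j -> ~ giso G (W i) (W j)) ->
  (forall g, G g -> Y *m g = g *m Y) -> exists y, Y = \sum_i y i *: pr i.
Proof.
move=> Wniso YG; have Wgs i : gsimple G (W i) by case: W_dec.
pose Z i j := W i *m Y *m pr j.
have ZG i j g : G g -> W i *m g *m (Y *m pr j) = Z i j *m g.
  move=> Gg; rewrite /Z -[RHS]mulmxA component_proj_comm // -[W i *m Y *m _]mulmxA.
  by rewrite (mulmxA Y g) (YG g Gg) !mulmxA.
have prY j g : G g -> g *m (Y *m pr j) = Y *m pr j *m g.
  by move=> Gg; rewrite mulmxA -(YG g Gg) -!mulmxA component_proj_comm.
have off i j : i != j -> Z i j = 0.
  move=> ij; apply/eqP/negPn/negP => Z0; apply: (Wniso i j ij); exists (Y *m pr j).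
  have [Wi0 _ Wi1] := Wgs i; have [Wj0 _ Wj1] := Wgs j.
  have Zj : (Z i j <= W j)%MS by apply: component_proj_sub.
  have Zmod : gmodule G (Z i j).
    by move=> g Gg; rewrite -ZG // /Z -[W i *m Y *m _]mulmxA submxMr // Wi0.
  have ZW : (W i *m (Y *m pr j) :=: W j)%MS.
    by apply/eqmxP; rewrite mulmxA Zj /=; apply: Wj1.
  split=> [//||g Gg]; last by rewrite ZG // [W i *m (Y *m _)]mulmxA.
  apply/eqP; rewrite eqn_leq mxrankM_maxl /=.
  pose Kr := (W i :&: kermx (Y *m pr j))%MS.
  have Kmod : gmodule G Kr.
    move=> g Gg; rewrite /Kr sub_capmx; apply/andP; split.
      by apply: submx_trans (submxMr _ (capmxSl _ _)) (Wi0 g Gg).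
    have KW : (Kr <= W i)%MS := capmxSl _ _.
    have KK : Kr *m (Y *m pr j) = 0 by apply/sub_kermxP/capmxSr.
    by apply/sub_kermxP; rewrite -mulmxA prY // mulmxA KK mul0mx.
  have [K0|K0] := eqVneq Kr 0.
    by rewrite -(mxrank_mul_ker (W i) (Y *m pr j)) -/Kr K0 mxrank0 addn0.
  have := Wi1 _ Kmod (capmxSl _ _) K0; rewrite sub_capmx => /andP[_ /sub_kermxP WK].
  by move: Z0; rewrite /Z -mulmxA WK eqxx.
have diag i : exists y, Z i i = y *: W i.
  have [Wi0 Wi Wi1] := Wgs i; pose T := Y *m pr i.
  have ZiW : (Z i i <= W i)%MS by apply: component_proj_sub.
  have [a aP] : exists a, eigenvalue (restrictmx (W i) T) a.
    have r0 : (0 < \rank (W i))%N by rewrite lt0n mxrank_eq0.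
    have [a] : exists a, root (char_poly (restrictmx (W i) T)) a.
      by apply: closed_rootP; rewrite size_char_poly; move: r0; case: (\rank _).
    by rewrite -eigenvalue_root_char; exists a.
  exists a; have /eigenvalueP [v vE v0] := aP.
  pose Kr := (W i :&: kermx (T - a%:M))%MS.
  have Kmod : gmodule G Kr.
    move=> g Gg; rewrite /Kr sub_capmx; apply/andP; split.
      by apply: submx_trans (submxMr _ (capmxSl _ _)) (Wi0 g Gg).
    have KK : Kr *m (T - a%:M) = 0 by apply/sub_kermxP/capmxSr.
    have Tg : T *m g = g *m T by rewrite /T prY.
    apply/sub_kermxP; rewrite -mulmxA mulmxBr -Tg scalar_mxC -mulmxBl mulmxA KK.
    by rewrite mul0mx.
  have Kv : (v *m row_base (W i) <= Kr)%MS.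
    have st : stablemx (row_base (W i)) T.
      by rewrite stablemx_row_base /T mulmxA.
    rewrite sub_capmx; apply/andP; split.
      by apply: submx_trans (submxMl _ _) _; rewrite eq_row_base.
    by rewrite -[kermx _]/(eigenspace T a) -sub_eigenspace_conjmx ?row_base_free //;
      apply/eigenspaceP.
  have Kr0 : Kr != 0.
    apply: contraNneq v0 => K0; move: Kv; rewrite K0 submx0 => /eqP v00.
    by apply/eqP; apply: (row_free_inj (row_base_free (W i))); rewrite v00 mul0mx.
  have := Wi1 _ Kmod (capmxSl _ _) Kr0; rewrite sub_capmx => /andP[_ /sub_kermxP].
  by rewrite mulmxBr mul_mx_scalar => /eqP; rewrite subr_eq0 /T mulmxA => /eqP.
have /all_sig [y yE] i : {y | Z i i = y *: W i} := cid (diag i).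
exists y; apply: component_ext => i.
rewrite -[Y in LHS]mulmx1 -component_proj_sum !mulmx_sumr (bigD1 i) //= big1 ?addr0.
  rewrite mulmxA [LHS]yE (bigD1 i) //= big1 ?addr0 => [|j ji].
    by rewrite -scalemxAr component_proj_id.
  by rewrite -scalemxAr (component_proj_0 ji (submx_refl _)) scaler0.
by move=> j ji; rewrite mulmxA; apply: off; rewrite eq_sym.
Qed.

End Decomposition.

(** * The trace form *)

Section TraceForm.
Context {K : numClosedFieldType} {n : nat} {D : set 'rV[K]_n.+1}.
Context {f : {mpoly K[n.+1]}} {s : nat} (S : saito_basis D f s).
Hypothesis DE : D = zeros [set f].
Context {G : set 'M[K]_n.+1} (G_assoc : associated_group D G).
Context {k : nat} {W : 'I_k -> 'M[K]_n.+1} (W_dec : irreducible_decomposition G W).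
Implicit Types (A X Y g : 'M[K]_n.+1).

Local Notation F := (saito_fact S).
Local Notation B_ := (saito_mx S).
Local Notation pr := (component_proj W).

Lemma component_proj_group i g : G g -> pr i *m g = g *m pr i.
Proof. exact: component_proj_comm. Qed.

Lemma component_proj_lie_comm i A : lie_stab f A -> pr i *m A = A *m pr i.
Proof. by apply: (commute_group_lie S DE G_assoc) => g; apply: component_proj_group. Qed.

Lemma component_proj_lie i : lie_stab f (pr i).
Proof.
apply: (commutant_lie_stab (S := S)) => l; apply: component_proj_lie_comm.
exact: saito_lie.
Qed.

(* An isomorphism of [W i] onto [W j], extended by zero, commutes with [G],
   hence with the projection onto [W i], which belongs to the Lie algebra. *)
Theorem components_not_isomorphic i j : i != j -> ~ giso G (W i) (W j).
Proof.
move=> ij [phi [Wphi _ phiG]]; pose E := pr i *m phi *m pr j.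
have EG g : G g -> E *m g = g *m E.
  move=> Gg; have /submxP [u uE] : (pr i <= W i)%MS.
    by rewrite -[pr i]mul1mx component_proj_sub.
  have pg : pr i *m g *m phi = pr i *m phi *m g.
    by rewrite uE -!mulmxA; congr (u *m _); rewrite !mulmxA phiG.
  rewrite /E -mulmxA (component_proj_group j Gg) mulmxA -pg.
  by rewrite (component_proj_group i Gg) !mulmxA.
have := commute_group_lie S DE G_assoc EG (component_proj_lie i).
rewrite /E !mulmxA (component_projK W_dec) -[_ *m pr j *m pr i]mulmxA.
rewrite (component_proj_ortho W_dec); last by rewrite eq_sym.
rewrite mulmx0 => /esym E0; have := component_neq0 W_dec j.
have Wj : (W i *m phi <= W j)%MS by rewrite Wphi.
rewrite -submx0 -Wphi -(component_proj_id W_dec Wj).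
rewrite -{1}(component_proj_id W_dec (submx_refl (W i))).
by rewrite -[W i *m pr i *m phi]mulmxA -mulmxA E0 mulmx0 submx_refl.
Qed.

Lemma lie_stab_lin c A B : lie_stab f A -> lie_stab f B -> lie_stab f (c *: A + B).
Proof.
move=> [a aE] [b bE]; exists (c * a + b).
by rewrite lie_deriv_linear aE bE scalerA scalerDl.
Qed.

Definition trace_radical X : Prop :=
  lie_stab f X /\ forall A, lie_stab f A -> \tr (X *m A) = 0.

(* With the Jordan decomposition [X = S + N], the field of the complex
   conjugate of [S] also stabilizes [f], and its trace against [X] is the sum
   of the squared moduli of the eigenvalues of [X]. *)
Lemma trace_radical_nilpotent X : trace_radical X -> exists e, X ^+ e = 0.
Proof.
move=> [[c cE] Xtr]; have [P [d [N [PU XE dN [e Ne]]]]] := jordan_decomposition X.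
have [wt _] : (forall m, m \in msupp (mact P f) -> weight d m = c) /\
    lie_deriv N (mact P f) = 0.
  by apply: lie_deriv_jordan dN Ne _; rewrite lie_deriv_mact // -XE cE mactZ.
pose d' := map_mx Num.conj d : 'rV[K]_n.+1.
have fd' : lie_stab f (invmx P *m diag_mx d' *m P).
  apply/lie_stab_mact => //; exists (c^*); apply: lie_deriv_diagP => m /wt <-.
  rewrite /weight rmorph_sum; apply: eq_bigr => i _.
  by rewrite rmorphM /= rmorph_nat mxE.
(* Commuting with a diagonal matrix means that [N] vanishes where its entries differ, which survives
   conjugating them. *)
have d'N : diag_mx d' *m N = N *m diag_mx d'.
  apply/matrixP => i j; have /matrixP/(_ i j)/eqP := dN.
  rewrite !mul_mx_diag !mul_diag_mx !mxE mulrC -subr_eq0 -mulrBr mulf_eq0.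
  by case/orP => [/eqP ->|]; [rewrite mulr0 mul0r | rewrite subr_eq0 => /eqP ->; rewrite mulrC].
have trN : \tr (N *m diag_mx d') = 0.
  apply: (@mxtrace_nilpotent _ _ _ e); rewrite mulmxE exprMn_comm.
    by rewrite Ne mul0r.
  by rewrite /GRing.comm -!mulmxE d'N.
have XdE : X *m (invmx P *m diag_mx d' *m P) =
    invmx P *m ((diag_mx d + N) *m diag_mx d') *m P.
  by rewrite XE !mulmxA mulmxK.
have := Xtr _ fd'; rewrite XdE mxtrace_mulC !mulmxA mulmxV // mul1mx.
rewrite mulmxDl raddfD /= trN addr0 => tr0.
have d0 i : d 0 i = 0.
  have : \sum_i `|d 0 i| ^+ 2 = 0.
    rewrite -[RHS]tr0 /mxtrace; apply: eq_bigr => j _.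
    by rewrite mul_mx_diag !mxE eqxx mulr1n normCK.
  move/eqP; rewrite psumr_eq0 => [/allP/(_ i (mem_index_enum _))|j _].
    by rewrite /= expf_eq0 /= normr_eq0 => /eqP.
  by rewrite exprn_ge0.
exists e; rewrite XE; have -> : diag_mx d = 0.
  by apply/matrixP => i j; rewrite !mxE d0 mul0rn.
rewrite add0r; have NX l : (invmx P *m N *m P) ^+ l = invmx P *m N ^+ l *m P.
  elim: l => [|l IH]; first by rewrite !expr0 mulmx1 mulVmx.
  by rewrite !exprS IH -!mulmxE !mulmxA mulmxK.
by rewrite NX Ne mulmx0 mul0mx.
Qed.

Lemma trace_radical_bracket X Y : trace_radical X -> lie_stab f Y ->
  trace_radical (bracket X Y).
Proof.
move=> [fX Xtr] fY; split; first exact: lie_stab_bracket.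
move=> A fA; have := Xtr _ (lie_stab_bracket fY fA).
rewrite /bracket mulmxBl mulmxBr !raddfB /= !mulmxA => <-.
by congr (_ - _); rewrite [RHS]mxtrace_mulC mulmxA.
Qed.

Lemma trace_radical_conj g X : G g -> trace_radical X ->
  trace_radical (invmx g *m X *m g).
Proof.
move=> Gg [fX Xtr]; have gU := associated_unit G_assoc Gg.
split=> [|A fA]; first exact: (lie_stab_conj S DE G_assoc).
have Gg' := associated_inv G_assoc Gg.
have := Xtr _ (lie_stab_conj S DE G_assoc Gg' fA); rewrite invmxK => <-.
by rewrite -!mulmxA mxtrace_mulC !mulmxA.
Qed.

(* The radical [L] of the trace form is an ideal of nilpotent matrices, so by
   Engel's theorem [W i L] is a proper submodule of [W i]. *)
Lemma trace_form_nondegenerate X : trace_radical X -> X = 0.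
Proof.
have [||L LP] := pred_vspace (P := trace_radical).
- by split=> [|A _]; [exists 0; rewrite lie_deriv0 scale0r | rewrite mul0mx mxtrace0].
- move=> c A B [fA Atr] [fB Btr]; split=> [|C fC]; first exact: lie_stab_lin.
  by rewrite mulmxDl -scalemxAl raddfD /= mxtraceZ Atr // Btr // mulr0 addr0.
have Lsub : subalgebra L.
  by move=> x y /LP rx /LP [fy _]; apply/LP/trace_radical_bracket.
have Lnil x : x \in L -> exists e, x ^+ e = 0 by move/LP/trace_radical_nilpotent.
have [N LN] := engel Lsub Lnil.
have WL i : act L (W i) = 0.
  apply/eqP/negPn/negP => WL0; have [Wi0 Wi Wi1] : gsimple G (W i) by case: W_dec.
  have LW : (act L (W i) <= W i)%MS.
    apply: act_sub => Z /LP [fZ _].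
    rewrite -[W i as X in (X *m _ <= _)%MS](component_proj_id W_dec (submx_refl (W i))).
    by rewrite -mulmxA component_proj_lie_comm // mulmxA component_proj_sub.
  have Lmod : gmodule G (act L (W i)).
    move=> g Gg; apply: act_mulr_sub => Z ZL; have gU := associated_unit G_assoc Gg.
    have ZgL : invmx g *m Z *m g \in L by apply/LP/trace_radical_conj => //; apply/LP.
    rewrite (_ : W i *m Z *m g = W i *m g *m (invmx g *m Z *m g)); last first.
      by rewrite !mulmxA mulmxK.
    by apply: submx_trans (sub_act _ ZgL); apply: submxMr; apply: Wi0.
  (* By simplicity [W i] would lie in its own image under [L], so it would survive all iterates,
     whereas the [N]-th one is zero. *)
  have WiL := Wi1 _ Lmod LW WL0; move: Wi; rewrite -submx0 -LN.
  apply/negP; rewrite negbK.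
  have Wit j : (W i <= iter j (act L) (W i))%MS.
    by elim: j => //= j IH; apply: submx_trans WiL (act_mono _ IH).
  by apply: submx_trans (Wit N) _; apply: iter_act_mono; apply: submx1.
move=> /LP XL; apply: (component_ext W_dec) => i; rewrite mulmx0; apply/eqP.
by rewrite -submx0 -(WL i) sub_act.
Qed.
End TraceForm.

(** * Counting components *)

Section CountingComponents.
Context {K : numClosedFieldType} {n : nat} {D : set 'rV[K]_n.+1}.
Context {f : {mpoly K[n.+1]}} {s : nat} (S : saito_basis D f s).
Hypothesis DE : D = zeros [set f].
Context {G : set 'M[K]_n.+1} (G_assoc : associated_group D G).
Context {k : nat} {W : 'I_k -> 'M[K]_n.+1} (W_dec : irreducible_decomposition G W).
Implicit Types (A X Y g : 'M[K]_n.+1).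

Local Notation F := (saito_fact S).
Local Notation B_ := (saito_mx S).
Local Notation pr := (component_proj W).

(** The form sum c_i dF_i / F_i vanishes on the basis fields, hence is zero, their matrix being
    invertible over the fraction field; its residue along F_i = 0 is c_i. *)
Lemma characters_free (c : 'I_s -> K) :
  (forall A, lie_stab f A -> \sum_i c i * character (factor F i) A = 0) ->
  forall i, c i = 0.
Proof.
move=> c0; pose xi a := \sum_i c i *: (cofactor_of F i * (factor F i)^`M(a)).
have xiE A : \sum_a lin_row A 0 a * xi a =
    \sum_i c i *: (cofactor_of F i * lie_deriv A (factor F i)).
  rewrite /xi; under eq_bigr do rewrite mulr_sumr.
  rewrite exchange_big; apply: eq_bigr => i _ /=.
  rewrite /lie_deriv /vfield_apply mulr_sumr scaler_sumr; apply: eq_bigr => a _.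
  by rewrite -!mul_mpolyC; ring.
have Mxi : lin_mx B_ *m \col_a xi a = 0.
  apply/matrixP => l z; rewrite [LHS]mxE [RHS]mxE.
  transitivity ((\sum_i c i * character (factor F i) (B_ l))%:MP * f); last first.
    by rewrite (c0 _ (saito_lie S l)) mpolyC0 mul0r.
  rewrite (raddf_sum (@mpolyC n.+1 K)) mulr_suml.
  transitivity (\sum_a lin_row (B_ l) 0 a * xi a).
    by apply: eq_bigr => a _; rewrite lin_mxE [(\col_a0 _ a0) _ _]mxE.
  rewrite xiE; apply: eq_bigr => i _; rewrite factor_lie; last exact: saito_lie.
  rewrite -[X in _ = _ * X](esym (factor_cofactor F i)) /=.
  by move: (character _ _) => a; rewrite -!mul_mpolyC mpolyCM; ring.
have xi0 a : xi a = 0.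
  have detM0 : \det (lin_mx B_) != 0.
    by rewrite saito_det mulf_neq0 ?mpolyC_eq0 ?saito_const_neq0 // (reduced_neq0 F).
  have := congr1 (mulmx (\adj (lin_mx B_))) Mxi.
  rewrite mulmxA mul_adj_mx mulmx0 mul_scalar_mx => /matrixP/(_ a 0)/eqP.
  by rewrite !mxE mulf_eq0 (negbTE detM0) => /eqP.
move=> i; apply: contrapT => /eqP ci; have [e de] := rprime_mderiv (factor_prime F i).
have : rdvd (factor F i) (c i *: (cofactor_of F i * (factor F i)^`M(e))).
  have := xi0 e; rewrite /xi (bigD1 i) //= => /eqP; rewrite addr_eq0 => /eqP ->.
  apply: rdvdN; apply: rdvd_sum => j ji; rewrite -mul_mpolyC; apply/rdvd_mull/rdvd_mulr.
  by apply: factor_dvd_cofactor; rewrite eq_sym.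
rewrite -mul_mpolyC => /(rprime_dvdM (factor_prime F i)) [].
  by apply: rprime_ndvd_unit (factor_prime F i) _; rewrite mpolyC_unit.
case/(rprime_dvdM (factor_prime F i)); first exact: factor_ndvd_cofactor.
exact: prime_ndvd_mderiv.
Qed.

Let Gram : 'M[K]_n.+1 := \matrix_(i, j) \tr (B_ i *m B_ j).

Lemma lie_functional (psi : 'M[K]_n.+1 -> K) :
  (forall y : 'I_n.+1 -> K, psi (\sum_i y i *: B_ i) = \sum_i y i * psi (B_ i)) ->
  exists2 Y, lie_stab f Y & forall A, lie_stab f A -> \tr (Y *m A) = psi A.
Proof.
move=> psiB.
have comb_tr (y : 'I_n.+1 -> K) A :
    \tr ((\sum_i y i *: B_ i) *m A) = \sum_i y i * \tr (B_ i *m A).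
  rewrite mulmx_suml raddf_sum; apply: eq_bigr => i _.
  by rewrite -scalemxAl /= mxtraceZ.
have comb_tr' (y : 'I_n.+1 -> K) A :
    \tr (A *m (\sum_i y i *: B_ i)) = \sum_i y i * \tr (A *m B_ i).
  by rewrite mxtrace_mulC comb_tr; apply: eq_bigr => i _; rewrite mxtrace_mulC.
have fcomb (y : 'I_n.+1 -> K) : lie_stab f (\sum_i y i *: B_ i).
  by apply: lie_stab_comb => i; apply: saito_lie.
have GU : Gram \in unitmx.
  rewrite -row_free_unit; apply: inj_row_free => v vG.
  have /(saito_free) v0 : \sum_i v 0 i *: B_ i = 0.
    apply: (trace_form_nondegenerate S DE G_assoc W_dec); split=> // A.
    case/(saito_span S) => y ->; rewrite comb_tr' big1 // => j _.
    have /rowP/(_ j) := vG; rewrite !mxE comb_tr => vj.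
    by rewrite (eq_bigr (fun i => v 0 i * Gram i j)) ?vj ?mulr0 // => i _; rewrite mxE.
  by apply/rowP => i; rewrite v0 mxE.
pose y := (\row_i psi (B_ i)) *m invmx Gram.
exists (\sum_i y 0 i *: B_ i) => // A /(saito_span S) [z ->].
rewrite comb_tr' psiB; apply: eq_bigr => j _; congr (_ * _); rewrite comb_tr.
have /rowP/(_ j) : y *m Gram = \row_i psi (B_ i) by rewrite mulmxKV.
by rewrite [LHS]mxE [RHS]mxE => <-; apply: eq_bigr => i _; rewrite [Gram _ _]mxE.
Qed.

(** Both inequalities between [s] and [k] come from the rank of this matrix. *)
Let C : 'M[K]_(s, k) := \matrix_(i, j) character (factor F i) (pr j).

Lemma factors_le_components : (s <= k)%N.
Proof.
suff /eqP <- : row_free C by apply: rank_leq_col.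
apply: inj_row_free => c cC.
pose psi A := \sum_i c 0 i * character (factor F i) A.
have [y|Y fY YE] := lie_functional (psi := psi).
  rewrite /psi; under eq_bigr do rewrite character_sum mulr_sumr.
  rewrite exchange_big; apply: eq_bigr => l _ /=; rewrite mulr_sumr.
  by apply: eq_bigr => i _; rewrite mulrCA.
have YG g : G g -> Y *m g = g *m Y.
  move=> Gg; have gU := associated_unit G_assoc Gg.
  have Gg' := associated_inv G_assoc Gg.
  have fgY : lie_stab f (g *m Y *m invmx g).
    by have := lie_stab_conj S DE G_assoc Gg' fY; rewrite invmxK.
  have : g *m Y *m invmx g - Y = 0.
    apply: (trace_form_nondegenerate S DE G_assoc W_dec); split.
      by rewrite addrC -scaleN1r; apply: lie_stab_lin.
    move=> A fA; have -> : \tr ((g *m Y *m invmx g - Y) *m A) =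
        \tr (Y *m (invmx g *m A *m g)) - \tr (Y *m A).
      rewrite mulmxBl raddfB /=; congr (_ - _).
      by rewrite -!mulmxA mxtrace_mulC !mulmxA.
    rewrite !YE //; last exact: (lie_stab_conj S DE G_assoc).
    apply/eqP; rewrite subr_eq0; apply/eqP; apply: eq_bigr => i _.
    by rewrite (character_conj S DE G_assoc).
  move/eqP; rewrite subr_eq0 => /eqP gY.
  by rewrite -{1}gY mulmxKV.
have niso i j := components_not_isomorphic S DE G_assoc W_dec (i := i) (j := j).
have [z YzE] := schur_commutant W_dec niso YG.
(* The projections are orthogonal for the trace form and have nonzero traces, so pairing [Y] with
   [pr j] isolates [z j]. *)
have z0 j : z j = 0.
  have : \tr (Y *m pr j) = 0.
    rewrite YE; last exact: (component_proj_lie S DE G_assoc W_dec).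
    have /rowP/(_ j) := cC; rewrite !mxE => <-.
    by apply: eq_bigr => i _; rewrite mxE.
  rewrite YzE mulmx_suml raddf_sum (bigD1 j) //= big1 ?addr0 => [|i ij].
    rewrite -scalemxAl mxtraceZ (component_projK W_dec) => /eqP.
    by rewrite mulf_eq0 (negbTE (component_proj_trace W_dec j)) orbF => /eqP.
  by rewrite -scalemxAl mxtraceZ (component_proj_ortho W_dec ij) mxtrace0 mulr0.
have Y0 : Y = 0 by rewrite YzE big1 // => j _; rewrite z0 scale0r.
apply/rowP => i; rewrite mxE; move: i; apply: characters_free => A fA.
by rewrite -/(psi A) -YE // Y0 mul0mx mxtrace0.
Qed.

(** The residues of the traces, multiplied by [C], give the invertible diagonal matrix of traces of
    projections, so [C] has rank [k]. *)
Lemma components_le_factors : (k <= s)%N.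
Proof.
have comm j l : pr j *m B_ l = B_ l *m pr j.
  by apply: (component_proj_lie_comm S DE G_assoc W_dec); apply: saito_lie.
have /all_sig [c cE] j : {c : 'I_s -> K | forall A, lie_stab f A ->
    \tr (A *m pr j) = \sum_i c i * character (factor F i) A}.
  exact: cid (character_log (comm j)).
have CE : (\matrix_(j, i) c j i) *m C = diag_mx (\row_j \tr (pr j)).
  apply/matrixP => j l; rewrite !mxE.
  have fl := component_proj_lie S DE G_assoc W_dec l.
  transitivity (\tr (pr l *m pr j)); last first.
    by rewrite (component_proj_trace2 W_dec) eq_sym; case: eqP => [->|].
  by rewrite cE //; apply: eq_bigr => i _; rewrite !mxE.
have DU : diag_mx (\row_j \tr (pr j)) \in unitmx.
  rewrite unitmxE det_diag unitfE; apply/prodf_neq0 => j _.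
  by rewrite mxE (component_proj_trace W_dec).
have := mxrankM_maxr (\matrix_(j, i) c j i) C.
by rewrite CE mxrank_unit // => /leq_trans; apply; apply: rank_leq_row.
Qed.

(** A polynomial not divisible by the prime factor is nonzero somewhere on its zero set, and
    nondivisibility passes to products. *)
Lemma zeros_factor_irreducible i : zariski_irreducible (zeros [set factor F i]).
Proof.
have zE v : zeros [set factor F i] v <-> (factor F i).@[v 0] = 0.
  by split=> [/(_ _ erefl)|vi _ ->].
have rowE (v : 'I_n.+1 -> K) p : p.@[(\row_i v i : 'rV_n.+1) 0] = p.@[v].
  by apply: meval_eq => j; rewrite mxE.
have ndvd p : ~ rdvd (factor F i) p ->
    exists2 v, zeros [set factor F i] v & p.@[v 0] != 0.
  move=> np; apply: contrapT => H; apply: np; apply: nullstellensatz_prime => [|v vi].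
    exact: factor_prime.
  apply/eqP/negPn/negP => pv; apply: H; exists (\row_i v i).
    by apply/zE; rewrite rowE.
  by rewrite rowE.
split=> [|Z1 Z2 [S1 ->] [S2 ->] cover].
  by have [v vi _] := ndvd 1 (@rprime_ndvd1 _ _ (factor_prime F i)); exists v.
apply: contrapT => /not_orP [nZ1 nZ2].
have key T : ~ zeros [set factor F i] `<=` zeros T ->
    exists2 p, T p & ~ rdvd (factor F i) p.
  move=> /existsNP [v /not_implyP [vi]] /existsNP [p /not_implyP [Tp pv]].
  exists p => // -[q qE]; apply: pv; rewrite qE mevalM.
  by move/zE: vi => ->; rewrite mulr0.
have [p1 S1p np1] := key _ nZ1; have [p2 S2p np2] := key _ nZ2.
have [|v vi] := ndvd (p1 * p2); first by case/(rprime_dvdM (factor_prime F i)).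
rewrite mevalM mulf_eq0 => /norP[v1 v2].
case: (cover v vi) => [/(_ _ S1p)|/(_ _ S2p)] /eqP; first by rewrite (negbTE v1).
by rewrite (negbTE v2).
Qed.

Lemma zeros_factor_sub i j :
  zeros [set factor F i] `<=` zeros [set factor F j] -> i = j.
Proof.
move=> sub; apply/eqP/negPn/negP => ij; apply: (factor_ndvd (r := F) ij).
apply: nullstellensatz_prime => [|v vi]; first exact: factor_prime.
have rowE p : p.@[(\row_i v i : 'rV_n.+1) 0] = p.@[v].
  by apply: meval_eq => l; rewrite mxE.
by rewrite -rowE; apply: (sub (\row_i v i)) => // _ ->; rewrite rowE.
Qed.

Lemma irreducible_sub_factor (Y : set 'rV[K]_n.+1) : zariski_irreducible Y -> Y `<=` D ->
  exists i, Y `<=` zeros [set factor F i].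
Proof.
move=> [[v0 Yv0] Yirr] YD.
have : Y `<=` zeros [set \prod_i factor F i].
  move=> v /YD /(divisorP DE) fv _ ->; apply/eqP; move/eqP: fv.
  rewrite [f in f.@[_]](factorization F) mevalM mevalC.
  by rewrite mulf_eq0 (negbTE (lead_neq0 F)).
elim: (index_enum _) => [|i r IH] Yr.
  have := Yr v0 Yv0 _ erefl; rewrite big_nil meval1 => /eqP.
  by rewrite oner_eq0.
have [|||Yi|] := Yirr (zeros [set factor F i]) (zeros [set \prod_(j <- r) factor F j]).
- by exists [set factor F i].
- by exists [set \prod_(j <- r) factor F j].
- move=> v /Yr/(_ _ erefl); rewrite big_cons mevalM => /eqP.
  by rewrite mulf_eq0 => /orP[/eqP v0'|/eqP v0']; [left|right] => _ ->.
- by exists i.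
exact: IH.
Qed.

Lemma irreducible_componentE (Z : set 'rV[K]_n.+1) :
  irreducible_component D Z <-> exists i, Z = zeros [set factor F i].
Proof.
have FD i : zeros [set factor F i] `<=` D.
  move=> v /(_ _ erefl) vi; apply/(divisorP DE).
  by rewrite [f in f.@[_]](factor_cofactor F i) mevalM vi mul0r.
split=> [[Zirr ZD Zmax]|[i ->]].
  have [i Zi] := irreducible_sub_factor Zirr ZD; exists i; apply/esym.
  exact: Zmax (zeros_factor_irreducible i) (FD i) Zi.
split=> [||Y Yirr YD iY]; [exact: zeros_factor_irreducible | exact: FD |].
have [j Yj] := irreducible_sub_factor Yirr YD.
have ij := zeros_factor_sub (subset_trans iY Yj); rewrite -ij in Yj.
by apply/seteqP.
Qed.

Theorem card_irreducible_components :
  [set Z | irreducible_component D Z] #= `I_k.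
Proof.
have <- : s = k by apply/eqP; rewrite eqn_leq factors_le_components components_le_factors.
have -> : [set Z | irreducible_component D Z] =
    (fun i => zeros [set factor F i]) @` [set: 'I_s].
  apply/seteqP; split=> [Z /irreducible_componentE [i ->]|_ [i _ <-]]; first by exists i.
  by apply/irreducible_componentE; exists i.
apply: card_eq_trans (_ : _ #= [set: 'I_s]) _; last by rewrite card_eq_sym card_II.
apply: inj_card_eq => i j _ _ ij; apply: zeros_factor_sub.
by rewrite ij.
Qed.

End CountingComponents.

Lemma linear_free_divisor_components (K : numClosedFieldType) (n : nat)
    (D : set 'rV[K]_n) (G : set 'M[K]_n) (k : nat) (W : 'I_k -> 'M[K]_n) :
  linear_free_divisor D -> associated_group D G -> irreducible_decomposition G W ->
  (forall i j : 'I_k, i != j -> ~ giso G (W i) (W j)) /\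
  [set Z | irreducible_component D Z] #= `I_k.
Proof.
case: n D G W => [|n] D G W D_lfd G_assoc W_dec.
  (* In dimension zero every polynomial is constant, so no equation exists. *)
  have [f [s [f1 _ _]]] := linear_free_divisor_saito D_lfd.
  by move: f1; rewrite (nvar0_mpolyC f) msizeC; case: (_ == _).
have [f [s [_ DE [S]]]] := linear_free_divisor_saito D_lfd.
split=> [i j|]; first exact: (components_not_isomorphic S DE G_assoc W_dec).
exact: (card_irreducible_components S DE G_assoc W_dec).
Qed.

Theorem theorem2p7 (R : realType) (n : nat)
    (D : set 'rV[R[i]]_n) (G : set 'M[R[i]]_n)
    (D_lfd : linear_free_divisor D)
    (G_assoc : associated_group D G)
    (G_red : reductive G)
    (k : nat) (W : 'I_k -> 'M[R[i]]_n)
    (W_dec : irreducible_decomposition G W) :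
  (forall i j : 'I_k, i != j -> ~ giso G (W i) (W j)) /\
  [set Z | irreducible_component D Z] #= `I_k.
Proof.
exact: (@linear_free_divisor_components R[i]).
Qed.
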